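(* Let $\mathfrak F=\{f_u,\ u\in I\}$ be a set of analytic vectors for the operator $A$ in the open region $\mathfrak X\subset\mathbb R^n$, with associated radii $R_u>0$. Fix $u\in I$, let $\widehat p(s,x,u)$ be the solution of the Cauchy problem $\partial_s\widehat p=A\widehat p$, $\widehat p(0,x,u)=f_u(x)$ ($s\ge 0$, $x\in\mathfrak X$), and for $\eta>0$ let $$q_k^{(\eta)}(x,u):=\frac1{k!}\prod_{r=0}^{k-1}(\eta^{-1}A+rI)f_u(x),\qquad k=0,1,2,\dots$$ Then the following statements are equivalent. (i) There exists a constant $R>0$ such that for each $x\in\mathfrak X$ the map $s\mapsto\widehat p(s,x,u)$ has a holomorphic extension to the domain $$G_{R}:=\{z\in\mathbb C:|z|<R\}\cup\{z\in\mathbb C:\operatorname{Re}z>0,\ |\operatorname{Im}z|<R\}.$$ (ii) There exists $\eta_u>0$ such that for each $x\in\mathfrak X$ $$\widehat p(s,x,u)=\sum_{k=0}^\infty q_k^{(\eta_u)}(x,u)\,(1-e^{-\eta_u s})^k,\qquad 0\le s<\infty;$$ moreover, the series converges uniformly for $(x,s)$ running through any compact subset of $\mathfrak X\times\{s\in\mathbb R:0\le s<R_u\}$. (iii) The solution $\widehat p$ is holomorphically extendable to $[0,\infty)$ (i.e. for each $x\in\mathfrak X$, $s\mapsto\widehat p(s,x,u)$ extends holomorphically to a complex neighbourhood of every point of $[0,\infty)$); there exists $\eta_u>0$ such that $$\limsup_{k\to\infty}\sqrt[k]{|q_k^{(\eta_u)}(x,u)|}\le 1,\qquad x\in\mathfrak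 X;$$ and there exists $\varepsilon_u$ with $0<\varepsilon_u<1$ such that the series $\sum_{k=0}^\infty q_k^{(\eta_u)}(x,u)w^k$ converges uniformly for $(x,w)$ running through any compact subset of $\mathfrak X\times\{w\in\mathbb C:|w|<1-\varepsilon_u\}$.
   Context: Setting. $\mathfrak X\subset\mathbb R^n$ is open and $C(\mathfrak X)$ is the space of continuous functions $\mathfrak X\to\mathbb C$ with the topology of uniform convergence on compacta. $A:\mathcal D(A)\subset C(\mathfrak X)\to C(\mathfrak X)$ is the closed linear operator which is the closure of the (closable) operator $A^\sharp$ whose domain consists of the $f\in C^2$ for which $$A^\sharp f(x)=\tfrac12\sum_{i,j}a_{ij}(x)\partial_{x_i}\partial_{x_j}f+\sum_i b_i(x)\partial_{x_i}f+\int_{\mathbb R^n}\Big[f(x+z)-f(x)-\tfrac{\partial f}{\partial x}\cdot z\Big]v(x,dz)$$ exists and is continuous. Here $a=\sigma\sigma^\top$; $b,\sigma,v$ have bounded derivatives of all orders in $x$; $v(x,\cdot)$ is a measure with $v(x,\{0\})=0$ and $\int(|z|^2\wedge|z|)v(x,dz)<\infty$. (For $\mathfrak X\ne\mathbb R^n$ the same operators are considered on $C(\mathfrak X)$ instead of $C(\mathbb R^n)$.) $\mathfrak F=\{f_u,\ u\in I\}$ is a dense family of bounded continuous functions $f_u:\mathbb R^n\to\mathbb C$ with bounded derivatives of all orders. Standing assumption: for each $u\in I$ the Cauchy problem $\partial_s\widehat p(s,x,u)=A\widehat p(s,x,u)$, $\widehat p(0,x,u)=f_u(x)$, $x\in\mathfrak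 X$, has a unique solution (on $[0,\infty)$, and uniqueness holds on each interval $[0,T)$). Analytic vectors. $\mathfrak F$ is a set of analytic vectors for $A$ in $\mathfrak X$ if (1) $A^kf_u$ exists for all $u\in I$, $k\in\mathbb N$; (2) for every $u\in I$ there is $R_u>0$ such that for all $x\in\mathfrak X$, $\sum_{k\ge0}\frac{s^k}{k!}|A^kf_u(x)|<\infty$ for $0\le s<R_u$, the convergence being uniform in $x$ over compact subsets of $\mathfrak X$. $I$ in $\eta^{-1}A+rI$ denotes the identity operator; the empty product is the identity, so $q_0^{(\eta)}=f_u$. *)

(* Defs.v *)
From HB Require Import structures.
From mathcomp Require Import all_boot all_order all_algebra.
From mathcomp Require Import complex.
From mathcomp Require Import all_classical all_reals all_analysis.

Set Implicit Arguments.
Unset Strict Implicit.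
Unset Printing Implicit Defensive.

Import Order.TTheory GRing.Theory Num.Theory.
Import numFieldNormedType.Exports.

Local Open Scope classical_set_scope.
Local Open Scope ring_scope.
Local Open Scope complex_scope.

(** R[i] seen as a numClosedFieldType: the topology of mathcomp-analysis is
    attached to numeric field structures and is not found from R[i] itself. *)
Definition Cplx (R : realType) : numClosedFieldType := R[i].

Definition ofR {R : realType} (r : R) : Cplx R := r%:C.
Definition cRe {R : realType} (z : Cplx R) : R := complex.Re z.
Definition cIm {R : realType} (z : Cplx R) : R := complex.Im z.
Definition cabs {R : realType} (z : Cplx R) : R := ComplexField.Normc.normc z.

Definition holomorphic_on {R : realType} (D : set (Cplx R))
    (F : Cplx R -> Cplx R) : Prop :=
  open D /\ forall z, D z -> derivable F z 1.

Definition uniform_series {K : numFieldType} {T : choiceType} (D : set T)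
    (u : nat -> T -> K) : Prop :=
  exists l : T -> K,
    {uniform D, (fun N y => \sum_(0 <= k < N) u k y) @ \oo --> l}.

Definition continuous_on {T U : topologicalType} (D : set T) (f : T -> U) :
    Prop :=
  forall x, D x -> {for x, continuous f}.

Section euclidean.
Variables (R : realType) (n : nat).
Local Notation Rn := 'rV[R]_n.+1.
Local Notation C := (Cplx R).

Definition borelRn := g_sigma_algebraType (@open Rn).

Definition enorm (z : Rn) : R := Num.sqrt (\sum_i z 0 i ^+ 2).

(** [partial [:: i; j] g] is d_i d_j g. *)
Definition partial (s : seq 'I_n.+1) (g : Rn -> R) : Rn -> R :=
  foldr (fun i h x => 'D_(delta_mx 0 i) h x) g s.

Definition class_C (k : nat) (X : set Rn) (g : Rn -> R) : Prop :=
  forall s : seq 'I_n.+1, (size s <= k)%N ->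
    continuous_on X (partial s g) /\
    ((size s < k)%N ->
      forall (i : 'I_n.+1) x, X x -> derivable (partial s g) x (delta_mx 0 i)).

(** All partial derivatives of order at least 1 exist and are bounded; the
    function itself may be unbounded. *)
Definition bounded_derivatives (g : Rn -> R) : Prop :=
  (forall (s : seq 'I_n.+1) (i : 'I_n.+1) x,
     derivable (partial s g) x (delta_mx 0 i)) /\
  (forall s : seq 'I_n.+1, s != [::] ->
     exists M : R, forall x, `|partial s g x| <= M).

(** Real derivatives of complex-valued functions are taken on the real and
    imaginary parts. *)
Definition cpartial (s : seq 'I_n.+1) (f : Rn -> C) (x : Rn) : C :=
  partial s (cRe \o f) x +i* partial s (cIm \o f) x.

Definition cclass_C (k : nat) (X : set Rn) (f : Rn -> C) : Prop :=
  class_C k X (cRe \o f) /\ class_C k X (cIm \o f).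

Definition bounded_smooth (f : Rn -> C) : Prop :=
  [/\ continuous f,
      exists M : R, forall x, cabs (f x) <= M,
      bounded_derivatives (cRe \o f) & bounded_derivatives (cIm \o f)].

End euclidean.

Section operators.
Variables (R : realType) (n : nat) (X : set 'rV[R]_n.+1).
Local Notation Rn := 'rV[R]_n.+1.
Local Notation C := (Cplx R).

(** The functions Rn -> C with uniform convergence on the compact subsets of X.
    C(X) is the set of those which are continuous on X, where two functions with
    the same values on X represent the same element.  An operator in C(X) is
    given by its graph. *)
Definition CX := {family (compactly_in X), Rn -> C}.
Definition operator := set (CX * CX).

Definition closure_op (A : operator) : operator :=
  [set fg | [/\ continuous_on X (fg.1 : Rn -> C),
                continuous_on X (fg.2 : Rn -> C) &
                closure A fg]].

Definition closable (A : operator) : Prop :=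
  forall f g h : CX, closure_op A (f, g) -> closure_op A (f, h) ->
    forall x, X x -> g x = h x.

Definition dom (A : operator) : set CX := [set f | exists g, A (f, g)].

(** The value of the operator, for f in its domain; it is determined on X when
    the operator is single-valued. *)
Definition app (A : operator) (f : CX) : CX :=
  xget (fun=> 0) [set g | A (f, g)].

Definition dense_family (I : Type) (f : I -> Rn -> C) : Prop :=
  forall g : CX, continuous_on X (g : Rn -> C) ->
    closure (range (f : I -> CX)) g.

(** [d/ds p(s, x) = (A p(s, .))(x)] for s in J and x in X, [p(0, .) = f0] on X.
    The derivative is taken within J, hence it is one-sided at the left end. *)
Definition cauchy_solution (A : operator) (J : set R) (f0 : CX) (p : R -> CX) :
    Prop :=
  (forall x, X x -> p 0 x = f0 x) /\
  (forall s, J s -> dom A (p s) /\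
     forall x, X x ->
       (ofR (t - s)^-1 * (p t x - p s x)) @[t --> within J s^'] -->
         (app A (p s) x : C)).

Definition cauchy_unique (A : operator) (J : set R) (f0 : CX) : Prop :=
  forall p1 p2, cauchy_solution A J f0 p1 -> cauchy_solution A J f0 p2 ->
    forall s x, J s -> X x -> p1 s x = p2 s x.

Definition cauchy_well_posed (A : operator) (f0 : CX) : Prop :=
  [/\ exists p, cauchy_solution A `[0, +oo[ f0 p,
      cauchy_unique A `[0, +oo[ f0 &
      forall T : R, 0 < T -> cauchy_unique A `[0, T[ f0].

Definition analytic_vectors (A : operator) (I : Type) (f : I -> CX)
    (rad : I -> R) : Prop :=
  (forall u k, dom A (iter k (app A) (f u))) /\
  (forall u, 0 < rad u /\
    forall s : R, 0 <= s < rad u ->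
      let term k (x : Rn) : R :=
        s ^+ k / k`!%:R * cabs (iter k (app A) (f u) x) in
      (forall x, X x -> cvgn (series (fun k => term k x))) /\
      (forall K : set Rn, compact K -> K `<=` X -> uniform_series K term)).

(** [prod_(r < k) (eta^-1 A + r I) f] *)
Fixpoint shifted_prod (A : operator) (eta : R) (f : CX) (k : nat) : CX :=
  if k is r.+1 then
    let g := shifted_prod A eta f r in
    fun x => ofR eta^-1 * app A g x + r%:R * g x
  else f.

Definition qcoef (A : operator) (eta : R) (f : CX) (k : nat) (x : Rn) : C :=
  (k`!%:R)^-1 * shifted_prod A eta f k x.

End operators.

Section generator.
Variables (R : realType) (n m : nat) (X : set 'rV[R]_n.+1).
Local Notation Rn := 'rV[R]_n.+1.
Local Notation C := (Cplx R).
Variables (b : Rn -> Rn) (sigma : Rn -> 'M[R]_(n.+1, m)).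
Variable (v : Rn -> {measure set (borelRn R n) -> \bar R}).

Definition jump_weight (z : borelRn R n) : R :=
  Num.min (enorm (z : Rn) ^+ 2) (enorm (z : Rn)).

Definition coefficients_ok : Prop :=
  [/\ forall i, bounded_derivatives (fun x => b x 0 i),
      forall i j, bounded_derivatives (fun x => sigma x i j),
      (forall x, v x [set 0 : Rn] = 0%E) /\
      (forall x, (\int[v x]_z (jump_weight z)%:E < +oo)%E) &
      (* v(x, .) may be infinite near 0, so its dependence on x is expressed by
         the finite measures (|z|^2 /\ |z|) v(x, dz) evaluated on Borel sets *)
      forall B : set (borelRn R n), measurable B ->
        bounded_derivatives
          (fun x => fine (\int[v x]_(z in B) (jump_weight z)%:E)%E)].

Definition jump (f : Rn -> C) (x : Rn) (z : borelRn R n) : C :=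
  f (x + (z : Rn)) - f x - \sum_i cpartial [:: i] f x * ofR ((z : Rn) 0 i).

Definition jump_integrable (f : Rn -> C) (x : Rn) : Prop :=
  (v x).-integrable setT (EFin \o (cRe \o jump f x)) /\
  (v x).-integrable setT (EFin \o (cIm \o jump f x)).

Definition Asharp_expr (f : Rn -> C) (x : Rn) : C :=
  let a := sigma x *m (sigma x)^T in
  ofR 2^-1 * (\sum_i \sum_j ofR (a i j) * cpartial [:: i; j] f x)
  + \sum_i ofR (b x 0 i) * cpartial [:: i] f x
  + (fine (\int[v x]_z (cRe (jump f x z))%:E)%E
     +i* fine (\int[v x]_z (cIm (jump f x z))%:E)%E).

(** The operator A^# in C(X).  The values of f outside of X only occur in
    f(x + z); they are left free, so for A^# to be closable the jumps from X
    must essentially stay in X. *)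
Definition Asharp : operator X :=
  [set fg | [/\ cclass_C 2 X fg.1,
                forall x, X x -> jump_integrable fg.1 x,
                forall x, X x -> fg.2 x = Asharp_expr fg.1 x &
                continuous_on X (fg.2 : Rn -> C)]].

Definition generator : operator X := closure_op Asharp.

End generator.
Arguments Asharp {R n m} X b sigma v.
Arguments generator {R n m} X b sigma v.

Definition disc_strip {R : realType} (r : R) : set (Cplx R) :=
  [set z | cabs z < r] `|` [set z | 0 < cRe z /\ `|cIm z| < r].

Section assertions.
Variables (R : realType) (n : nat) (X : set 'rV[R]_n.+1).
Local Notation Rn := 'rV[R]_n.+1.
Local Notation C := (Cplx R).
Variables (A : operator X) (f0 : CX X) (rho : R) (p : R -> CX X).

Definition strip_extension : Prop :=
  exists r : R, 0 < r /\
    forall x, X x ->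
      exists F : C -> C, holomorphic_on (disc_strip r) F /\
        forall s : R, 0 <= s -> F (ofR s) = p s x.

Definition exponential_expansion : Prop :=
  exists eta : R, 0 < eta /\
    (forall x, X x -> forall s : R, 0 <= s ->
       series (fun k => qcoef A eta f0 k x * ofR (1 - expR (- eta * s)) ^+ k)
         @ \oo --> (p s x : C)) /\
    (forall K : set (Rn * R), compact K ->
       K `<=` [set y | X y.1 /\ 0 <= y.2 < rho] ->
       uniform_series K (fun k y =>
         qcoef A eta f0 k y.1 * ofR (1 - expR (- eta * y.2)) ^+ k)).

Definition holomorphically_extendable : Prop :=
  forall x, X x -> forall s0 : R, 0 <= s0 ->
    exists (D : set C) (F : C -> C),
      [/\ D (ofR s0), holomorphic_on D F &
          forall s : R, 0 <= s -> D (ofR s) -> F (ofR s) = p s x].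

Definition unit_disc_expansion : Prop :=
  holomorphically_extendable /\
  exists eta : R, 0 < eta /\
    (forall x, X x ->
       (limn_esup (fun k => (cabs (qcoef A eta f0 k x) `^ k%:R^-1)%:E)
          <= 1)%E) /\
    exists eps : R, 0 < eps < 1 /\
      forall K : set (Rn * C), compact K ->
        K `<=` [set y | X y.1 /\ cabs y.2 < 1 - eps] ->
        uniform_series K (fun k y => qcoef A eta f0 k y.1 * y.2 ^+ k).

End assertions.
Arguments strip_extension {R n} X p.

(* Main.v *)
(* Write [a_j = A^j f_u (x)].  Because [A] is linear, closed and single-valued on
   [X], and the Cauchy problem is uniquely solvable on [[0, R_u[], the solution is
   [p (s, x) = sum_j a_j s^j / j!] there, and [q_k] depends on the sequence [a]
   alone.  Substituting [w = 1 - exp (- eta s)], i.e. [s = - log (1 - w) / eta],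
   turns this power series into [sum_k q_k w^k]: the coefficients of the composite
   obey the same recursion as the [q_k], and for nonnegative [a] all terms are
   nonnegative, which bounds [|q_k| w^k] locally uniformly in [x].
   The map [w |-> - log (1 - w) / eta] sends the unit disc into [G_R] for [eta]
   large, so an extension to [G_R] gives a holomorphic function on the unit disc,
   whose Taylor series at [0] is [sum_k q_k w^k].  Conversely [1 - exp (- eta z)]
   maps [G_R] into the unit disc for [R] small, and (iii) is tied to (ii) by the
   root test and by analytic continuation along the half-line.
   Since holomorphy only means complex differentiability, Taylor expansion is
   proved here by Goursat's bisection on the images of rectangles under
   [(t, theta) |-> z + t (r exp (i theta) - z)], which contract a circle to [z]. *)

Require Import Defs.
From HB Require Import structures.
From mathcomp Require Import all_boot all_order all_algebra.
From mathcomp Require Import complex ring lra.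
From mathcomp Require Import all_classical all_reals all_analysis.

Set Implicit Arguments.
Unset Strict Implicit.
Unset Printing Implicit Defensive.

Import Order.TTheory GRing.Theory Num.Theory.
Import numFieldNormedType.Exports.

Local Open Scope classical_set_scope.
Local Open Scope ring_scope.

(** * Complex numbers as pairs of reals *)

Section modulus.
Variable R : realType.
Implicit Types (z w : Cplx R) (r s : R).

(** The $q_k^{(\eta)}$ are products of operators, while the assertions concern one complex variable
    at a fixed $x$. On the orbit $a_j = A^j f_u(x)$ the operator acts as the shift $S$, and the
    composite $H_a(w) = \sum_j a_j (-\eta^{-1}\log(1-w))^j/j!$ satisfies $(1-w) H_a' = \eta^{-1}
    H_{Sa}$. In coefficients this is $(k+1) q_{k+1}(a) = \eta^{-1} q_k(Sa) + k q_k(a)$. No series is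
    ever composed or rearranged: each function has a Taylor series by Cauchy's theorem, and
    coefficients are identified by uniqueness on a real interval. Uniformity in $x$ rests on the
    single bound $|q_k| (1-e^{-\eta s})^k \le \sum_j |a_j| s^j/j!$ for $s < R_u$, whose right side
    is bounded on compacta. The width of the strip and $\eta$ are inversely proportional:
    $-\log(1-w)$ sends the unit disc into $\Re > -1$, $|\Im| < 2$, whence $\eta = 3/R$; backwards,
    $|1-e^{-z}| < 1$ on some fixed $G_d$, whence $R = d/\eta$. *)

Lemma cabs_ge0 z : 0 <= cabs z.
Proof. by rewrite /cabs; case: z => a b /=; rewrite sqrtr_ge0. Qed.

Lemma cabs0 : cabs (0 : Cplx R) = 0. Proof. exact: ComplexField.Normc.normc0. Qed.

Lemma cabs1 : cabs (1 : Cplx R) = 1. Proof. exact: ComplexField.Normc.normc1. Qed.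

Lemma cabs_eq0 z : cabs z = 0 -> z = 0. Proof. exact: ComplexField.Normc.eq0_normc. Qed.

Lemma cabsM z w : cabs (z * w) = cabs z * cabs w.
Proof. exact: ComplexField.Normc.normcM. Qed.

Lemma cabsV z : cabs z^-1 = (cabs z)^-1.
Proof. exact: ComplexField.Normc.normcV. Qed.

Lemma cabsD z w : cabs (z + w) <= cabs z + cabs w.
Proof. exact: le_normcD. Qed.

Lemma cabsN z : cabs (- z) = cabs z.
Proof. exact: normcN. Qed.

Lemma cabsC z w : cabs (z - w) = cabs (w - z).
Proof. by rewrite -cabsN opprB. Qed.

Lemma cabsB z w : cabs (z - w) <= cabs z + cabs w.
Proof. by rewrite -(cabsN w) cabsD. Qed.

Lemma cabs_tri x z w : cabs (z - w) <= cabs (z - x) + cabs (x - w).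
Proof. by rewrite (_ : z - w = (z - x) + (x - w)) ?cabsD //; ring. Qed.

Lemma cabs_ger z w : cabs z - cabs w <= cabs (z - w).
Proof. by rewrite lerBlDr (le_trans _ (cabsD _ _)) // subrK. Qed.

Lemma cabsX z k : cabs (z ^+ k) = cabs z ^+ k.
Proof.
by elim: k => [|k IH]; rewrite ?expr0 ?cabs1 // !exprS cabsM IH.
Qed.

Lemma cabs_ofR r : cabs (ofR r) = `|r|.
Proof. by rewrite /cabs /ofR /= expr0n /= addr0 sqrtr_sqr. Qed.

Lemma normE z : `|z| = ofR (cabs z).
Proof. by []. Qed.

Lemma cabs_gt0 z : (0 < cabs z) = (z != 0).
Proof.
apply/idP/idP => [|z0]; first by apply: contraTneq => ->; rewrite cabs0 ltxx.
by rewrite lt_def cabs_ge0 andbT; apply: contra_neq z0; exact: cabs_eq0.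
Qed.

Lemma cabs_sum (I : Type) (s : seq I) (P : pred I) (F : I -> Cplx R) :
  cabs (\sum_(i <- s | P i) F i) <= \sum_(i <- s | P i) cabs (F i).
Proof.
elim/big_rec2: _ => [|i y x _ h]; first by rewrite cabs0.
by apply: le_trans (cabsD _ _) _; rewrite lerD2l.
Qed.

Lemma ofR1 : ofR (1 : R) = 1. Proof. by []. Qed.
Lemma ofRD r s : ofR (r + s) = ofR r + ofR s.
Proof. exact: (rmorphD (real_complex R)). Qed.
Lemma ofRN r : ofR (- r) = - ofR r.
Proof. exact: (rmorphN (real_complex R)). Qed.
Lemma ofRB r s : ofR (r - s) = ofR r - ofR s.
Proof. exact: (rmorphB (real_complex R)). Qed.
Lemma ofRM r s : ofR (r * s) = ofR r * ofR s.
Proof. exact: (rmorphM (real_complex R)). Qed.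
Lemma ofRX r k : ofR (r ^+ k) = ofR r ^+ k.
Proof. exact: (rmorphXn (real_complex R)). Qed.
Lemma ofRV r : ofR r^-1 = (ofR r)^-1.
Proof. exact: (fmorphV (real_complex R)). Qed.
Lemma ofR_nat k : ofR (k%:R : R) = k%:R.
Proof. exact: (rmorph_nat (real_complex R)). Qed.

Lemma cabs_nat k : cabs (k%:R : Cplx R) = k%:R.
Proof. by rewrite -ofR_nat cabs_ofR ger0_norm. Qed.

Lemma cReD z w : cRe (z + w) = cRe z + cRe w. Proof. by case: z; case: w. Qed.
Lemma cImD z w : cIm (z + w) = cIm z + cIm w. Proof. by case: z; case: w. Qed.
Lemma cReN z : cRe (- z) = - cRe z. Proof. by case: z. Qed.
Lemma cImN z : cIm (- z) = - cIm z. Proof. by case: z. Qed.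
Lemma cReB z w : cRe (z - w) = cRe z - cRe w. Proof. by rewrite cReD cReN. Qed.
Lemma cImB z w : cIm (z - w) = cIm z - cIm w. Proof. by rewrite cImD cImN. Qed.
Lemma cReM z w : cRe (z * w) = cRe z * cRe w - cIm z * cIm w.
Proof. by case: z; case: w. Qed.
Lemma cImM z w : cIm (z * w) = cRe z * cIm w + cIm z * cRe w.
Proof. by case: z; case: w. Qed.
Lemma cRe_ofRM r z : cRe (ofR r * z) = r * cRe z.
Proof. by rewrite cReM /= mul0r subr0. Qed.
Lemma cIm_ofRM r z : cIm (ofR r * z) = r * cIm z.
Proof. by rewrite cImM /= mul0r addr0. Qed.

Lemma cRe_sum (I : Type) (s : seq I) (P : pred I) (F : I -> Cplx R) :
  cRe (\sum_(i <- s | P i) F i) = \sum_(i <- s | P i) cRe (F i).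
Proof. by elim/big_rec2: _ => // i y x _ <-; rewrite cReD. Qed.
Lemma cIm_sum (I : Type) (s : seq I) (P : pred I) (F : I -> Cplx R) :
  cIm (\sum_(i <- s | P i) F i) = \sum_(i <- s | P i) cIm (F i).
Proof. by elim/big_rec2: _ => // i y x _ <-; rewrite cImD. Qed.

Lemma complex_eq z w : cRe z = cRe w -> cIm z = cIm w -> z = w.
Proof. by case: z => a b; case: w => c d /= -> ->. Qed.

Lemma normr_cRe z : `|cRe z| <= cabs z.
Proof.
case: z => a b; rewrite /cabs /= -sqrtr_sqr.
by rewrite ler_wsqrtr// lerDl sqr_ge0.
Qed.

Lemma normr_cIm z : `|cIm z| <= cabs z.
Proof.
case: z => a b; rewrite /cabs /= -sqrtr_sqr.
by rewrite ler_wsqrtr// lerDr sqr_ge0.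
Qed.

Definition iC : Cplx R := 'i%C.

Lemma cabs_iC : cabs iC = 1.
Proof. by rewrite /cabs /= expr0n expr1n /= add0r sqrtr1. Qed.

Lemma complex_split z : z = ofR (cRe z) + iC * ofR (cIm z).
Proof. exact: complexE. Qed.

Lemma cabs_ReIm z : cabs z <= `|cRe z| + `|cIm z|.
Proof.
rewrite {1}(complex_split z); apply: le_trans (cabsD _ _) _.
by rewrite cabsM cabs_iC mul1r !cabs_ofR.
Qed.

(** Complex numbers are comparable only when their imaginary parts agree, so a positive complex
    number is real. This turns the complex radii in the topology of [Cplx R] into real ones. *)
Lemma gt0_ofR z : 0 < z -> z = ofR (cRe z) /\ 0 < cRe z.
Proof.
rewrite ltcE => /andP[/eqP z0 Rz0]; split; last exact: Rz0.
by apply: complex_eq => //; exact: z0.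
Qed.

Lemma cvg_cabsP (T : Type) (F : set_system T) (f : T -> Cplx R) (l : Cplx R) :
  Filter F ->
  (f x @[x --> F] --> l) <->
  (forall e : R, 0 < e -> \forall x \near F, cabs (f x - l) < e).
Proof.
move=> FF; split => [/cvgrPdist_lt fl e e0|fl].
  have e0' : 0 < ofR e by rewrite /ofR ltcR.
  near=> x; rewrite cabsC -ltcR -/(ofR _) -normE.
  by near: x; exact: fl.
apply/cvgrPdist_lt => e e0.
have [eE e0'] := gt0_ofR e0.
near=> x; rewrite normE eE /ofR ltcR cabsC.
by near: x; exact: fl.
Unshelve. all: by end_near. Qed.

Lemma near_dnbhs_cabsP (P : Cplx R -> Prop) (z : Cplx R) :
  (\forall w \near z, P w) <->
  (exists2 d : R, 0 < d & forall w, cabs (w - z) < d -> P w).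
Proof.
split=> [/nbhs_ballP[e /= e0 he]|[d d0 hd]].
  have [eE e0'] := gt0_ofR e0.
  exists (cRe e) => // w wz; apply: he.
  by rewrite /ball /= normE eE /ofR ltcR cabsC.
apply/nbhs_ballP; exists (ofR d) => /=; first by rewrite /ofR ltcR.
move=> w; rewrite /ball /= normE /ofR ltcR cabsC; exact: hd.
Qed.

End modulus.

(** * Power series *)

Section power_series.
Variable R : realType.
Implicit Types (c d : nat -> Cplx R) (z w h : Cplx R) (r s : R).

Lemma cabs_cvg_le (T : Type) (F : set_system T) (f : T -> Cplx R) l B :
  ProperFilter F -> f x @[x --> F] --> l ->
  (\forall x \near F, cabs (f x) <= B) -> cabs l <= B.
Proof.
move=> FF fl fB; apply/ler_addgt0Pr => e e0.
have [x [h1 h2]] : exists x, cabs (f x) <= B /\ cabs (f x - l) < e.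
  apply: (@filter_ex _ F); near=> x; split; near: x => //.
  by move/cvg_cabsP : fl; exact.
rewrite (_ : l = f x - (f x - l)); last by ring.
by apply: le_trans (cabsB _ _) _; rewrite lerD// ltW.
Unshelve. all: by end_near. Qed.

Lemma geometric_partial_le (q : R) N n : 0 <= q < 1 ->
  \sum_(N <= k < n) q ^+ k <= q ^+ N / (1 - q).
Proof.
move=> /andP[q0 q1]; rewrite ler_pdivlMr ?subr_gt0//.
have [Nn|/ltnW nN] := leqP N n; last by rewrite big_geq// mul0r exprn_ge0.
rewrite -(subnKC Nn); elim: (n - N)%N => [|m IH].
  by rewrite addn0 big_geq// mul0r exprn_ge0.
have {}IH : (\sum_(N <= k < N + m) q ^+ k) * (1 - q) = q ^+ N - q ^+ (N + m).
  elim: m {IH} => [|m IH]; first by rewrite addn0 big_geq// mul0r subrr.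
  by rewrite addnS big_nat_recr ?leq_addr//= mulrDl IH exprS; ring.
rewrite addnS big_nat_recr ?leq_addr//= mulrDl IH.
have := exprn_ge0 (N + m) q0; have := exprn_ge0 (N + m).+1 q0; rewrite exprS.
by nra.
Qed.

(** Real and imaginary parts are dominated by a geometric series. The tail bound depends only on [M]
    and [q], which is what later gives uniformity in $x$. *)
Lemma geometric_series_cvg (u : nat -> Cplx R) (M q : R) : 0 <= q < 1 ->
  (forall k, cabs (u k) <= M * q ^+ k) ->
  series u @ \oo --> limn (series u) /\
  forall N, cabs (limn (series u) - series u N) <= M * q ^+ N / (1 - q).
Proof.
move=> q01 uM; have /andP[q0 q1] := q01.
have M0 : 0 <= M by have := uM 0; rewrite expr0 mulr1; exact: le_trans (cabs_ge0 _).
have part (v : nat -> R) : (forall k, `|v k| <= M * q ^+ k) -> cvgn (series v).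
  move=> vM; apply: normed_cvg; apply: (series_le_cvg _ _ vM) => //=.
  - by move=> k; rewrite mulr_ge0// exprn_ge0.
  - by apply: is_cvg_geometric_series; rewrite ger0_norm.
have cre := part (cRe \o u) (fun k => le_trans (normr_cRe _) (uM k)).
have cim := part (cIm \o u) (fun k => le_trans (normr_cIm _) (uM k)).
have cu : cvgn (series u).
  apply/cvg_ex; exists (ofR (limn (series (cRe \o u))) + iC R * ofR (limn (series (cIm \o u)))).
  apply/cvg_cabsP => e e0; near=> n.
  rewrite -[X in X - _]/(series u n) (complex_split (series u n)).
  rewrite (_ : _ - _ = ofR (cRe (series u n) - limn (series (cRe \o u))) +
     iC R * ofR (cIm (series u n) - limn (series (cIm \o u)))); last first.
    by rewrite !ofRB; ring.
  apply: le_lt_trans (cabsD _ _) _; rewrite cabsM cabs_iC mul1r !cabs_ofR.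
  rewrite [ltRHS](splitr e) ltrD// distrC.
    rewrite /series/= cRe_sum; near: n.
    by move/cvgrPdist_lt : cre; apply; rewrite divr_gt0.
  rewrite /series/= cIm_sum; near: n.
  by move/cvgrPdist_lt : cim; apply; rewrite divr_gt0.
split=> // N; apply: (@cabs_cvg_le _ \oo (fun n => series u n - series u N)).
  exact: (cvgB cu (cvg_cst _)).
exists N => // n /= Nn; rewrite /series/= (big_cat_nat (leq0n N) Nn)/= [X in cabs X]addrC addKr.
apply: le_trans (cabs_sum _ _ _) _.
apply: (@le_trans _ _ (\sum_(N <= k < n) M * q ^+ k)); first exact: ler_sum.
by rewrite -mulr_sumr -mulrA ler_wpM2l// geometric_partial_le.
Unshelve. all: by end_near. Qed.

(* junk unless the series converges *)
Definition pval c z : Cplx R := limn (series (fun k => c k * z ^+ k)).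

(** Radius of convergence at least [r0], encoded by Abel's condition of bounded terms at every
    smaller radius: such bounds are easier to transport than convergence itself. *)
Definition converges_in c r0 : Prop :=
  forall r, 0 < r < r0 -> exists M, forall k, cabs (c k) * r ^+ k <= M.

Lemma coef_geometric c r M z : 0 < r -> (forall k, cabs (c k) * r ^+ k <= M) ->
  forall k, cabs (c k * z ^+ k) <= M * (cabs z / r) ^+ k.
Proof.
move=> r0 cM k; rewrite cabsM cabsX expr_div_n.
have rk : 0 < r ^+ k by rewrite exprn_gt0.
rewrite (_ : _ * _ = cabs (c k) * r ^+ k * (cabs z ^+ k / r ^+ k)).
  by rewrite ler_wpM2r// divr_ge0 ?exprn_ge0 ?cabs_ge0// ltW.
by field; rewrite gt_eqF.
Qed.

Lemma ratio_lt1 z r : cabs z < r -> 0 <= cabs z / r < 1.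
Proof.
move=> zr; have r0 := le_lt_trans (cabs_ge0 z) zr.
by rewrite divr_ge0 ?cabs_ge0 ?(ltW r0)//= ltr_pdivrMr// mul1r.
Qed.

Lemma pval_tail c r M z : cabs z < r -> (forall k, cabs (c k) * r ^+ k <= M) ->
  forall N, cabs (pval c z - series (fun k => c k * z ^+ k) N) <=
    M * (cabs z / r) ^+ N / (1 - cabs z / r).
Proof.
move=> zr cM N; have r0 := le_lt_trans (cabs_ge0 z) zr.
by have [_ h] := geometric_series_cvg (ratio_lt1 zr) (coef_geometric z r0 cM); exact: h.
Qed.

Lemma mid_radius z r : cabs z < r -> exists2 s, 0 < s < r & cabs z < s.
Proof.
move=> zr; exists ((cabs z + r) / 2); have := cabs_ge0 z; lra.
Qed.

Lemma pval_cvg c r z : converges_in c r -> cabs z < r ->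
  series (fun k => c k * z ^+ k) @ \oo --> pval c z.
Proof.
move=> cr /mid_radius[s /[dup] /andP[s0 _] /cr[M cM] zs].
by have [h _] := geometric_series_cvg (ratio_lt1 zs) (coef_geometric z s0 cM); exact: h.
Qed.

Lemma pval_unique c z l : series (fun k => c k * z ^+ k) @ \oo --> l -> pval c z = l.
Proof. by move=> h; apply: cvg_lim => //; exact: norm_hausdorff. Qed.

Lemma pval0 c : pval c 0 = c 0.
Proof.
apply: pval_unique; apply/cvg_cabsP => e e0; exists 1 => // -[//|n] _ /=.
rewrite /series/= big_nat_recl//= expr0 mulr1 big1 ?addr0 ?subrr ?cabs0// => i _.
by rewrite expr0n mulr0.
Qed.

Lemma series_term_cvg0 (u : nat -> Cplx R) : cvgn (series u) -> u @ \oo --> (0 : Cplx R).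
Proof. exact: cvg_series_cvg_0. Qed.

Lemma cvg_bounded (u : nat -> Cplx R) (l : Cplx R) : u @ \oo --> l ->
  exists M, forall k, cabs (u k) <= M.
Proof.
move=> /cvg_cabsP /(_ 1 ltr01) [N _ hN].
exists (cabs l + 1 + \sum_(0 <= k < N) cabs (u k)) => k.
have s0 (m : nat) : 0 <= \sum_(0 <= k < m) cabs (u k) by apply: sumr_ge0 => i _; exact: cabs_ge0.
have [kN|Nk] := ltnP k N; last first.
  rewrite -[leLHS]addr0 lerD// -lerBlDl ltW//.
  exact: le_lt_trans (cabs_ger _ _) (hN _ Nk).
rewrite -[leLHS]add0r lerD//; first by rewrite addr_ge0// cabs_ge0.
rewrite big_mkord (bigD1 (Ordinal kN))//= lerDl.
by apply: sumr_ge0 => i _; exact: cabs_ge0.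
Qed.

(** The terms of a convergent series tend to 0, hence are bounded; positive real points suffice
    because only the modulus of the point enters the condition. *)
Lemma converges_in_cvg c r0 :
  (forall s, 0 < s < r0 -> cvgn (series (fun k => c k * ofR s ^+ k))) ->
  converges_in c r0.
Proof.
move=> h r /[dup] /andP[r0' _] /h /series_term_cvg0 /cvg_bounded[M hM].
by exists M => k; have := hM k; rewrite cabsM cabsX cabs_ofR gtr0_norm.
Qed.

Definition dcoef c (k : nat) : Cplx R := k.+1%:R * c k.+1.

(** In the factorization of $s^{k+1} - r^{k+1}$ each of the $k+1$ summands is at least $r^k$. The
    inequality absorbs the factor $k+1$ produced by differentiation, at the price of a smaller
    radius. *)
Lemma bernoulli_pow r s k : 0 <= r <= s -> k.+1%:R * r ^+ k * (s - r) <= s ^+ k.+1.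
Proof.
move=> /andP[r0 rs].
have -> : s ^+ k.+1 = (s - r) * (\sum_(i < k.+1) s ^+ (k - i) * r ^+ i) + r ^+ k.+1.
  by rewrite -subrXX subrK.
apply: (@le_trans _ _ ((s - r) * (\sum_(i < k.+1) r ^+ k))).
  by rewrite sumr_const card_ord -mulr_natl; lra.
rewrite -[leLHS]addr0 lerD ?exprn_ge0//; apply: ler_wpM2l; first by rewrite subr_ge0.
apply: ler_sum => i _; rewrite -{1}(subnK (_ : (i <= k)%N)); last by rewrite -ltnS.
rewrite exprD ler_wpM2r ?exprn_ge0// lerXn2r// nnegrE//.
exact: le_trans rs.
Qed.

Lemma dcoef_bound c r s M : 0 <= r < s -> (forall k, cabs (c k) * s ^+ k <= M) ->
  forall k, cabs (dcoef c k) * r ^+ k <= M / (s - r).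
Proof.
move=> /andP[r0 rs] cM k; rewrite ler_pdivlMr ?subr_gt0//.
rewrite cabsM cabs_nat; apply: le_trans (cM k.+1).
rewrite (_ : _ * _ * _ * _ = cabs (c k.+1) * (k.+1%:R * r ^+ k * (s - r))); last by ring.
by rewrite ler_wpM2l ?cabs_ge0// bernoulli_pow// r0 ltW.
Qed.

Lemma converges_in_dcoef c r0 : converges_in c r0 -> converges_in (dcoef c) r0.
Proof.
move=> cr r /andP[r0' rr0].
have [|M hM] := cr ((r + r0) / 2); first by lra.
by exists (M / ((r + r0) / 2 - r)); apply: dcoef_bound => //; lra.
Qed.

(** A first-order expansion with real tolerances and no quotient, so that [h = 0] needs no exception
    and the derivative is an explicit argument. *)
Definition cdiff (f : Cplx R -> Cplx R) z (l : Cplx R) : Prop :=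
  forall e : R, 0 < e -> exists2 d : R, 0 < d &
    forall h, cabs h < d -> cabs (f (z + h) - f z - l * h) <= e * cabs h.

(** The bound is quadratic in [h] and only geometric in [k], so after multiplication by coefficients
    it can be summed over [k] whenever [cabs z + d] lies inside the disc of convergence. *)
Lemma pow_taylor1 z h (d : R) k : 0 < d -> cabs h <= d ->
  cabs ((z + h) ^+ k - z ^+ k - k%:R * h * z ^+ k.-1) <=
  (cabs h / d) ^+ 2 * (cabs z + d) ^+ k.
Proof.
move=> d0 hd.
have H0 := cabs_ge0 h; have Z0 := cabs_ge0 z.
have q0 : 0 <= cabs h / d by rewrite divr_ge0// ltW.
have A1 j : 0 <= (cabs z + d) ^+ j by rewrite exprn_ge0// addr_ge0// ltW.
have hE : cabs h = cabs h / d * d by rewrite mulfVK// gt_eqF.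
have q1 : cabs h / d <= 1 by rewrite ler_pdivrMr// mul1r.
set q := cabs h / d in hE q0 q1 *.
(* the induction needs the first-order remainder as well *)
suff [] : cabs ((z + h) ^+ k - z ^+ k) <= q * (cabs z + d) ^+ k /\
  cabs ((z + h) ^+ k - z ^+ k - k%:R * h * z ^+ k.-1) <= q ^+ 2 * (cabs z + d) ^+ k by [].
elim: k => [|k [IH1 IH2]].
  by rewrite !expr0 subrr mul0r mul0r subr0 cabs0 mulr1 mulr1 q0 exprn_ge0.
have zk : cabs (z ^+ k) <= (cabs z + d) ^+ k.
  by rewrite cabsX; apply: lerXn2r; rewrite ?nnegrE ?lerDl ?addr_ge0 ?(ltW d0).
split.
  rewrite (_ : _ - _ = (z + h) * ((z + h) ^+ k - z ^+ k) - - (h * z ^+ k)); last by rewrite !exprS; ring.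
  rewrite (_ : _ - - _ = z * ((z + h) ^+ k - z ^+ k) + (h * (z + h) ^+ k)); last by ring.
  apply: le_trans (cabsD _ _) _; rewrite !cabsM exprS.
  have : cabs ((z + h) ^+ k) <= (cabs z + d) ^+ k.
    rewrite cabsX; apply: lerXn2r; rewrite ?nnegrE ?cabs_ge0 ?addr_ge0 ?(ltW d0)//.
    by apply: le_trans (cabsD _ _) _; rewrite lerD2l.
  move=> zhk; rewrite mulrDl mulrDr lerD//.
    by rewrite (mulrCA q) ler_wpM2l.
  by rewrite {1}hE mulrA ler_wpM2l// mulr_ge0// ltW.
rewrite (_ : _ - _ = z * ((z + h) ^+ k - z ^+ k - k%:R * h * z ^+ k.-1) +
   h * ((z + h) ^+ k - z ^+ k)); last first.
  case: k {IH1 IH2 zk} => [|k]; first by rewrite /= !expr0 !expr1; ring.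
  by rewrite /= -[k.+2%:R]natr1 !exprS; ring.
apply: le_trans (cabsD _ _) _; rewrite !cabsM [(cabs z + d) ^+ _]exprS mulrDl mulrDr lerD//.
  by rewrite (mulrCA (q ^+ 2)) ler_wpM2l.
rewrite {1}hE expr2 (_ : q * q * _ = q * d * (q * (cabs z + d) ^+ k)); last by ring.
by rewrite ler_wpM2l// mulr_ge0// ltW.
Qed.

Lemma pval_cdiff c r z : converges_in c r -> cabs z < r ->
  cdiff (pval c) z (pval (dcoef c) z).
Proof.
move=> cr zr.
(* The gap between [cabs z] and [r] is cut into three pieces of length [d]: [z + h] stays below
   [cabs z + d], and the coefficients are bounded at [r2 = cabs z + 2 * d], so that [q < 1]. *)
set r2 := (cabs z + 2 * r) / 3; set d := (r - cabs z) / 3.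
have Z0 := cabs_ge0 z.
have d0 : 0 < d by rewrite /d; lra.
have r20 : 0 < r2 < r by rewrite /r2; lra.
have [M cM] := cr _ r20.
set q := (cabs z + d) / r2.
have q01 : 0 <= q < 1.
  rewrite /q divr_ge0 ?ler_pdivrMr ?ltr_pdivrMr//; try by rewrite /r2 /d; lra.
set K := M / (1 - q) / d ^+ 2.
have M0 : 0 <= M by have := cM 0; rewrite expr0 mulr1; apply: le_trans (cabs_ge0 _).
have K0 : 0 <= K by rewrite !mulr_ge0 ?invr_ge0 ?exprn_ge0//; lra.
have main h : cabs h < d ->
    cabs (pval c (z + h) - pval c z - pval (dcoef c) z * h) <= K * cabs h ^+ 2.
  move=> hd.
  have zh : cabs (z + h) < r by apply: le_lt_trans (cabsD _ _) _; move: hd; rewrite /d; lra.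
  pose S c z n := series (fun k => c k * z ^+ k) n.
  (* [n.+1] terms of the series go with [n] terms of its derivative, because [dcoef] drops the
     constant term. *)
  apply: (@cabs_cvg_le _ \oo (fun n => S c (z + h) n.+1 - S c z n.+1 - S (dcoef c) z n * h)).
    apply: cvgB; first apply: cvgB.
    - by rewrite (cvg_shiftS (S c (z + h))); exact: pval_cvg cr _.
    - by rewrite (cvg_shiftS (S c z)); exact: pval_cvg cr _.
    - by apply: cvgMr_tmp; exact: (pval_cvg (converges_in_dcoef cr)).
  apply: nearW => n.
  have -> : S c (z + h) n.+1 - S c z n.+1 - S (dcoef c) z n * h =
    \sum_(0 <= k < n.+1) c k * ((z + h) ^+ k - z ^+ k - k%:R * h * z ^+ k.-1).
    rewrite /S /series /= [RHS](eq_bigr (fun k => c k * (z + h) ^+ k - c k * z ^+ k -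
       c k * (k%:R * h * z ^+ k.-1))); last by move=> k _; ring.
    rewrite !sumrB; congr (_ - _); rewrite [RHS]big_nat_recl// mul0r mul0r mulr0 add0r.
    by rewrite mulr_suml; apply: eq_bigr => k _; rewrite /dcoef /=; ring.
  apply: le_trans (cabs_sum _ _ _) _.
  apply: (@le_trans _ _ (\sum_(0 <= k < n.+1) (cabs h / d) ^+ 2 * M * q ^+ k)).
    apply: ler_sum => k _; rewrite cabsM.
    apply: (@le_trans _ _ (cabs (c k) * ((cabs h / d) ^+ 2 * (cabs z + d) ^+ k))).
      by rewrite ler_wpM2l ?cabs_ge0// pow_taylor1// ltW.
    have ck : cabs (c k) * (cabs z + d) ^+ k <= M * q ^+ k.
      have z1 : 0 <= cabs z + d by rewrite addr_ge0// ltW.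
      have := coef_geometric (ofR (cabs z + d)) (andP r20).1 cM k.
      by rewrite cabsM cabsX cabs_ofR ger0_norm.
    rewrite mulrCA -mulrA ler_wpM2l ?exprn_ge0//.
    by rewrite divr_ge0 ?cabs_ge0 ?(ltW d0).
  rewrite -mulr_sumr; apply: (@le_trans _ _ ((cabs h / d) ^+ 2 * M * (q ^+ 0 / (1 - q)))).
    apply: ler_wpM2l; last exact: geometric_partial_le.
    by rewrite mulr_ge0// exprn_ge0// divr_ge0 ?cabs_ge0// ltW.
  by rewrite le_eqVlt /K expr0 expr_div_n; apply/orP; left; apply/eqP; field; lra.
move=> e e0; exists (Num.min d (e / (K + 1))).
  by rewrite lt_min d0 divr_gt0// ltr_wpDl.
move=> h; rewrite lt_min => /andP[hd he]; apply: le_trans (main _ hd) _.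
rewrite expr2 mulrA ler_wpM2r ?cabs_ge0//.
move: he; rewrite ltr_pdivlMr ?ltr_wpDl// => he.
by have := cabs_ge0 h; nra.
Qed.

End power_series.

(** * Identity theorem for power series *)

Section uniqueness.
Variable R : realType.
Implicit Types (c d : nat -> Cplx R) (z w h : Cplx R) (r s : R).

(** If all coefficients below [k] vanish, a zero [w] leaves $|c_k| |w|^k$ equal to a tail of order
    $|w|^{k+1}$, which is impossible for small [w] unless $c_k = 0$. *)
Lemma pval_zeros c (r0 : R) : 0 < r0 -> converges_in c r0 ->
  (forall e : R, 0 < e -> exists2 w, 0 < cabs w < e & pval c w = 0) ->
  forall k, c k = 0.
Proof.
move=> r00 cr zeros.
have r01 : 0 < r0 / 2 < r0 by lra.
have [M cM] := cr _ r01; have /andP[r1 _] := r01.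
set r := r0 / 2 in cM r1.
have M0 : 0 <= M by have := cM 0; rewrite expr0 mulr1; apply: le_trans (cabs_ge0 _).
elim/ltn_ind => k IH; apply: contrapT => /eqP; rewrite -cabs_gt0 => ck0.
(* Below [r / 2] the denominator of the tail is at least 1/2, which gives the factor 2. The other
   bound is what contradicts [cabs (c k) * r ^+ k.+1 <= 2 * M * cabs w]; the [+ 1] covers
   [M = 0]. *)
have [] := zeros (Num.min (r / 2) (cabs (c k) * r ^+ k.+1 / (2 * M + 1))).
  rewrite lt_min !divr_gt0// ?mulr_gt0 ?exprn_gt0//; lra.
move=> w; rewrite lt_min => /andP[w0 /andP[wr wc]] pw.
have wr1 : cabs w < r by lra.
have := pval_tail wr1 cM k.+1.
rewrite pw sub0r cabsN /series/= big_nat_recr//= big1_seq ?add0r; last first.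
  by move=> i; rewrite mem_index_iota => /IH ->; rewrite mul0r.
rewrite cabsM cabsX => h.
set q := cabs w / r in h.
have q2 : q <= 1 / 2 by rewrite /q ler_pdivrMr//; lra.
have q0 : 0 <= q by rewrite divr_ge0 ?cabs_ge0 ?(ltW r1).
have {}h : cabs (c k) * cabs w ^+ k <= 2 * M * q ^+ k.+1.
  apply: le_trans h _; rewrite ler_pdivrMr; last by lra.
  have := exprn_ge0 k.+1 q0; set y := q ^+ _ => y0; have : 0 <= M * y by rewrite mulr_ge0.
  by nra.
have {}h : cabs (c k) * r ^+ k.+1 <= 2 * M * cabs w.
  rewrite -(ler_pM2r (exprn_gt0 k w0)).
  rewrite (_ : _ * _ * _ = cabs (c k) * cabs w ^+ k * r ^+ k.+1); last by ring.
  rewrite -ler_pdivlMr ?exprn_gt0//; apply: le_trans h _.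
  rewrite le_eqVlt; apply/orP; left; apply/eqP.
  by rewrite /q expr_div_n exprS; field; rewrite expf_neq0 ?gt_eqF.
move: wc; rewrite ltr_pdivlMr; last by lra.
by move: w0 M0; nra.
Qed.

Lemma pval_inj c d (r0 : R) : 0 < r0 -> converges_in c r0 -> converges_in d r0 ->
  (forall e : R, 0 < e -> exists2 w, 0 < cabs w < e & pval c w = pval d w) ->
  forall k, c k = d k.
Proof.
move=> r00 cr dr h k; apply/eqP; rewrite -subr_eq0; apply/eqP.
have sub (w : Cplx R) : cabs w < r0 -> pval (fun k => c k - d k) w = pval c w - pval d w.
  move=> wr; apply: pval_unique.
  rewrite (_ : series _ = series (fun k => c k * w ^+ k) - series (fun k => d k * w ^+ k)).
    exact: (cvgB (pval_cvg cr wr) (pval_cvg dr wr)).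
  apply/funext => n; rewrite /series /= -[RHS]/(_ - _) /= -sumrB.
  by apply: eq_bigr => i _; ring.
apply: (@pval_zeros (fun k => c k - d k) r0 r00).
  move=> r /[dup] /cr[M hM] /[dup] /dr[N hN] /andP[r1 _]; exists (M + N) => i.
  apply: (@le_trans _ _ ((cabs (c i) + cabs (d i)) * r ^+ i)).
    by rewrite ler_wpM2r ?cabsB// exprn_ge0// ltW.
  by rewrite mulrDl lerD.
move=> e e0; have [w] := h (Num.min e r0) ltac:(by rewrite lt_min e0).
rewrite lt_min => /andP[w0 /andP[we wr]] cd; exists w; first by rewrite w0.
by rewrite sub// cd subrr.
Qed.

Lemma pval_inj_real c d (r0 : R) : 0 < r0 -> converges_in c r0 -> converges_in d r0 ->
  (forall s, 0 < s < r0 -> pval c (ofR s) = pval d (ofR s)) ->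
  forall k, c k = d k.
Proof.
move=> r00 cr dr h; apply: (pval_inj r00 cr dr) => e e0.
exists (ofR (Num.min e r0 / 2)).
  rewrite cabs_ofR; have : 0 < Num.min e r0 by rewrite lt_min e0.
  have : Num.min e r0 <= e by rewrite ge_min lexx.
  by move=> h1 h2; rewrite gtr0_norm; lra.
apply: h; have : 0 < Num.min e r0 by rewrite lt_min e0.
have : Num.min e r0 <= r0 by rewrite ge_min lexx orbT.
lra.
Qed.

End uniqueness.

(** * Calculus of complex derivatives *)

Section complex_derivative.
Variable R : realType.
Implicit Types (f g : Cplx R -> Cplx R) (z w h l m : Cplx R) (r s : R).

Lemma cdiff_near f g z l : (exists2 d : R, 0 < d & forall w, cabs (w - z) < d -> f w = g w) ->
  cdiff f z l -> cdiff g z l.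
Proof.
move=> [d d0 fg] fl e /fl[d' d'0 hd']; exists (Num.min d d'); first by rewrite lt_min d0.
move=> h; rewrite lt_min => /andP[h1 h2].
rewrite -!fg ?subrr ?cabs0//; first exact: hd'.
by rewrite addrC addKr.
Qed.

Lemma cdiff_lip f z l : cdiff f z l -> exists2 d : R, 0 < d &
  forall h, cabs h < d -> cabs (f (z + h) - f z) <= (cabs l + 1) * cabs h.
Proof.
move=> /(_ 1 ltr01)[d d0 hd]; exists d => // h /hd; rewrite mul1r => k.
rewrite (_ : _ - _ = (f (z + h) - f z - l * h) + l * h); last by ring.
by apply: le_trans (cabsD _ _) _; rewrite cabsM; lra.
Qed.

Lemma cdiff_cont f z l : cdiff f z l -> forall e : R, 0 < e -> exists2 d : R, 0 < d &
  forall h, cabs h < d -> cabs (f (z + h) - f z) < e.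
Proof.
move=> /cdiff_lip[d d0 hd] e e0; have l0 := cabs_ge0 l.
exists (Num.min d (e / (cabs l + 2))); first by rewrite lt_min d0 divr_gt0//; lra.
move=> h; rewrite lt_min => /andP[/hd h1]; rewrite ltr_pdivlMr; last by lra.
by have := cabs_ge0 h; nra.
Qed.

Lemma cdiff_cst (a z : Cplx R) : cdiff (fun _ => a) z 0.
Proof. by move=> e e0; exists 1 => // h _; rewrite subrr mul0r subrr cabs0 mulr_ge0 ?cabs_ge0 ?ltW. Qed.

Lemma cdiff_id z : cdiff id z 1.
Proof.
move=> e e0; exists 1 => // h _.
by rewrite mul1r (_ : _ - _ = 0) ?cabs0 ?mulr_ge0 ?cabs_ge0 ?ltW//; ring.
Qed.

Lemma cdiffD f g z l m : cdiff f z l -> cdiff g z m ->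
  cdiff (fun w => f w + g w) z (l + m).
Proof.
move=> fl gm e e0; have e2 : 0 < e / 2 by lra.
have [d1 d10 h1] := fl _ e2; have [d2 d20 h2] := gm _ e2.
exists (Num.min d1 d2); first by rewrite lt_min d10.
move=> h; rewrite lt_min => /andP[/h1 k1 /h2 k2].
rewrite (_ : _ - _ = (f (z + h) - f z - l * h) + (g (z + h) - g z - m * h)); last by ring.
by apply: le_trans (cabsD _ _) _; lra.
Qed.

Lemma cdiff_comp f g z l m : cdiff f z l -> cdiff g (f z) m ->
  cdiff (fun w => g (f w)) z (m * l).
Proof.
move=> fl gm e e0; have [d1 d10 h1] := cdiff_lip fl.
have l0 := cabs_ge0 l; have m0 := cabs_ge0 m.
have [|d2 d20 h2] := gm (e / 2 / (cabs l + 1)); first by rewrite !divr_gt0//; lra.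
have [|d3 d30 h3] := fl (e / 2 / (cabs m + 1)); first by rewrite !divr_gt0//; lra.
exists (Num.min d1 (Num.min d3 (d2 / (cabs l + 1)))).
  by rewrite !lt_min d10 d30 divr_gt0//; lra.
move=> h; rewrite !lt_min => /and3P[/h1 k1 /h3 k3]; rewrite ltr_pdivlMr => [kh|]; last by lra.
have H0 := cabs_ge0 h.
have {}k2 := h2 (f (z + h) - f z) ltac:(by apply: le_lt_trans k1 _; lra).
have {}k2 : cabs (g (f (z + h)) - g (f z) - m * (f (z + h) - f z)) <= e / 2 * cabs h.
  rewrite subrKC in k2; apply: le_trans k2 _.
  rewrite -mulrA ler_wpM2l//; first by lra.
  by rewrite mulrC ler_pdivrMr; lra.
rewrite (_ : _ - _ = (g (f (z + h)) - g (f z) - m * (f (z + h) - f z)) +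
   m * (f (z + h) - f z - l * h)); last by ring.
apply: le_trans (cabsD _ _) _; rewrite cabsM.
have : cabs m * cabs (f (z + h) - f z - l * h) <= e / 2 * cabs h.
  apply: (@le_trans _ _ (cabs m * (e / 2 / (cabs m + 1) * cabs h))).
    by rewrite ler_wpM2l.
  rewrite (_ : _ * _ = (e / 2 * cabs h) * (cabs m / (cabs m + 1))); last by ring.
  have : 0 <= e / 2 * cabs h by rewrite mulr_ge0//; lra.
  by move=> h0; rewrite ler_piMr// ler_pdivrMr; lra.
by lra.
Qed.

Lemma cdiffM f g z l m : cdiff f z l -> cdiff g z m ->
  cdiff (fun w => f w * g w) z (l * g z + f z * m).
Proof.
move=> fl gm e e0.
have G0 := cabs_ge0 (g z); have F0 := cabs_ge0 (f z); have l0 := cabs_ge0 l.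
have [|d1 d10 h1] := fl (e / 3 / (cabs (g z) + 1)); first by rewrite !divr_gt0//; lra.
have [|d2 d20 h2] := gm (e / 3 / (cabs (f z) + 1)); first by rewrite !divr_gt0//; lra.
have [d3 d30 h3] := cdiff_lip fl.
have [|d4 d40 h4] := cdiff_cont gm (e := e / 3 / (cabs l + 1)); first by rewrite !divr_gt0//; lra.
exists (Num.min (Num.min d1 d2) (Num.min d3 d4)); first by rewrite !lt_min d10 d20 d30.
move=> h; rewrite !lt_min => /andP[/andP[/h1 k1 /h2 k2] /andP[/h3 k3 /h4 k4]].
have H0 := cabs_ge0 h.
rewrite (_ : _ - _ = (f (z + h) - f z - l * h) * g z + f z * (g (z + h) - g z - m * h) +
  (f (z + h) - f z) * (g (z + h) - g z)); last by ring.
apply: le_trans (cabsD _ _) _; apply: le_trans (lerD (cabsD _ _) (lexx _)) _.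
rewrite !cabsM.
have aux (x a b : R) : 0 <= x -> 0 <= b -> a <= e / 3 / (x + 1) * b -> a * x <= e / 3 * b.
  move=> x0 b0 ha; apply: (@le_trans _ _ (e / 3 / (x + 1) * b * x)); first by rewrite ler_wpM2r.
  rewrite (_ : _ * _ = (e / 3 * b) * (x / (x + 1))); last by ring.
  by rewrite ler_piMr// ?ler_pdivrMr ?mulr_ge0//; lra.
have := aux _ _ _ G0 H0 k1; have := aux _ _ _ F0 H0 k2; rewrite (mulrC _ (cabs (f z))).
have : cabs (f (z + h) - f z) * cabs (g (z + h) - g z) <= e / 3 * cabs h.
  apply: le_trans (ler_pM (cabs_ge0 _) (cabs_ge0 _) k3 (ltW k4)) _.
  by rewrite le_eqVlt; apply/orP; left; apply/eqP; field; lra.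
by lra.
Qed.

Lemma cdiffV z : z != 0 -> cdiff (fun w => w^-1) z (- z ^- 2).
Proof.
rewrite -cabs_gt0 => z0 e e0.
exists (Num.min (cabs z / 2) (e * cabs z ^+ 3 / 2)).
  by rewrite lt_min !divr_gt0 ?mulr_gt0 ?exprn_gt0.
move=> h; rewrite lt_min => /andP[h1 h2].
have zh : cabs z / 2 < cabs (z + h).
  by have := cabs_ger z (- h); rewrite opprK cabsN; lra.
have zn0 : z != 0 by rewrite -cabs_gt0.
have zhn0 : z + h != 0 by rewrite -cabs_gt0; lra.
rewrite (_ : _ - _ = h ^+ 2 * (z ^- 2 * (z + h)^-1)); last by field; rewrite ?zn0 ?zhn0.
rewrite cabsM cabsX expr2 mulrAC ler_wpM2r ?cabs_ge0//.
rewrite cabsM !cabsV cabsX -invfM ler_pdivrMr; last by rewrite mulr_gt0 ?exprn_gt0//; lra.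
apply: le_trans (ltW h2) _; rewrite -mulrA ler_wpM2l ?(ltW e0)//.
by rewrite exprSr -mulrA ler_wpM2l ?exprn_ge0 ?cabs_ge0// ltW.
Qed.

Lemma cdiff_unique f z l m : cdiff f z l -> cdiff f z m -> l = m.
Proof.
move=> fl fm; apply/eqP; rewrite -subr_eq0; apply/negP => /negP; rewrite -cabs_gt0 => lm.
have e0 : 0 < cabs (l - m) / 4 by rewrite divr_gt0.
have [d1 d10 h1] := fl _ e0; have [d2 d20 h2] := fm _ e0.
pose h : R := Num.min d1 d2 / 2.
have m0 : 0 < Num.min d1 d2 by rewrite lt_min d10.
have h0 : 0 < h by rewrite /h; lra.
have hd1 : h < d1 by apply: (@lt_le_trans _ _ (Num.min d1 d2)); [rewrite /h; lra | rewrite ge_min lexx].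
have hd2 : h < d2 by apply: (@lt_le_trans _ _ (Num.min d1 d2)); [rewrite /h; lra | rewrite ge_min lexx orbT].
have hE : cabs (ofR h) = h by rewrite cabs_ofR gtr0_norm.
have := h1 (ofR h); have := h2 (ofR h); rewrite hE => /(_ hd2) k2 /(_ hd1) k1.
have : cabs ((l - m) * ofR h) <= cabs (l - m) / 2 * h.
  rewrite (_ : _ * _ = (f (z + ofR h) - f z - m * ofR h) - (f (z + ofR h) - f z - l * ofR h)); last by ring.
  by apply: le_trans (cabsB _ _) _; lra.
by rewrite cabsM hE; nra.
Qed.

(** The bridge to [holomorphic_on]. The quotient form excludes [h = 0], so this case is settled
    separately in one direction. *)
Lemma derivable_cdiff f z : derivable f z 1 <-> exists l, cdiff f z l.
Proof.
rewrite /derivable cvg_ex; split=> -[l].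
  move=> /cvg_cabsP fl; exists l => e /fl.
  rewrite /dnbhs near_withinE => /near_dnbhs_cabsP[d d0 hd].
  exists d => // h hd'; have [->|h0] := eqVneq h 0.
    by rewrite addr0 subrr mulr0 subrr cabs0 mulr0.
  have := hd h; rewrite subr0 => /(_ hd' h0) /ltW.
  have hp : 0 < cabs h by rewrite cabs_gt0.
  rewrite -(ler_pM2r hp) -cabsM /= (_ : _ * h = f (z + h) - f z - l * h)//.
  rewrite mulrBl /= -[h%:A]/(h * 1) mulr1 [h + z]addrC.
  by rewrite -[_ *: _]/(h^-1 * _) mulrAC mulVf// mul1r.
move=> fl; exists l; apply/cvg_cabsP => e e0.
have [d d0 hd] := fl (e / 2) ltac:(by rewrite divr_gt0).
rewrite /dnbhs near_withinE; apply/near_dnbhs_cabsP; exists d => // h.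
rewrite subr0 => /hd hd' h0; have hp : 0 < cabs h by rewrite cabs_gt0.
rewrite -(ltr_pM2r hp) -cabsM /= (_ : _ * h = f (z + h) - f z - l * h).
  by apply: le_lt_trans hd' _; nra.
rewrite mulrBl /= -[h%:A]/(h * 1) mulr1 [h + z]addrC.
by rewrite -[_ *: _]/(h^-1 * _) mulrAC mulVf// mul1r.
Qed.

End complex_derivative.

(** * Exponential, logarithm and path integrals *)

Section exponential.
Local Open Scope complex_scope.
Variable R : realType.
Implicit Types (z w h : Cplx R) (r s : R).

Lemma is_derive_epsP (f : R -> R) (x l : R) : is_derive x 1 f l <->
  forall e : R, 0 < e -> exists2 d : R, 0 < d &
    forall t : R, `|t| < d -> `|f (x + t) - f x - l * t| <= e * `|t|.
Proof.
have E (h : R) : h != 0 -> h^-1 *: (f (h%:A + x) - f x) - l = h^-1 * (f (x + h) - f x - l * h).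
  move=> h0; rewrite -[h%:A]/(h * 1) mulr1 [h + x]addrC -[_ *: _]/(h^-1 * _).
  by field.
split=> [[fd fl] e e0|fl].
  have : h^-1 *: (f (h%:A + x) - f x) @[h --> 0^'] --> l by rewrite -fl; exact: fd.
  move=> /cvgrPdist_lt /(_ _ e0); rewrite /dnbhs near_withinE => /nbhs_ballP[d /= d0 hd].
  exists d => // h hd'; have [->|h0] := eqVneq h 0.
    by rewrite addr0 subrr mulr0 subrr normr0 mulr0.
  have := hd h; rewrite /ball /= sub0r normrN => /(_ hd' h0).
  rewrite distrC E// normrM normfV mulrC ltr_pdivrMr ?normr_gt0// => /ltW.
  by rewrite mulrC.
suff fl' : h^-1 *: (f (h%:A + x) - f x) @[h --> 0^'] --> l.
  by apply: DeriveDef; [apply/cvg_ex; exists l|exact: cvg_lim fl'].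
apply/cvgrPdist_le => e /fl[d d0 hd]; rewrite /dnbhs near_withinE; apply/nbhs_ballP; exists d => // h.
rewrite /ball /= sub0r normrN => /hd hd' h0.
by rewrite distrC E// normrM normfV mulrC ler_pdivrMr ?normr_gt0// mulrC.
Qed.

Definition cexp z : Cplx R := (expR (cRe z) * cos (cIm z)) +i* (expR (cRe z) * sin (cIm z)).

Lemma cexp0 : cexp 0 = 1.
Proof. by rewrite /cexp /= expR0 cos0 sin0 mulr1 mulr0. Qed.

Lemma cexpD z w : cexp (z + w) = cexp z * cexp w.
Proof.
apply: complex_eq; rewrite ?cReM ?cImM /cexp /= ?cReD ?cImD expRD ?cosD ?sinD; ring.
Qed.

Lemma cexp_ofR s : cexp (ofR s) = ofR (expR s).
Proof. by rewrite /cexp /= cos0 sin0 mulr1 mulr0. Qed.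

Lemma cabs_cexp z : cabs (cexp z) = expR (cRe z).
Proof.
by rewrite /cabs /cexp /= !exprMn -mulrDr cos2Dsin2 mulr1 sqrtr_sqr ger0_norm// expR_ge0.
Qed.

(** The first-order expansions of [expR], [cos] and [sin] at 0 are multiplied out; every cross term
    is of second order in [h]. *)
Lemma cexp_small (e : R) : 0 < e -> exists2 d : R, 0 < d &
  forall h, cabs h < d -> cabs (cexp h - 1 - h) <= e * cabs h.
Proof.
move=> e0.
(* The real part will cost [3 * k * H] and the imaginary part [5 * k * H], so [16 * k <= e] leaves
   room. The cap at 1 keeps [k] and, through [cabs h < k], the second-order terms small. *)
have he : 0 < Num.min e 1 / 16 by rewrite divr_gt0// lt_min e0 /=.
have e1 : Num.min e 1 <= e by rewrite ge_min lexx.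
have e2 : Num.min e 1 <= 1 by rewrite ge_min lexx orbT.
set k := Num.min e 1 / 16 in he.
have ke : 16 * k <= e by rewrite /k; lra.
have k1 : 16 * k <= 1 by rewrite /k; lra.
clearbody k.
have [d1 d10 h1] := (is_derive_epsP expR 0 _).1 (is_derive_expR 0) _ he.
have [d2 d20 h2] := (is_derive_epsP cos 0 _).1 (is_derive_cos 0) _ he.
have [d3 d30 h3] := (is_derive_epsP sin 0 _).1 (is_derive_sin 0) _ he.
exists (Num.min (Num.min d1 d2) (Num.min d3 k)); first by rewrite !lt_min d10 d20 d30.
move=> h; rewrite !lt_min => /andP[/andP[hd1 hd2] /andP[hd3 hk]].
have hx := normr_cRe h; have hy := normr_cIm h.
have {h1} := h1 _ (le_lt_trans hx hd1).
have {h2} := h2 _ (le_lt_trans hy hd2).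
have {h3} := h3 _ (le_lt_trans hy hd3).
rewrite !add0r expR0 cos0 sin0 oppr0 mul0r !subr0 !addr0 !mul1r.
set x := cRe h in hx *; set y := cIm h in hy *; set H := cabs h in hk hx hy *.
move=> h3 h2 h1; apply: le_trans (cabs_ReIm _) _.
rewrite !cReB !cImB /= -/x -/y subr0.
set E := expR x in h1 *; set C := cos y in h2 *; set S := sin y in h3 *.
have C1 : `|C| <= 1 by rewrite ler_norml cos_geN1 cos_le1.
have X0 := normr_ge0 x; have Y0 := normr_ge0 y.
have H0 : 0 <= H by exact: le_trans hx.
have r1 : `|E * C - 1 - x| <= 3 * k * H.
  rewrite (_ : _ - _ = (E - 1 - x) * C + (1 + x) * (C - 1)); last by ring.
  apply: le_trans (ler_normD _ _) _; rewrite !normrM.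
  have : `|1 + x| <= 2 by apply: le_trans (ler_normD _ _) _; rewrite normr1; lra.
  have a1 : `|E - 1 - x| <= k * H by apply: le_trans h1 _; rewrite ler_wpM2l// ltW.
  have a2 : `|C - 1| <= k * H by apply: le_trans h2 _; rewrite ler_wpM2l// ltW.
  move=> x2; have := ler_pM (normr_ge0 _) (normr_ge0 _) a1 C1.
  by have := ler_pM (normr_ge0 _) (normr_ge0 _) x2 a2; lra.
have r2 : `|E * S - y| <= 5 * k * H.
  rewrite (_ : _ - _ = (E - 1 - x) * S + x * S + (S - y)); last by ring.
  apply: le_trans (ler_normD _ _) _; apply: le_trans (lerD (ler_normD _ _) (lexx _)) _; rewrite !normrM.
  have a2 : `|S - y| <= k * H by apply: le_trans h3 _; rewrite ler_wpM2l// ltW.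
  have S2 : `|S| <= 2 * H.
    rewrite (_ : S = (S - y) + y); last by ring.
    apply: le_trans (ler_normD _ _) _.
    have : k * H <= 1 * H by apply: ler_wpM2r; lra.
    by lra.
  have a1 : `|E - 1 - x| <= k * H by apply: le_trans h1 _; rewrite ler_wpM2l// ltW.
  have := ler_pM (normr_ge0 _) (normr_ge0 _) a1 S2.
  have := ler_pM (normr_ge0 _) (normr_ge0 _) hx S2.
  have : 0 <= k * H by apply: mulr_ge0; lra.
  have : H * (2 * H) <= k * (2 * H) by apply: ler_wpM2r; lra.
  have : k * H * (2 * H) <= k * H * 1 by apply: ler_wpM2l; [apply: mulr_ge0; lra|lra].
  by lra.
have : 8 * k * H <= e * H by apply: ler_wpM2r => //; lra.
by lra.
Qed.

Lemma cexp_cdiff z : cdiff cexp z (cexp z).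
Proof.
move=> e e0; have ez : 0 < expR (cRe z) by exact: expR_gt0.
have [d d0 hd] := cexp_small (divr_gt0 e0 ez).
exists d => // h /hd; rewrite cexpD => k.
 rewrite (_ : _ - _ = cexp z * (cexp h - 1 - h)); last by ring.
rewrite cabsM cabs_cexp; apply: le_trans (_ : expR (cRe z) * (e / expR (cRe z) * cabs h) <= _).
  by rewrite ler_pM2l.
by rewrite le_eqVlt; apply/orP; left; apply/eqP; field; rewrite gt_eqF.
Qed.

Lemma sin_atan (x : R) : sin (atan x) = x * cos (atan x).
Proof.
have c0 : cos (atan x) != 0 by rewrite cos_atan invr_eq0 sqrtr_eq0 -ltNge ltr_pwDl// sqr_ge0.
by have := atanK x; rewrite /tan => {2}<-; rewrite mulfVK.
Qed.

(* the principal logarithm on [Re z > 0] only; elsewhere it is off by multiples of [i pi] or junk *)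
Definition clog z : Cplx R := ln (cabs z) +i* atan (cIm z / cRe z).

Lemma cexp_clog z : 0 < cRe z -> cexp (clog z) = z.
Proof.
move=> z0; have zn0 : 0 < cabs z by apply: lt_le_trans (normr_cRe z); rewrite normr_gt0 gt_eqF.
rewrite /cexp /clog /= lnK ?posrE// sin_atan cos_atan.
have -> : Num.sqrt (1 + (cIm z / cRe z) ^+ 2) = cabs z / cRe z.
  rewrite -[RHS]ger0_norm ?divr_ge0 ?cabs_ge0 ?(ltW z0)// -sqrtr_sqr; congr Num.sqrt.
  rewrite !expr_div_n [cabs z ^+ 2](_ : _ = cRe z ^+ 2 + cIm z ^+ 2).
    by field; rewrite gt_eqF.
  by case: {z0 zn0} z => a b; rewrite /cabs /= sqr_sqrtr// addr_ge0// sqr_ge0.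
by apply: complex_eq => /=; field; rewrite !gt_eqF.
Qed.

Lemma cRe_clog z : cRe (clog z) = ln (cabs z). Proof. by []. Qed.

Lemma cIm_clog_lt z : `|cIm (clog z)| < 2.
Proof.
have := atan_ltpi2 (cIm z / cRe z); have := atan_gtNpi2 (cIm z / cRe z).
have := pihalf_lt2 R; rewrite /= ltr_norml; lra.
Qed.

Lemma clog_ofR s : 0 < s -> clog (ofR s) = ofR (ln s).
Proof. by move=> s0; rewrite /clog cabs_ofR gtr0_norm//= mul0r atan0. Qed.

End exponential.

(** * Limits through real and imaginary parts, and the derivative of the logarithm *)

Section logarithm.
Variable R : realType.
Implicit Types (z w h : Cplx R) (r s : R).

Lemma cvg_cRe (T : Type) (F : set_system T) (f : T -> Cplx R) (l : Cplx R) :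
  Filter F -> f x @[x --> F] --> l -> cRe (f x) @[x --> F] --> cRe l.
Proof.
move=> FF /cvg_cabsP fl; apply/cvgrPdist_lt => e e0; near=> x.
rewrite distrC -cReB; apply: le_lt_trans (normr_cRe _) _.
by near: x; exact: fl.
Unshelve. all: by end_near. Qed.

Lemma cvg_cIm (T : Type) (F : set_system T) (f : T -> Cplx R) (l : Cplx R) :
  Filter F -> f x @[x --> F] --> l -> cIm (f x) @[x --> F] --> cIm l.
Proof.
move=> FF /cvg_cabsP fl; apply/cvgrPdist_lt => e e0; near=> x.
rewrite distrC -cImB; apply: le_lt_trans (normr_cIm _) _.
by near: x; exact: fl.
Unshelve. all: by end_near. Qed.

Lemma cvg_ReIm (T : Type) (F : set_system T) (f : T -> Cplx R) (l : Cplx R) :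
  Filter F -> cRe (f x) @[x --> F] --> cRe l -> cIm (f x) @[x --> F] --> cIm l ->
  f x @[x --> F] --> l.
Proof.
move=> FF fr fi; apply/cvg_cabsP => e e0; near=> x.
apply: le_lt_trans (cabs_ReIm _) _; rewrite cReB cImB [ltRHS](splitr e) ltrD// distrC.
  by near: x; move/cvgrPdist_lt : fr; apply; lra.
by near: x; move/cvgrPdist_lt : fi; apply; lra.
Unshelve. all: by end_near. Qed.

Lemma cvg_cabs (T : Type) (F : set_system T) (f : T -> Cplx R) (l : Cplx R) :
  Filter F -> f x @[x --> F] --> l -> cabs (f x) @[x --> F] --> cabs l.
Proof.
move=> FF /cvg_cabsP fl; apply/cvgrPdist_lt => e e0; near=> x.
have : cabs (f x - l) < e by near: x; exact: fl.
have := cabs_ger (f x) l; have := cabs_ger l (f x); rewrite (cabsC l).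
by rewrite ltr_norml; lra.
Unshelve. all: by end_near. Qed.

Lemma clog_continuous z : 0 < cRe z -> clog w @[w --> z] --> clog z.
Proof.
move=> z0; have zn0 : 0 < cabs z by apply: lt_le_trans (normr_cRe z); rewrite normr_gt0 gt_eqF.
have idz : id w @[w --> z] --> z by exact: cvg_id.
have hr : ln (cabs w) @[w --> z] --> ln (cabs z).
  have := @continuous_cvg _ _ _ (nbhs z) (nbhs_filter z) (fun w => cabs w) (@ln R) (cabs z) (continuous_ln zn0).
  by apply; exact: (cvg_cabs (nbhs_filter z) idz).
have hi : atan (cIm w / cRe w) @[w --> z] --> atan (cIm z / cRe z).
  have := @continuous_cvg _ _ _ (nbhs z) (nbhs_filter z) (fun w => cIm w / cRe w) (@atan R) (cIm z / cRe z).
  move=> /(_ (@continuous_atan R _)); apply.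
  apply: cvgM; first exact: (cvg_cIm (nbhs_filter z) idz).
  by apply: cvgV; [rewrite gt_eqF|exact: (cvg_cRe (nbhs_filter z) idz)].
exact: (@cvg_ReIm _ (nbhs z) (@clog R) (clog z) (nbhs_filter z) hr hi).
Qed.

(** With [u] the increment of [g], the expansion of [E] at [g z] reads $|h - l u| \le k |u|$.
    Continuity of [g] is what makes [u] small enough for that expansion to apply. *)
Lemma cdiff_inverse (E g : Cplx R -> Cplx R) z l : l != 0 ->
  cdiff E (g z) l -> g w @[w --> z] --> g z -> (\forall w \near z, E (g w) = w) ->
  cdiff g z l^-1.
Proof.
move=> l0 El gz Eg e e0; have lp : 0 < cabs l by rewrite cabs_gt0.
(* The first bound gives $|l| |u| \le 2 |h|$, and the second then brings the error $k |u| / |l|$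
   below $e |h|$. *)
pose k := Num.min (cabs l / 2) (e * cabs l ^+ 2 / 2).
have k0 : 0 < k by rewrite lt_min !divr_gt0// mulr_gt0// exprn_gt0.
have k1 : k <= cabs l / 2 by rewrite ge_min lexx.
have k2 : k <= e * cabs l ^+ 2 / 2 by rewrite ge_min lexx orbT.
clearbody k; have [d d0 hd] := El _ k0.
have [d' d'0 hd'] : exists2 d' : R, 0 < d' & forall w, cabs (w - z) < d' ->
    cabs (g w - g z) < d /\ E (g w) = w.
  apply/near_dnbhs_cabsP; near=> w; split; near: w => //.
  by move/cvg_cabsP : gz; exact.
have Ez : E (g z) = z by apply: (hd' z _).2; rewrite subrr cabs0.
exists d' => // h hh.
have [g1 g2] := hd' (z + h) ltac:(by rewrite addrC addKr).
have := hd _ g1; rewrite subrKC g2 Ez.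
rewrite (_ : z + h - z = h); last by ring.
set u := g (z + h) - g z => hu.
have U0 := cabs_ge0 u.
have u1 : cabs l * cabs u <= 2 * cabs h.
  have : cabs (l * u) - cabs h <= k * cabs u.
    by apply: le_trans hu; rewrite cabsC; exact: cabs_ger.
  rewrite cabsM; have : k * cabs u <= cabs l / 2 * cabs u by rewrite ler_wpM2r.
  by lra.
rewrite (_ : u - l^-1 * h = - (l^-1 * (h - l * u))); last by field.
rewrite cabsN cabsM cabsV mulrC ler_pdivrMr//; apply: le_trans hu _.
rewrite -(ler_pM2l lp).
have : k * (cabs l * cabs u) <= e * cabs l ^+ 2 / 2 * (2 * cabs h).
  by apply: ler_pM => //; [exact: ltW|rewrite mulr_ge0// ltW].
by lra.
Unshelve. all: by end_near. Qed.

Lemma clog_cdiff z : 0 < cRe z -> cdiff (@clog R) z z^-1.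
Proof.
move=> z0; have zn0 : z != 0 by apply: contraTneq z0 => ->; rewrite ltxx.
apply: (@cdiff_inverse (@cexp R)) => //.
- by rewrite -{2}(cexp_clog z0); exact: cexp_cdiff.
- exact: clog_continuous.
- apply/near_dnbhs_cabsP; exists (cRe z) => // w hw; apply: cexp_clog.
  by have := le_lt_trans (normr_cRe _) hw; rewrite cReB ltr_norml; lra.
Qed.

End logarithm.

(** * Curves in the plane and their integrals *)

Section path_integral.
Local Open Scope complex_scope.
Variable R : realType.
Local Notation mu := (@lebesgue_measure R).
Implicit Types (u U : R -> Cplx R) (a b c x : R) (l : Cplx R).

Definition rcdiff U x l : Prop :=
  forall e : R, 0 < e -> exists2 d : R, 0 < d &
    forall t : R, `|t| < d -> cabs (U (x + t) - U x - l * ofR t) <= e * `|t|.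

Lemma cdiff_rcdiff U (f : Cplx R -> Cplx R) x l m :
  rcdiff U x l -> cdiff f (U x) m -> rcdiff (fun t => f (U t)) x (m * l).
Proof.
move=> Ul fm e e0.
have l0 := cabs_ge0 l; have m0 := cabs_ge0 m.
have [d1 d10 h1] := Ul 1 ltr01.
have [|d2 d20 h2] := fm (e / 2 / (cabs l + 1)); first by rewrite !divr_gt0//; lra.
have [|d3 d30 h3] := Ul (e / 2 / (cabs m + 1)); first by rewrite !divr_gt0//; lra.
exists (Num.min d1 (Num.min d3 (d2 / (cabs l + 1)))).
  by rewrite !lt_min d10 d30 divr_gt0//; lra.
move=> t; rewrite !lt_min => /and3P[/h1 k1 /h3 k3]; rewrite ltr_pdivlMr => [kt|]; last by lra.
have T0 := normr_ge0 t.
have {}k1 : cabs (U (x + t) - U x) <= (cabs l + 1) * `|t|.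
  rewrite (_ : _ - _ = (U (x + t) - U x - l * ofR t) + l * ofR t); last by ring.
  by apply: le_trans (cabsD _ _) _; rewrite cabsM cabs_ofR; lra.
have {}k2 := h2 (U (x + t) - U x) ltac:(by apply: le_lt_trans k1 _; lra).
have {}k2 : cabs (f (U (x + t)) - f (U x) - m * (U (x + t) - U x)) <= e / 2 * `|t|.
  rewrite subrKC in k2; apply: le_trans k2 _.
  rewrite -mulrA ler_wpM2l//; first by lra.
  by rewrite mulrC ler_pdivrMr; lra.
rewrite (_ : _ - _ = (f (U (x + t)) - f (U x) - m * (U (x + t) - U x)) +
   m * (U (x + t) - U x - l * ofR t)); last by ring.
apply: le_trans (cabsD _ _) _; rewrite cabsM.
have : cabs m * cabs (U (x + t) - U x - l * ofR t) <= e / 2 * `|t|.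
  apply: (@le_trans _ _ (cabs m * (e / 2 / (cabs m + 1) * `|t|))).
    by rewrite ler_wpM2l.
  rewrite (_ : _ * _ = (e / 2 * `|t|) * (cabs m / (cabs m + 1))); last by ring.
  have : 0 <= e / 2 * `|t| by rewrite mulr_ge0//; lra.
  by move=> h0; rewrite ler_piMr// ler_pdivrMr; lra.
by lra.
Qed.

Lemma rcdiff_ofR x : rcdiff (@ofR R) x 1.
Proof.
move=> e e0; exists 1 => // t _.
by rewrite ofRD mul1r [ofR x + _]addrC addrK subrr cabs0 mulr_ge0// ltW.
Qed.

Lemma rcdiff_continuous U x l : rcdiff U x l -> {for x, continuous U}.
Proof.
move=> Ul; apply/cvg_cabsP => e e0.
have [d d0 hd] := Ul 1 ltr01; have l0 := cabs_ge0 l.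
apply/nbhs_ballP; exists (Num.min d (e / (cabs l + 2))).
  by rewrite /= lt_min d0 divr_gt0//; lra.
move=> y; rewrite /ball /= lt_min distrC => /andP[/hd]; rewrite subrKC => k.
rewrite ltr_pdivlMr => [ky|]; last by lra.
rewrite (_ : _ - _ = (U y - U x - l * ofR (y - x)) + l * ofR (y - x)); last by ring.
apply: le_lt_trans (cabsD _ _) _; rewrite cabsM cabs_ofR.
have := normr_ge0 (y - x); move: k ky; set v := `|_|; rewrite mul1r.
by nra.
Qed.

Lemma rcdiff_Re U x l : rcdiff U x l -> is_derive x 1 (cRe \o U) (cRe l).
Proof.
move=> Ul; apply/is_derive_epsP => e /Ul[d d0 hd]; exists d => // t /hd; apply: le_trans.
by rewrite /= (mulrC (cRe l)) -cRe_ofRM (mulrC (ofR t)) -!cReB normr_cRe.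
Qed.

Lemma rcdiff_Im U x l : rcdiff U x l -> is_derive x 1 (cIm \o U) (cIm l).
Proof.
move=> Ul; apply/is_derive_epsP => e /Ul[d d0 hd]; exists d => // t /hd; apply: le_trans.
by rewrite /= (mulrC (cIm l)) -cIm_ofRM (mulrC (ofR t)) -!cImB normr_cIm.
Qed.

(** Continuity is two-sided even at the end points, which is available because the curves and
    integrands extend beyond the interval; one-sided limits are thereby avoided. *)
Definition cont_on a b u : Prop := forall x, a <= x <= b -> {for x, continuous u}.

Definition cint a b u : Cplx R :=
  (\int[mu]_(x in `[a, b]) cRe (u x))%R +i* (\int[mu]_(x in `[a, b]) cIm (u x))%R.

Lemma within_of_for (f : R -> R) a b : (forall x, a <= x <= b -> {for x, continuous f}) ->
  {within `[a, b], continuous f}.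
Proof.
move=> h; apply: continuous_in_subspaceT => x; rewrite inE /= in_itv /=; exact: h.
Qed.

Lemma cont_on_Re a b u : cont_on a b u -> forall x, a <= x <= b -> {for x, continuous (fun t => cRe (u t))}.
Proof. by move=> h x /h; exact: cvg_cRe. Qed.

Lemma cont_on_Im a b u : cont_on a b u -> forall x, a <= x <= b -> {for x, continuous (fun t => cIm (u t))}.
Proof. by move=> h x /h; exact: cvg_cIm. Qed.

Lemma integrable_for (f : R -> R) a b : (forall x, a <= x <= b -> {for x, continuous f}) ->
  mu.-integrable `[a, b] (EFin \o f).
Proof.
move=> /within_of_for h; apply: continuous_compact_integrable => //; exact: segment_compact.
Qed.

Lemma cint_ext a b u U : (forall x, a <= x <= b -> u x = U x) -> cint a b u = cint a b U.
Proof.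
by move=> h; congr Complex; apply: eq_Rintegral => x; rewrite inE /= in_itv /= => /h ->.
Qed.

Lemma cintD a b u U : cont_on a b u -> cont_on a b U ->
  cint a b (fun x => u x + U x) = cint a b u + cint a b U.
Proof.
move=> hu hU; apply: complex_eq; rewrite ?cReD ?cImD /=.
  under eq_Rintegral do rewrite cReD.
  by rewrite RintegralD//; apply: integrable_for; exact: cont_on_Re.
under eq_Rintegral do rewrite cImD.
by rewrite RintegralD//; apply: integrable_for; exact: cont_on_Im.
Qed.

Lemma cintZ a b l u : cont_on a b u -> cint a b (fun x => l * u x) = l * cint a b u.
Proof.
move=> hu; have ir := integrable_for (cont_on_Re hu); have ii := integrable_for (cont_on_Im hu).
have zr k : mu.-integrable `[a, b] (EFin \o (fun x => k * cRe (u x))).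
  by apply: integrable_for => x xab; apply: cvgMl_tmp; exact: (cont_on_Re hu).
have zi k : mu.-integrable `[a, b] (EFin \o (fun x => k * cIm (u x))).
  by apply: integrable_for => x xab; apply: cvgMl_tmp; exact: (cont_on_Im hu).
apply: complex_eq; rewrite ?cReM ?cImM /=.
  under eq_Rintegral do rewrite cReM.
  by rewrite RintegralB// !RintegralZl.
under eq_Rintegral do rewrite cImM.
by rewrite RintegralD// !RintegralZl.
Qed.

Lemma cont_onZ a b l u : cont_on a b u -> cont_on a b (fun x => l * u x).
Proof. by move=> h x /h; exact: cvgMl_tmp. Qed.
Lemma cont_onD a b u U : cont_on a b u -> cont_on a b U -> cont_on a b (fun x => u x + U x).
Proof. by move=> h k x /[dup] /h h' /k; exact: cvgD. Qed.
Lemma cont_onM a b u U : cont_on a b u -> cont_on a b U -> cont_on a b (fun x => u x * U x).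
Proof. by move=> h k x /[dup] /h h' /k; exact: cvgM. Qed.

Lemma cont_onB a b u U : cont_on a b u -> cont_on a b U -> cont_on a b (fun x => u x - U x).
Proof. by move=> h k x /[dup] /h h' /k; exact: cvgB. Qed.
Lemma cont_on_cst a b l : cont_on a b (fun _ => l).
Proof. by move=> x _; exact: cvg_cst. Qed.

Lemma cintB a b u U : cont_on a b u -> cont_on a b U ->
  cint a b (fun x => u x - U x) = cint a b u - cint a b U.
Proof.
move=> hu hU; rewrite -[- cint a b U]mulN1r -(cintZ (-1) hU) -(cintD hu (cont_onZ (l := -1) hU)).
by apply: cint_ext => x _; rewrite mulN1r.
Qed.

(* the factor 2 comes from bounding real and imaginary parts separately *)
Lemma cint_le a b u (M : R) : a <= b -> cont_on a b u ->
  (forall x, a <= x <= b -> cabs (u x) <= M) -> cabs (cint a b u) <= 2 * M * (b - a).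
Proof.
move=> ab hu hM; apply: le_trans (cabs_ReIm _) _.
have aux (f : R -> R) : (forall x, a <= x <= b -> {for x, continuous f}) ->
    (forall x, a <= x <= b -> `|f x| <= M) -> `|\int[mu]_(x in `[a, b]) f x| <= M * (b - a).
  move=> cf fM; have fi := integrable_for cf.
  apply: le_trans (le_normr_Rintegral _ fi) _ => //.
  apply: (@le_trans _ _ (\int[mu]_(x in `[a, b]) (fun=> M) x)).
    have i1 : mu.-integrable `[a, b] (EFin \o (fun x => `|f x|)).
      by apply: integrable_for => x xab; apply: cvg_norm; exact: cf.
    have i2 : mu.-integrable `[a, b] (EFin \o (fun=> M)).
      by apply: integrable_for => x xab; exact: cvg_cst.
    apply: (le_Rintegral _ i1 i2) => // x /=; rewrite in_itv /=; exact: fM.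
  have mab : mu `[a, b]%classic = (b - a)%:E.
    rewrite lebesgue_measure_itv /= lte_fin.
    by move: ab; rewrite le_eqVlt => /predU1P[->|->//]; rewrite ltxx subrr.
  rewrite Rintegral_cst//; suff -> : fine (mu `[a, b]) = b - a by [].
  by rewrite [X in fine X]mab.
rewrite -mulrA mulr2n mulrDl mul1r lerD//; apply: aux.
- exact: cont_on_Re.
- by move=> x /hM; apply: le_trans; exact: normr_cRe.
- exact: cont_on_Im.
- by move=> x /hM; apply: le_trans; exact: normr_cIm.
Qed.

Lemma cint_FTC a b u U : a <= b -> (forall x, a <= x <= b -> rcdiff U x (u x)) ->
  cont_on a b u -> cint a b u = U b - U a.
Proof.
rewrite le_eqVlt => /predU1P[->{a}|ab] dU cu.
  by rewrite subrr; apply: complex_eq => /=; rewrite set_itv1 Rintegral_set1.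
have aux (F f : R -> R) : (forall x, a <= x <= b -> is_derive x 1 F (f x)) ->
    (forall x, a <= x <= b -> {for x, continuous f}) -> \int[mu]_(x in `[a, b]) f x = F b - F a.
  move=> dF cf; have cF x : a <= x <= b -> {for x, continuous F}.
    by move=> /dF [/derivable1_diffP /differentiable_continuous].
  rewrite /Rintegral (@continuous_FTC2 _ f F _ _ ab (within_of_for cf))//.
    split.
    - by move=> x; rewrite in_itv /= => /andP[/ltW ax /ltW xb]; have [] := dF x ltac:(by rewrite ax xb).
    - by apply: cvg_at_right_filter; apply: cF; rewrite lexx ltW.
    - by apply: cvg_at_left_filter; apply: cF; rewrite lexx ltW.
  move=> x; rewrite in_itv /= => /andP[/ltW ax /ltW xb].
  by rewrite derive1E; have [_ ->] := dF x ltac:(by rewrite ax xb).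
apply: complex_eq; rewrite ?cReB ?cImB /=.
  apply: (aux (cRe \o U)); last exact: cont_on_Re.
  by move=> x /dU /rcdiff_Re.
apply: (aux (cIm \o U)); last exact: cont_on_Im.
by move=> x /dU /rcdiff_Im.
Qed.

Lemma cint_split c a b u : a <= c <= b -> cont_on a b u ->
  cint a b u = cint a c u + cint c b u.
Proof.
move=> /andP[ac cb] cu.
have aux (f : R -> R) : (forall x, a <= x <= b -> {for x, continuous f}) ->
   \int[mu]_(x in `[a, b]) f x = \int[mu]_(x in `[a, c]) f x + \int[mu]_(x in `[c, b]) f x.
  move=> cf; have fi := integrable_for cf.
  have := @Rintegral_itvB R f (BLeft a) (BRight b) c fi.
  rewrite !bnd_simp => /(_ ac cb) /eqP; rewrite subr_eq addrC => /eqP ->; congr (_ + _).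
  rewrite Rintegral_itv_obnd_cbnd//.
  by apply: integrableS fi => //; apply: subset_itv; rewrite bnd_simp.
by apply: complex_eq; rewrite ?cReD ?cImD /=; apply: aux; [exact: cont_on_Re|exact: cont_on_Im].
Qed.

End path_integral.

(** * Goursat and Cauchy *)

#[local] Arguments cabs : simpl never.

Section goursat.
Variable R : realType.
Implicit Types (t x y : R).

Lemma largest_quarter (x p q r s : R) : x <= p + q + r + s ->
  4 * p < x -> 4 * q < x -> 4 * r < x -> x <= 4 * s.
Proof. lra. Qed.

Lemma nested_intervals (a w : nat -> R) : (forall n, 0 <= w n) ->
  (forall n, a n <= a n.+1 /\ a n.+1 + w n.+1 <= a n + w n) ->
  exists x, forall n, a n <= x <= a n + w n.
Proof.
move=> w0 aw.
have amono m n : (m <= n)%N -> a m <= a n.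
  move=> /subnKC <-; elim: (n - m)%N => [|k IH]; first by rewrite addn0.
  by rewrite addnS; apply: le_trans IH _; have [] := aw (m + k)%N.
have bmono m n : (m <= n)%N -> a n + w n <= a m + w m.
  move=> /subnKC <-; elim: (n - m)%N => [|k IH]; first by rewrite addn0.
  by rewrite addnS; apply: le_trans IH; have [] := aw (m + k)%N.
have ab m n : a m <= a n + w n.
  have [mn|/ltnW nm] := leqP m n.
    by apply: le_trans (amono _ _ mn) _; rewrite lerDl.
  by apply: le_trans (bmono _ _ nm); rewrite lerDl.
have ub n : ubound (range a) (a n + w n) by move=> _ [m _ <-]; exact: ab.
exists (sup (range a)) => n; apply/andP; split.
  by apply: ub_le_sup; [exists (a 0 + w 0); exact: ub|exists n].
by apply: ge_sup; [exists (a 0); exists 0%N|exact: ub].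
Qed.

(* A primitive of the affine map [g0 + g1 * (w - w0)], whose integral over a closed path therefore vanishes. *)
Definition quadratic (g0 g1 w0 w : Cplx R) := g0 * w + g1 * (w - w0) ^+ 2 / 2.

Lemma quadratic_cdiff (g0 g1 w0 w : Cplx R) :
  cdiff (quadratic g0 g1 w0) w (g0 + g1 * (w - w0)).
Proof.
rewrite /quadratic => e e0; have G := cabs_ge0 g1.
exists (e / (cabs g1 + 1)); first by rewrite divr_gt0//; lra.
move=> h; rewrite ltr_pdivlMr => [hh|]; last by lra.
have c2 : cabs (2 : Cplx R)^-1 = 2^-1 by rewrite cabsV (cabs_nat R 2).
rewrite (_ : _ - _ = g1 * h * 2^-1 * h); last by field.
rewrite 3!cabsM c2 ler_wpM2r ?cabs_ge0//.
by have := cabs_ge0 h; nra.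
Qed.

(** The affine part of [g] has the primitive [quadratic] and integrates exactly to end-point values,
    which cancel around a closed path. What is left is the remainder [K] times the speed [B], with
    the factor 2 of [cint_le]. *)
Lemma path_integral_affine (g : Cplx R -> Cplx R) (p p' : R -> Cplx R) (g0 g1 w0 : Cplx R) (a b K B : R) :
  a <= b -> cont_on a b p' -> cont_on a b (fun x => g (p x)) ->
  (forall x, a <= x <= b -> rcdiff p x (p' x)) ->
  (forall x, a <= x <= b -> cabs (p' x) <= B) ->
  (forall x, a <= x <= b -> cabs (g (p x) - g0 - g1 * (p x - w0)) <= K) ->
  cabs (cint a b (fun x => g (p x) * p' x) -
    (quadratic g0 g1 w0 (p b) - quadratic g0 g1 w0 (p a))) <= 2 * (K * B) * (b - a).
Proof.
move=> ab cp' cg dp hB hK.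
have cp : cont_on a b p by move=> x /dp; exact: rcdiff_continuous.
have caff : cont_on a b (fun x => g0 + g1 * (p x - w0)).
  have c1 : cont_on a b (fun x => p x - w0) := cont_onB cp (cont_on_cst (l := w0)).
  exact: (cont_onD (cont_on_cst (l := g0)) (cont_onZ (l := g1) c1)).
have cm : cont_on a b (fun x => (g0 + g1 * (p x - w0)) * p' x) := cont_onM caff cp'.
have cm' : cont_on a b (fun x => g (p x) * p' x) := cont_onM cg cp'.
have dq x : a <= x <= b ->
    rcdiff (fun x => quadratic g0 g1 w0 (p x)) x ((g0 + g1 * (p x - w0)) * p' x).
  by move=> xab; apply: cdiff_rcdiff; [exact: dp|exact: quadratic_cdiff].
have <- := cint_FTC ab dq cm; rewrite -(cintB cm' cm).
apply: (cint_le ab (cont_onB cm' cm)) => x xab.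
rewrite -mulrBl cabsM ler_pM ?cabs_ge0 ?hB//.
by rewrite opprD addrA hK.
Qed.

(* [G] parametrizes a region by a rectangle with sides [wt] and [wx]; [G1] and [G2] are its partial derivatives. *)
Variables (g : Cplx R -> Cplx R) (G G1 G2 : R -> R -> Cplx R) (t0 wt x0 wx B : R).
Definition in_rect t x := t0 <= t <= t0 + wt /\ x0 <= x <= x0 + wx.
Hypotheses (wt0 : 0 <= wt) (wx0 : 0 <= wx).
Hypothesis dG1 : forall t x, in_rect t x -> rcdiff (fun s => G s x) t (G1 t x).
Hypothesis dG2 : forall t x, in_rect t x -> rcdiff (G t) x (G2 t x).
Hypothesis bG1 : forall t x, in_rect t x -> cabs (G1 t x) <= B.
Hypothesis bG2 : forall t x, in_rect t x -> cabs (G2 t x) <= B.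
Hypothesis cG1 : forall t x, in_rect t x -> {for t, continuous (fun s => G1 s x)}.
Hypothesis cG2 : forall t x, in_rect t x -> {for x, continuous (G2 t)}.
Hypothesis dg : forall t x, in_rect t x -> exists l, cdiff g (G t x) l.

Let A x t := g (G t x) * G1 t x.
Let V t x := g (G t x) * G2 t x.

(* the integral of [g (w) dw] along the image under [G] of the boundary of [[a, a + w] x [c, c + v]] *)
Definition boundary_integral a w c v :=
  cint a (a + w) (A c) + cint c (c + v) (V (a + w)) -
  cint a (a + w) (A (c + v)) - cint c (c + v) (V a).
Local Notation S := boundary_integral.

Lemma cont_gG1 x a b : (forall t, a <= t <= b -> in_rect t x) -> cont_on a b (fun t => g (G t x)).
Proof.
move=> h t /h /[dup] /dG1 d /dg [l gl]; exact: (rcdiff_continuous (cdiff_rcdiff d gl)).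
Qed.

Lemma cont_gG2 t a b : (forall x, a <= x <= b -> in_rect t x) -> cont_on a b (fun x => g (G t x)).
Proof.
move=> h x /h /[dup] /dG2 d /dg [l gl]; exact: (rcdiff_continuous (cdiff_rcdiff d gl)).
Qed.

Lemma cont_A x a b : (forall t, a <= t <= b -> in_rect t x) -> cont_on a b (A x).
Proof. by move=> h; apply: cont_onM; [exact: cont_gG1|move=> t /h; exact: cG1]. Qed.

Lemma cont_V t a b : (forall x, a <= x <= b -> in_rect t x) -> cont_on a b (V t).
Proof. by move=> h; apply: cont_onM; [exact: cont_gG2|move=> x /h; exact: cG2]. Qed.

(** Moving along one parameter at a time and integrating the bounded partial derivatives shows that
    the images of small subrectangles are small. *)
Lemma rect_lipschitz t x t' x' : in_rect t x -> in_rect t' x' ->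
  cabs (G t x - G t' x') <= 2 * B * (`|t - t'| + `|x - x'|).
Proof.
move=> tx tx'; have tx2 : in_rect t' x by case: tx tx' => h1 h2 [h3 h4]; split.
apply: le_trans (cabs_tri (G t' x) _ _) _; rewrite mulrDr; apply: lerD.
  have aux s s' : s <= s' -> in_rect s x -> in_rect s' x ->
      cabs (G s' x - G s x) <= 2 * B * (s' - s).
    move=> ss [h1 h2] [h3 _].
    have hh u : s <= u <= s' -> in_rect u x by move=> hu; split => //; lra.
    rewrite -(@cint_FTC _ s s' (fun u => G1 u x) (fun u => G u x))//.
    - by apply: cint_le => // u hu; [apply: cG1|apply: bG1]; exact: hh.
    - by move=> u hu; apply: dG1; exact: hh.
    - by move=> u hu; apply: cG1; exact: hh.
  have [tt|/ltW tt] := leP t t'.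
    by rewrite cabsC; have := aux _ _ tt tx tx2; rewrite ler0_norm; lra.
  by have := aux _ _ tt tx2 tx; rewrite ger0_norm; lra.
have aux s s' : s <= s' -> in_rect t' s -> in_rect t' s' ->
    cabs (G t' s' - G t' s) <= 2 * B * (s' - s).
  move=> ss [h1 h2] [_ h3].
  have hh u : s <= u <= s' -> in_rect t' u by move=> hu; split => //; lra.
  rewrite -(@cint_FTC _ s s' (G2 t') (G t'))//.
  - by apply: cint_le => // u hu; [apply: cG2|apply: bG2]; exact: hh.
  - by move=> u hu; apply: dG2; exact: hh.
  - by move=> u hu; apply: cG2; exact: hh.
have [tt|/ltW tt] := leP x x'.
  by rewrite cabsC; have := aux _ _ tt tx2 tx'; rewrite ler0_norm; lra.
by have := aux _ _ tt tx' tx2; rewrite ger0_norm; lra.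
Qed.

Definition subrect a w c v := [/\ 0 <= w, 0 <= v, t0 <= a, a + w <= t0 + wt & x0 <= c /\ c + v <= x0 + wx].

Lemma subrect_in a w c v t x : subrect a w c v -> a <= t <= a + w -> c <= x <= c + v -> in_rect t x.
Proof. by move=> [? ? ? ? [? ?]] ? ?; split; lra. Qed.

(** Each outer side is cut in two, and the integrals along the inner cuts occur twice with opposite
    signs. *)
Lemma boundary_integral_split a w c v : subrect a (w + w) c (v + v) -> 0 <= w -> 0 <= v ->
  S a (w + w) c (v + v) =
  S a w c v + S (a + w) w c v + S a w (c + v) v + S (a + w) w (c + v) v.
Proof.
move=> sr w0 v0; rewrite /S !addrA; rewrite -!(addrA a w w) -!(addrA c v v).
have hA x : c <= x <= c + (v + v) ->
    cint a (a + (w + w)) (A x) = cint a (a + w) (A x) + cint (a + w) (a + (w + w)) (A x).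
  move=> hx; apply: cint_split; first by lra.
  by apply: cont_A => t ht; apply: subrect_in sr _ _.
have hV t : a <= t <= a + (w + w) ->
    cint c (c + (v + v)) (V t) = cint c (c + v) (V t) + cint (c + v) (c + (v + v)) (V t).
  move=> ht; apply: cint_split; first by lra.
  by apply: cont_V => x hx; apply: subrect_in sr _ _.
rewrite !hA ?hV; try (apply/andP; split; lra).
by ring.
Qed.

(** The bisection takes place in the parameter rectangle, and the Lipschitz bound carries the
    shrinking over to the images. The factor $4^n$ lost in choosing quarters is met by two factors
    $2^{-n}$, one from the side length and one from the error of the first-order expansion. *)
Lemma goursat : S t0 wt x0 wx = 0.
Proof.
pose w n := wt / 2 ^+ n; pose v n := wx / 2 ^+ n.
have wS n : w n = w n.+1 + w n.+1 by rewrite /w exprS; field; rewrite expf_neq0.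
have vS n : v n = v n.+1 + v n.+1 by rewrite /v exprS; field; rewrite expf_neq0.
have wn0 n : 0 <= w n by rewrite divr_ge0// exprn_ge0.
have vn0 n : 0 <= v n by rewrite divr_ge0// exprn_ge0.
have w0E : w 0%N = wt by rewrite /w expr0 divr1.
have v0E : v 0%N = wx by rewrite /v expr0 divr1.
have wvE n : w n + v n = (wt + wx) * (1 / 2) ^+ n by rewrite /w /v expr_div_n expr1n; ring.
clearbody w v.
pose ok n (p : R * R) := subrect p.1 (w n) p.2 (v n).
(* Being a subrectangle is a premise inside [step], so that the choice function is total on
   corners. *)
pose step (q : nat * (R * R)) (p : R * R) := ok q.1 q.2 ->
  [/\ q.2.1 <= p.1, p.1 + w q.1.+1 <= q.2.1 + w q.1, q.2.2 <= p.2,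
      p.2 + v q.1.+1 <= q.2.2 + v q.1 &
      cabs (S q.2.1 (w q.1) q.2.2 (v q.1)) <= 4 * cabs (S p.1 (w q.1.+1) p.2 (v q.1.+1))].
have /choice[f hf] : forall q, exists p, step q p.
  move=> [n [a c]]; have [oknp|nok] := pselect (ok n (a, c)); last by exists (a, c).
  have := oknp; rewrite /step /ok /= => sr.
  have sr2 := sr; rewrite wS vS in sr2.
  have E := boundary_integral_split sr2 (wn0 _) (vn0 _).
  have {}E := congr1 cabs E; rewrite -wS -vS in E.
  set s1 := S a (w n.+1) c (v n.+1) in E; set s2 := S (a + w n.+1) (w n.+1) c (v n.+1) in E.
  set s3 := S a (w n.+1) (c + v n.+1) (v n.+1) in E.
  set s4 := S (a + w n.+1) (w n.+1) (c + v n.+1) (v n.+1) in E.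
  have {}E : cabs (S a (w n) c (v n)) <= cabs s1 + cabs s2 + cabs s3 + cabs s4.
    rewrite E; apply: le_trans (cabsD _ _) _; rewrite lerD2r.
    by apply: le_trans (cabsD _ _) _; rewrite lerD2r cabsD.
  have wle : w n.+1 <= w n by rewrite (wS n) lerDl.
  have vle : v n.+1 <= v n by rewrite (vS n) lerDl.
  have [h1|h1] := leP (cabs (S a (w n) c (v n))) (4 * cabs s1).
    by exists (a, c) => _; split; rewrite //= ?lerD2l.
  have [h2|h2] := leP (cabs (S a (w n) c (v n))) (4 * cabs s2).
    by exists (a + w n.+1, c) => _; split; rewrite //= ?lerDl// ?lerD2l// -?addrA -?wS.
  have [h3|h3] := leP (cabs (S a (w n) c (v n))) (4 * cabs s3).
    by exists (a, c + v n.+1) => _; split; rewrite //= ?lerDl// ?lerD2l// -?addrA -?vS.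
  exists (a + w n.+1, c + v n.+1) => _; split; rewrite //= ?lerDl// -?addrA -?wS -?vS//.
  exact: largest_quarter E h1 h2 h3.
pose s := fix s n : R * R := if n is m.+1 then f (m, s m) else (t0, x0).
have hs n : ok n (s n).
  elim: n => [|n IH].
    by rewrite /ok /= w0E v0E; split.
  have [h1 h2 h3 h4 _] := hf (n, s n) IH; rewrite /ok /=.
  move: IH h1 h2 h3 h4 => [j1 j2 j3 j4 [j5 j6]] /= h1 h2 h3 h4.
  by split => //; [lra|lra|split; lra].
have hst n := hf (n, s n) (hs n).
have Sn n : cabs (S t0 wt x0 wx) <= 4 ^+ n * cabs (S (s n).1 (w n) (s n).2 (v n)).
  elim: n => [|n IH]; first by rewrite /= w0E v0E expr0 mul1r.
  apply: le_trans IH _; rewrite exprSr -mulrA ler_wpM2l ?exprn_ge0//.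
  by have [] := hst n.
have [tl htl] := @nested_intervals (fun n => (s n).1) w wn0
  (fun n => let: And5 h1 h2 _ _ _ := hst n in conj h1 h2).
have [xl hxl] := @nested_intervals (fun n => (s n).2) v vn0
  (fun n => let: And5 _ _ h1 h2 _ := hst n in conj h1 h2).
have inl : in_rect tl xl by apply: (subrect_in (hs 0%N)).
have [l gl] := dg inl.
have B0 : 0 <= B by apply: le_trans (bG1 inl); exact: cabs_ge0.
set L := wt + wx; have L0 : 0 <= L by rewrite addr_ge0.
(* The constant comes from [SK]: $4 K B (W+X)$ with $K = 2 e B (W+X)$, where $(W+X)^2 = L^2/4^n$
   cancels the $4^n$ of [Sn]. *)
suff main (e : R) : 0 < e -> cabs (S t0 wt x0 wx) <= e * (8 * B ^+ 2 * L ^+ 2).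
  apply: cabs_eq0; apply/eqP; rewrite eq_le cabs_ge0 andbT.
  apply/ler_addgt0Pr => e e0; rewrite add0r.
  have k0 : 0 <= 8 * B ^+ 2 * L ^+ 2 by rewrite !mulr_ge0// sqr_ge0.
  apply: le_trans (main (e / (8 * B ^+ 2 * L ^+ 2 + 1)) _) _.
    by rewrite divr_gt0//; lra.
  rewrite mulrAC -mulrA ler_piMr ?(ltW e0)// ler_pdivrMr; lra.
move=> e0; have [d d0 hd] := gl _ e0.
have [n hn] : exists n, 2 * B * (w n + v n) < d.
  have /cvgrPdist_lt : (fun n => 2 * B * L * (1 / 2) ^+ n) @ \oo --> 2 * B * L * 0.
    by apply: cvgMl_tmp; apply: cvg_expr; rewrite ger0_norm; lra.
  move=> /(_ _ d0) [n _ /(_ n (leqnn n)) hn]; exists n; move: hn.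
  rewrite mulr0 sub0r normrN ger0_norm; last first.
    by rewrite mulr_ge0 ?exprn_ge0// ?mulr_ge0//; lra.
  apply: le_lt_trans; rewrite le_eqVlt; apply/orP; left; apply/eqP.
  by rewrite wvE /L; ring.
apply: le_trans (Sn n) _.
set a := (s n).1; set c := (s n).2; have sr : subrect a (w n) c (v n) := hs n.
have htl' := htl n; have hxl' := hxl n; rewrite /= -/a -/c in htl' hxl'.
set W := w n in sr htl' hn *; set X := v n in sr hxl' hn *.
have W0 : 0 <= W by exact: wn0. have X0 : 0 <= X by exact: vn0.
set g0 := g (G tl xl); set K := e * (2 * B * (W + X)).
have est t x : a <= t <= a + W -> c <= x <= c + X -> cabs (g (G t x) - g0 - l * (G t x - G tl xl)) <= K.
  move=> ht hx; have hl : cabs (G t x - G tl xl) <= 2 * B * (W + X).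
    apply: le_trans (rect_lipschitz (subrect_in sr ht hx) inl) _.
    by rewrite ler_wpM2l ?mulr_ge0// lerD// ler_norml; lra.
  have := hd _ (le_lt_trans hl hn); rewrite subrKC => h.
  by apply: le_trans h _; rewrite ler_wpM2l// ltW.
have sideA x : c <= x <= c + X -> cabs (cint a (a + W) (A x) -
   (quadratic g0 l (G tl xl) (G (a + W) x) - quadratic g0 l (G tl xl) (G a x))) <= 2 * (K * B) * W.
  move=> hx; have hin t : a <= t <= a + W -> in_rect t x by move=> ht; apply: (subrect_in sr).
  rewrite [X in _ <= _ * X](_ : W = a + W - a); last by ring.
  apply: (@path_integral_affine g (fun t => G t x) (fun t => G1 t x)) => //.
  - lra.
  - by move=> t /hin; exact: cG1.
  - exact: cont_gG1.
  - by move=> t /hin; exact: dG1.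
  - by move=> t /hin; exact: bG1.
  - by move=> t ht; exact: est.
have sideV t : a <= t <= a + W -> cabs (cint c (c + X) (V t) -
   (quadratic g0 l (G tl xl) (G t (c + X)) - quadratic g0 l (G tl xl) (G t c))) <= 2 * (K * B) * X.
  move=> ht; have hin x : c <= x <= c + X -> in_rect t x by move=> hx; apply: (subrect_in sr).
  rewrite [Y in _ <= _ * Y](_ : X = c + X - c); last by ring.
  apply: (@path_integral_affine g (G t) (G2 t)) => //.
  - lra.
  - by move=> x /hin; exact: cG2.
  - exact: cont_gG2.
  - by move=> x /hin; exact: dG2.
  - by move=> x /hin; exact: bG2.
  - by move=> x hx; exact: est.
have SK : cabs (S a W c X) <= 4 * (K * B) * (W + X).
  have q1 := sideA c ltac:(lra). have q2 := sideA (c + X) ltac:(lra).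
  have q3 := sideV a ltac:(lra). have q4 := sideV (a + W) ltac:(lra).
  move: q1 q2 q3 q4; set p1 := _ - _ => q1; set p2 := _ - _ => q2; set p3 := _ - _ => q3; set p4 := _ - _ => q4.
  have -> : S a W c X = p1 + p4 - p2 - p3 by rewrite /S /p1 /p2 /p3 /p4; ring.
  apply: le_trans (cabsB _ _) _; apply: le_trans (lerD (cabsB _ _) (lexx _)) _.
  apply: le_trans (lerD (lerD (cabsD _ _) (lexx _)) (lexx _)) _; lra.
apply: (@le_trans _ _ (4 ^+ n * (4 * (K * B) * (W + X)))); first by rewrite ler_wpM2l ?exprn_ge0.
rewrite le_eqVlt; apply/orP; left; apply/eqP.
rewrite /K /W /X !wvE -/L (_ : 4 ^+ n = 2 ^+ n * 2 ^+ n); last by rewrite -exprMn -natrM.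
by rewrite expr_div_n expr1n; field; rewrite expf_neq0.
Qed.

End goursat.

(** * Cauchy's formula on a circle and Taylor expansion in a disc *)

Section cauchy.
Local Open Scope complex_scope.
Variable R : realType.
Implicit Types (z w h l : Cplx R) (t x s : R).

Lemma cdiffZ (f : Cplx R -> Cplx R) a z l : cdiff f z l -> cdiff (fun w => a * f w) z (a * l).
Proof.
move=> fl; have := cdiffM (@cdiff_cst R a z) fl.
by rewrite mul0r add0r.
Qed.

Lemma cexp_iC x : cexp (iC R * ofR x) = (cos x +i* sin x).
Proof.
by apply: complex_eq; rewrite /= !mul0r !mul1r ?add0r ?subr0 ?expR0 ?mul1r ?oppr0 ?addr0 ?expR0 ?mul1r.
Qed.

Lemma cabs_cexp_iC x : cabs (cexp (iC R * ofR x)) = 1.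
Proof. by rewrite cabs_cexp cReM /= mul0r mulr0 subr0 expR0. Qed.

Definition circle (r x : R) : Cplx R := ofR r * cexp (iC R * ofR x).

Lemma cabs_circle r x : 0 <= r -> cabs (circle r x) = r.
Proof. by move=> r0; rewrite cabsM cabs_cexp_iC mulr1 cabs_ofR ger0_norm. Qed.

Lemma rcdiff_circle r x : rcdiff (circle r) x (iC R * circle r x).
Proof.
have h : cdiff (fun w => ofR r * cexp (iC R * w)) (ofR x) (ofR r * (cexp (iC R * ofR x) * (iC R * 1))).
  by apply: cdiffZ; apply: cdiff_comp; [apply: cdiffZ; exact: cdiff_id|exact: cexp_cdiff].
have := cdiff_rcdiff (rcdiff_ofR x) h.
by rewrite /circle mulr1 mulr1 (_ : _ * _ = iC R * (ofR r * cexp (iC R * ofR x)))//; ring.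
Qed.

Lemma circle_period r : circle r (2 * pi) = circle r 0.
Proof.
by rewrite /circle !cexp_iC mulr_natl cos2pi sin2pi cos0 sin0.
Qed.

Lemma geometric_eq0 (q C : R) z : 0 <= q < 1 ->
  (forall N, cabs z <= C * q ^+ N.+1) -> z = 0.
Proof.
move=> q01 h; apply: cabs_eq0; apply/eqP; rewrite eq_le cabs_ge0 andbT.
have qc : (fun N => C * q ^+ N.+1) @ \oo --> C * 0.
  apply: cvgMl_tmp; rewrite (cvg_shiftS (fun N => q ^+ N)).
  by apply: cvg_expr; rewrite ger0_norm; lra.
rewrite -(mulr0 C) -(cvg_lim (@Rhausdorff R) qc); apply: limr_ge; first by apply/cvg_ex; exists (C * 0).
exact: nearW.
Qed.

Variables (f : Cplx R -> Cplx R) (r rho : R).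
Hypotheses (r0 : 0 < r) (r_rho : r < rho).
Hypothesis df : forall w, cabs w < rho -> exists l, cdiff f w l.
Local Notation p := (circle r).

Lemma circle_neq0 x : p x != 0.
Proof. by rewrite -cabs_gt0 cabs_circle// ltW. Qed.

Lemma cont_circle a b : cont_on a b p.
Proof. by move=> x _; exact: rcdiff_continuous (rcdiff_circle r x). Qed.

Lemma cont_cdiff_circle (g : Cplx R -> Cplx R) a b :
  (forall x, exists l, cdiff g (p x) l) -> cont_on a b (fun x => g (p x)).
Proof.
move=> dgp x _; have [l gl] := dgp x.
exact: rcdiff_continuous (cdiff_rcdiff (rcdiff_circle r x) gl).
Qed.

(** On the circle $dw = i w\,dx$, so the Cauchy integral of $f(w)/(w-z)$ is $i$ times the integral
    in $x$ of [f] against [kernel]. *)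
Definition kernel z w := w * (w - z)^-1.

Lemma cdiff_kernel z w : w - z != 0 -> exists l, cdiff (kernel z) w l.
Proof.
move=> wz; have h : cdiff (fun w => w - z) w (1 + 0) by exact: cdiffD (cdiff_id w) (cdiff_cst _ _).
by eexists; apply: (cdiffM (cdiff_id w)); exact: (cdiff_comp h (cdiffV wz)).
Qed.

Lemma circleB_neq0 z x : cabs z < r -> p x - z != 0.
Proof.
by move=> zr; rewrite -cabs_gt0; have := cabs_ger (p x) z; rewrite cabs_circle ?(ltW r0)//; lra.
Qed.

Lemma cont_kernel z a b : cabs z < r -> cont_on a b (fun x => kernel z (p x)).
Proof. by move=> zr; apply: cont_cdiff_circle => x; apply: cdiff_kernel; exact: circleB_neq0. Qed.

Lemma kernel_le z x : cabs z < r -> cabs (kernel z (p x)) <= r / (r - cabs z).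
Proof.
move=> zr; rewrite cabsM cabsV cabs_circle ?(ltW r0)// ler_pM2l// lef_pV2 ?posrE; last 2 first.
- by rewrite cabs_gt0 circleB_neq0.
- by rewrite subr_gt0.
by have := cabs_ger (p x) z; rewrite cabs_circle ?(ltW r0)//.
Qed.

Lemma cont_circleVX k a b : cont_on a b (fun x => (p x)^-1 ^+ k).
Proof.
elim: k => [|k IH]; first by move=> x _; exact: cvg_cst.
have cV : cont_on a b (fun x => (p x)^-1).
  by apply: cont_cdiff_circle => x; eexists; apply: cdiffV; exact: circle_neq0.
have -> : (fun x => (p x)^-1 ^+ k.+1) = (fun x => (p x)^-1 * (p x)^-1 ^+ k).
  by apply/funext => x; rewrite exprS.
exact: cont_onM cV IH.
Qed.

Lemma two_pi_gt0 : 0 < 2 * pi :> R.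
Proof. by rewrite mulr_gt0// pi_gt0. Qed.
Let pi0 : 0 <= 2 * pi :> R := ltW two_pi_gt0.

(** For positive [k] the integrand has the primitive [U] along the circle, which takes the same
    value at both ends of the period. *)
Lemma cint_circleVX k : (0 < k)%N -> cint 0 (2 * pi) (fun x => (p x)^-1 ^+ k) = 0.
Proof.
move=> k0; have kn0 : (k%:R : Cplx R) != 0 by rewrite pnatr_eq0 -lt0n.
have iC0 : iC R != 0 by rewrite -cabs_gt0 cabs_iC.
pose U (w : Cplx R) := - (k%:R * iC R)^-1 * w^-1 ^+ k.
have dpow (w : Cplx R) j : w != 0 -> cdiff (fun w => w^-1 ^+ j) w (- j%:R * w^-1 ^+ j * w^-1).
  move=> w0; elim: j => [|j IH].
    by rewrite oppr0 !mul0r; exact: cdiff_cst.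
  have -> : (fun w : Cplx R => w^-1 ^+ j.+1) = (fun w => w^-1 * w^-1 ^+ j).
    by apply/funext => v; rewrite exprS.
  have -> : - j.+1%:R * w^-1 ^+ j.+1 * w^-1 = - w ^- 2 * w^-1 ^+ j + w^-1 * (- j%:R * w^-1 ^+ j * w^-1).
    by rewrite -[j.+1%:R]natr1 exprS -exprVn; ring.
  exact: cdiffM (cdiffV w0) IH.
have dU x : rcdiff (fun x => U (p x)) x ((p x)^-1 ^+ k).
  have h := cdiffZ (- (k%:R * iC R)^-1) (@dpow (p x) k (circle_neq0 x)).
  have := cdiff_rcdiff (rcdiff_circle r x) h.
  rewrite (_ : _ * _ * (iC R * _) = (p x)^-1 ^+ k)//.
  by have pn := circle_neq0 x; field; rewrite pn kn0 iC0.
rewrite (@cint_FTC _ _ _ _ _ pi0 (fun x _ => dU x)); last exact: cont_circleVX.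
by rewrite circle_period subrr.
Qed.

(** A finite geometric expansion of $w/(w-z)$ in powers of $z/w$ with its exact remainder; sum and
    integral need no interchange of limits. The weight [u] will be 1 and then [f] on the circle. *)
Lemma cint_kernel z (u : R -> Cplx R) N : cabs z < r -> cont_on 0 (2 * pi) u ->
  cint 0 (2 * pi) (fun x => u x * kernel z (p x)) =
  \sum_(0 <= k < N) cint 0 (2 * pi) (fun x => u x * (p x)^-1 ^+ k) * z ^+ k +
  z ^+ N * cint 0 (2 * pi) (fun x => u x * (p x)^-1 ^+ N * kernel z (p x)).
Proof.
move=> zr cu; elim: N => [|N IH].
  rewrite big_nil add0r expr0 mul1r; apply: cint_ext => x _.
  by rewrite expr0 mulr1.
rewrite IH big_nat_recr//= -addrA; congr (_ + _).
have c1 : cont_on 0 (2 * pi) (fun x => u x * (p x)^-1 ^+ N) := cont_onM cu (cont_circleVX (k := N) (b := 2 * pi)).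
have c2 : cont_on 0 (2 * pi) (fun x => u x * (p x)^-1 ^+ N.+1 * kernel z (p x)).
  exact: (cont_onM (cont_onM cu (cont_circleVX (k := N.+1) (b := 2 * pi))) (cont_kernel zr)).
set J := cint _ _ (fun x => u x * (p x)^-1 ^+ N); set I1 := cint _ _ (fun x => u x * (p x)^-1 ^+ N.+1 * _).
rewrite (_ : cint _ _ _ = J + z * I1); first by rewrite exprS; ring.
rewrite /I1 -(cintZ z c2) -(cintD c1 (cont_onZ (l := z) c2)).
apply: cint_ext => x _; have pz := circleB_neq0 x zr; have pn := circle_neq0 x.
by rewrite /kernel exprS; field; rewrite pz pn.
Qed.

Lemma cint_kernel_rest z (u : R -> Cplx R) (M : R) N : cabs z < r -> cont_on 0 (2 * pi) u ->
  (forall x, 0 <= x <= 2 * pi -> cabs (u x) <= M) ->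
  cabs (z ^+ N * cint 0 (2 * pi) (fun x => u x * (p x)^-1 ^+ N * kernel z (p x))) <=
  (2 * (M * (r / (r - cabs z))) * (2 * pi)) * (cabs z / r) ^+ N.
Proof.
move=> zr cu uM; rewrite cabsM cabsX.
have c2 : cont_on 0 (2 * pi) (fun x => u x * (p x)^-1 ^+ N * kernel z (p x)).
  exact: (cont_onM (cont_onM cu (cont_circleVX (k := N) (b := 2 * pi))) (cont_kernel zr)).
have M0 : 0 <= M by apply: le_trans (uM 0 _); [exact: cabs_ge0|rewrite lexx].
have K0 : 0 <= r / (r - cabs z) by rewrite divr_ge0 ?(ltW r0)// subr_ge0 ltW.
have h : cabs (cint 0 (2 * pi) (fun x => u x * (p x)^-1 ^+ N * kernel z (p x))) <=
    2 * (M * r^-1 ^+ N * (r / (r - cabs z))) * (2 * pi - 0).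
  apply: (cint_le pi0 c2) => x hx; rewrite 2!cabsM ler_pM ?mulr_ge0 ?cabs_ge0 ?kernel_le//.
  by rewrite ler_pM ?cabs_ge0 ?uM// cabsX cabsV cabs_circle// ltW.
apply: le_trans (ler_wpM2l (exprn_ge0 N (cabs_ge0 z)) h) _.
rewrite le_eqVlt; apply/orP; left; apply/eqP; rewrite exprMn; ring.
Qed.

(** Terms of positive degree vanish by periodicity, the constant term gives $2\pi$, and the
    remainder tends to 0 geometrically. *)
Lemma cint_kernel1 z : cabs z < r -> cint 0 (2 * pi) (fun x => kernel z (p x)) = ofR (2 * pi).
Proof.
move=> zr; apply/eqP; rewrite -subr_eq0; apply/eqP.
have c1 : cont_on 0 (2 * pi) (fun _ : R => (1 : Cplx R)) by exact: cont_on_cst.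
apply: (geometric_eq0 (ratio_lt1 zr)) => N.
apply: le_trans (cint_kernel_rest N.+1 zr c1 (M := 1) _); last by move=> x _; rewrite cabs1.
rewrite [X in X - _](_ : _ = cint 0 (2 * pi) (fun x => 1 * kernel z (p x))); last first.
  by apply: cint_ext => x _; rewrite mul1r.
rewrite (cint_kernel N.+1 zr c1) big_nat_recl//= big1 ?addr0; last first.
  move=> i _; rewrite (_ : cint _ _ _ = 0) ?mul0r// -(cint_circleVX (ltn0Sn i)).
  by apply: cint_ext => x _; rewrite mul1r.
rewrite expr0 mulr1 (_ : cint _ _ _ = ofR (2 * pi)); last first.
  rewrite (@cint_FTC _ _ _ _ (@ofR R) pi0); first by rewrite subr0.
  - by move=> x _; rewrite expr0 mul1r; exact: rcdiff_ofR.
  - by move=> x _; apply: cvg_cst.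
by rewrite addrC addKr.
Qed.

(** For small [t] the factor [f (G t x)] is uniformly close to [f z], and [cint_kernel1] evaluates
    the integral that remains; constancy of [J] carries this to [t = 1]. *)
Lemma cauchy_formula z : cabs z < r ->
  cint 0 (2 * pi) (fun x => f (p x) * kernel z (p x)) = f z * ofR (2 * pi).
Proof.
move=> zr; have rho0 : 0 <= r by exact: ltW.
have Z0 := cabs_ge0 z.
pose G t x := z + ofR t * (p x - z).
have inD t x : 0 <= t <= 1 -> cabs (G t x) < rho.
  move=> /andP[t0 t1]; rewrite (_ : G t x = ofR (1 - t) * z + ofR t * p x); last by rewrite /G ofRB ofR1; ring.
  apply: le_lt_trans (cabsD _ _) _; rewrite 2!cabsM !cabs_ofR cabs_circle// !ger0_norm//; last by lra.
  by have h := r_rho; nra.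
have cm := cont_kernel zr (a := 0) (b := 2 * pi).
have contf t a b : 0 <= t <= 1 -> cont_on a b (fun x => f (G t x)).
  move=> t01 x _; have [l fl] := df (inD t x t01).
  have h1 : cdiff (fun w => z + ofR t * (w - z)) (p x) (0 + ofR t * (1 + 0)).
    by apply: cdiffD; [exact: cdiff_cst|apply: cdiffZ; apply: cdiffD; [exact: cdiff_id|exact: cdiff_cst]].
  exact: rcdiff_continuous (cdiff_rcdiff (cdiff_rcdiff (rcdiff_circle r x) h1) fl).
have cJ t : 0 <= t <= 1 -> cont_on 0 (2 * pi) (fun x => f (G t x) * kernel z (p x)).
  by move=> t01; exact: (cont_onM (contf t 0 (2 * pi) t01) cm).
(* [J t] is the integral of [f (w) / (w - z)] over the circle contracted by the factor [t] towards [z];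
   the contraction avoids the singularity at [z], so Goursat makes [J] constant on [(0, 1]] *)
pose J t := cint 0 (2 * pi) (fun x => f (G t x) * kernel z (p x)).
have J1 d : 0 < d <= 1 -> J 1 = J d.
  move=> /andP[d0 d1].
  pose G1 (t x : R) := p x - z; pose G2 (t x : R) := ofR t * (iC R * p x).
  pose g w := f w * (w - z)^-1.
  have GB t x : G t x - z = ofR t * (p x - z) by rewrite /G; ring.
  have dt t x : rcdiff (fun s => G s x) t (G1 t x).
    have h1 : cdiff (fun w => z + (p x - z) * w) (ofR t) (0 + (p x - z) * 1).
      by apply: cdiffD; [exact: cdiff_cst|apply: cdiffZ; exact: cdiff_id].
    have := cdiff_rcdiff (rcdiff_ofR t) h1; rewrite add0r !mulr1.
    by congr rcdiff; apply/funext => s; rewrite /G mulrC.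
  have dx t x : rcdiff (G t) x (G2 t x).
    have h1 : cdiff (fun w => z + ofR t * (w - z)) (p x) (0 + ofR t * (1 + 0)).
      by apply: cdiffD; [exact: cdiff_cst|apply: cdiffZ; apply: cdiffD; [exact: cdiff_id|exact: cdiff_cst]].
    by have := cdiff_rcdiff (rcdiff_circle r x) h1; rewrite add0r addr0 mulr1.
  have : boundary_integral g G G1 G2 d (1 - d) 0 (2 * pi) = 0.
    have w1 : 0 <= 1 - d by lra.
    apply: (@goursat R g G G1 G2 d (1 - d) 0 (2 * pi) (2 * r) w1 pi0 (fun t x _ => dt t x) (fun t x _ => dx t x)).
    - by move=> t x _; apply: le_trans (cabsB _ _) _; rewrite cabs_circle//; lra.
    - move=> t x [/andP[t0 t1] _]; rewrite 2!cabsM cabs_ofR cabs_iC cabs_circle// mul1r ger0_norm; last by lra.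
      by have h := r0; nra.
    - by move=> t x _; exact: cvg_cst.
    - by move=> t x _; apply: (cont_onZ (l := ofR t) (cont_onZ (l := iC R) (cont_circle (a := x) (b := x)))); rewrite lexx.
    - move=> t x [/andP[t0 t1] _]; have [l fl] := df (inD t x ltac:(lra)).
      have Gz : G t x - z != 0.
        rewrite GB mulf_neq0 ?circleB_neq0// -cabs_gt0 cabs_ofR normr_gt0; lra.
      have h : cdiff (fun w => w - z) (G t x) (1 + 0) by exact: cdiffD (cdiff_id _) (cdiff_cst _ _).
      by eexists; apply: (cdiffM fl); exact: (cdiff_comp h (cdiffV Gz)).
  rewrite /boundary_integral !add0r.
  (* The sides [x = 0] and [x = 2 * pi] have the same image and cancel. *)
  have -> : (fun t => g (G t (2 * pi)) * G1 t (2 * pi)) = (fun t => g (G t 0) * G1 t 0).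
    by rewrite /G /G1 circle_period.
  (* The factor [t] in [G2] cancels the one in [G t x - z]: the form $dw/(w-z)$ is invariant under
     the contraction. *)
  have hV t : 0 < t <= 1 -> cint 0 (2 * pi) (fun x => g (G t x) * G2 t x) = iC R * J t.
    move=> t01; have t01' : 0 <= t <= 1 by lra.
    rewrite /J -(cintZ (iC R) (cJ t t01')).
    apply: cint_ext => x _; rewrite /g /G2 /kernel GB.
    have tn0 : ofR t != 0 :> Cplx R by rewrite -cabs_gt0 cabs_ofR normr_gt0; lra.
    by have pz := circleB_neq0 x zr; field; rewrite pz tn0.
  rewrite (_ : d + (1 - d) = 1); last by ring.
  rewrite !hV ?ltr01 ?lexx ?d0// => h.
  have iC0 : iC R != 0 by rewrite -cabs_gt0 cabs_iC.
  apply: (mulfI iC0); apply/eqP; rewrite -subr_eq0 -h; apply/eqP; ring.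
have -> : cint 0 (2 * pi) (fun x => f (p x) * kernel z (p x)) = J 1.
  by apply: cint_ext => x _; rewrite /G ofR1 mul1r subrKC.
rewrite -(cint_kernel1 zr) -(cintZ (f z) cm).
apply/eqP; rewrite -subr_eq0; apply/eqP; apply: cabs_eq0; apply/eqP; rewrite eq_le cabs_ge0 andbT.
set K := r / (r - cabs z); have K0 : 0 <= K by rewrite divr_ge0 ?(ltW r0)// subr_ge0 ltW.
apply/ler_addgt0Pr => e e0; rewrite add0r.
have [l fl] := df (lt_trans zr r_rho).
have pi0' := two_pi_gt0.
have C0 : 0 < 2 * K * (2 * pi) + 1 by rewrite ltr_wpDl// mulr_ge0// mulr_ge0.
have [d d0 hd] := cdiff_cont fl (divr_gt0 e0 C0).
(* The displacement from [z] is at most [t * (2 * r)], hence at most [d / 2]. *)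
pose t := Num.min 1 (d / (4 * r)).
have t0 : 0 < t by rewrite lt_min ltr01 divr_gt0// mulr_gt0.
have t1 : t <= 1 by rewrite ge_min lexx.
have td : t * (4 * r) <= d by rewrite -ler_pdivlMr ?mulr_gt0// ge_min lexx orbT.
have t01 : 0 <= t <= 1 by rewrite ltW.
have c1 := cJ t t01; have c2 := cont_onZ (l := f z) cm.
rewrite (J1 t) ?t0// /J -(cintB c1 c2).
apply: le_trans (cint_le pi0 (cont_onB c1 c2) (M := e / (2 * K * (2 * pi) + 1) * K) _) _.
- move=> x _; rewrite -mulrBl cabsM ler_pM ?cabs_ge0 ?kernel_le//.
  apply: ltW; apply: hd; rewrite cabsM cabs_ofR gtr0_norm//.
  apply: le_lt_trans (_ : t * (2 * r) < d); last by nra.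
  by rewrite ler_wpM2l ?(ltW t0)//; apply: le_trans (cabsB _ _) _; rewrite cabs_circle//; lra.
move: C0; set D := 2 * K * (2 * pi) => C0.
rewrite subr0 [leLHS](_ : _ = e * (D / (D + 1))); last by rewrite /D; ring.
by rewrite ler_piMr ?(ltW e0)// ler_pdivrMr// mul1r lerDl.
Qed.

(** The coefficients are Cauchy integrals over the circle of radius [r], and the exact remainder of
    [cint_kernel] decays like $(|z|/r)^N$. The circle has to lie inside the domain, which is why [r]
    is strictly below [rho]. *)
Lemma cauchy_taylor : exists c, converges_in c r /\ forall z, cabs z < r -> f z = pval c z.
Proof.
have cf : cont_on 0 (2 * pi) (fun x => f (p x)).
  by apply: cont_cdiff_circle => x; apply: df; rewrite cabs_circle// ltW.
have [M hM] : exists M, forall x, 0 <= x <= 2 * pi -> cabs (f (p x)) <= M.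
  have [|c _ hc] := @EVT_max R (fun x => cabs (f (p x))) 0 (2 * pi) pi0.
    by apply: within_of_for => x /cf; exact: cvg_cabs.
  by exists (cabs (f (p c))) => x hx; apply: hc; rewrite in_itv.
pose c k := (ofR (2 * pi))^-1 * cint 0 (2 * pi) (fun x => f (p x) * (p x)^-1 ^+ k).
have tp0 : ofR (2 * pi) != 0 :> Cplx R.
  by rewrite -cabs_gt0 cabs_ofR gtr0_norm two_pi_gt0.
have main z : cabs z < r -> series (fun k => c k * z ^+ k) @ \oo --> f z.
  move=> zr; apply/cvg_cabsP => e e0.
  set C := 2 * (M * (r / (r - cabs z))) * (2 * pi).
  have qc : (fun N => (2 * pi)^-1 * C * (cabs z / r) ^+ N) @ \oo --> (2 * pi)^-1 * C * 0.
    apply: cvgMl_tmp; apply: cvg_expr; have := ratio_lt1 zr => /andP[h1 h2].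
    by rewrite ger0_norm.
  rewrite mulr0 in qc; move/cvgrPdist_lt : qc => /(_ _ e0) [n0 _ hn]; exists n0 => // N /hn.
  rewrite sub0r normrN => h; apply: le_lt_trans h.
  apply: le_trans (ler_norm _); rewrite -mulrA.
  have := cint_kernel_rest N zr cf hM; rewrite -/C => h.
  have E : series (fun k => c k * z ^+ k) N - f z = - ((ofR (2 * pi))^-1 *
      (z ^+ N * cint 0 (2 * pi) (fun x => f (p x) * (p x)^-1 ^+ N * kernel z (p x)))).
    have := cint_kernel N zr cf; rewrite (cauchy_formula zr).
    set S := \sum_(_ <= _ < _) _; set Z := z ^+ N * _ => hS.
    have -> : series (fun k => c k * z ^+ k) N = (ofR (2 * pi))^-1 * S.
      by rewrite /series /= mulr_sumr; apply: eq_bigr => k _; rewrite /c mulrA.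
    have -> : f z = (ofR (2 * pi))^-1 * (S + Z) by rewrite -hS [f z * _]mulrC mulKf.
    by ring.
  rewrite E cabsN cabsM cabsV cabs_ofR gtr0_norm ?two_pi_gt0// ler_wpM2l//.
  by rewrite invr_ge0 pi0.
exists c; split; last by move=> z /main /pval_unique.
apply: converges_in_cvg => s /andP[s0 sr]; apply/cvg_ex; exists (f (ofR s)).
by apply: main; rewrite cabs_ofR gtr0_norm.
Qed.

End cauchy.

(** * The substitution [w = 1 - exp (- eta s)] *)

Section mercator.
Variable R : realType.
Implicit Types (z w h l : Cplx R) (c d : nat -> Cplx R) (x s r : R).

Lemma converges_inS c r r' : r' <= r -> converges_in c r -> converges_in c r'.
Proof. by move=> rr h s /andP[s0 sr]; apply: h; lra. Qed.

(* coefficients of [(1 - w) * sum_k d_k w^k] *)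
Definition mul1BX d k : Cplx R := d k - (if k is j.+1 then d j else 0).

Lemma pval_mul1BX d r : converges_in d r -> converges_in (mul1BX d) r /\
  forall w, cabs w < r -> pval (mul1BX d) w = (1 - w) * pval d w.
Proof.
move=> dr; split.
  move=> s /[dup] /andP[s0 _] /dr[M hM]; exists (M + s * M) => -[|k].
    rewrite /mul1BX subr0; have := hM 0%N; have : 0 <= s * M.
      rewrite mulr_ge0 ?(ltW s0)//; apply: le_trans (hM 0%N); rewrite expr0 mulr1; exact: cabs_ge0.
    by lra.
  apply: (@le_trans _ _ ((cabs (d k.+1) + cabs (d k)) * s ^+ k.+1)).
    by rewrite ler_wpM2r ?cabsB// exprn_ge0// ltW.
  by rewrite mulrDl lerD// exprS mulrCA ler_wpM2l// ltW.
move=> w wr; apply: pval_unique; rewrite -cvg_shiftS mulrBl mul1r.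
pose S n := series (fun k => d k * w ^+ k) n.
have -> : (fun n => series (fun k => mul1BX d k * w ^+ k) n.+1) = (fun n => S n.+1 - w * S n).
  apply/funext => n; rewrite /S /series /=.
  rewrite big_nat_recl// [in RHS]big_nat_recl// mulr_sumr -addrA -sumrB; congr (_ + _).
    by rewrite /mul1BX subr0.
  by apply: eq_bigr => k _; rewrite /mul1BX exprS; ring.
have h1 : (fun n => S n.+1) @ \oo --> pval d w.
  by rewrite (cvg_shiftS S); exact: pval_cvg dr wr.
have h2 : (fun n => w * S n) @ \oo --> w * pval d w.
  by apply: cvgMl_tmp; exact: pval_cvg dr wr.
exact: cvgB h1 h2.
Qed.

Lemma pval_scale a d r : converges_in d r -> converges_in (fun k => a * d k) r /\
  forall w, cabs w < r -> pval (fun k => a * d k) w = a * pval d w.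
Proof.
move=> dr; split.
  move=> s /dr[M hM]; exists (cabs a * M) => k.
  by rewrite cabsM -mulrA ler_wpM2l ?cabs_ge0.
move=> w wr; apply: pval_unique.
have -> : series (fun k => a * d k * w ^+ k) = (fun n => a * series (fun k => d k * w ^+ k) n).
  by apply/funext => n; rewrite /series /= mulr_sumr; apply: eq_bigr => k _; rewrite mulrA.
by apply: cvgMl_tmp; exact: pval_cvg dr wr.
Qed.

Definition indic0 (k : nat) : Cplx R := if k is 0%N then 1 else 0.

Lemma pval_indic0 w : pval indic0 w = 1.
Proof.
apply: pval_unique; apply/cvg_cabsP => e e0; exists 1%N => // -[//|n] _.
rewrite /series /= big_nat_recl// big1 ?addr0; last by move=> i _; rewrite mul0r.
by rewrite expr0 mulr1 subrr cabs0.
Qed.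

Lemma converges_in_indic0 r : converges_in indic0 r.
Proof.
move=> s /andP[s0 _]; exists 1 => -[|k]; first by rewrite cabs1 expr0 mulr1.
by rewrite cabs0 mul0r.
Qed.

Definition mercator w : Cplx R := - clog (1 - w).

Lemma cRe1B_gt0 w : cabs w < 1 -> 0 < cRe (1 - w).
Proof. by move=> w1; rewrite cReB /=; have := normr_cRe w; rewrite ler_norml; lra. Qed.

Lemma mercator_cdiff w : cabs w < 1 -> cdiff mercator w (1 - w)^-1.
Proof.
move=> w1; have h1 : cdiff (fun w => 1 + (-1) * w) w (0 + (-1) * 1).
  by apply: cdiffD; [exact: cdiff_cst|apply: cdiffZ; exact: cdiff_id].
have w2 : 0 < cRe (1 + (-1) * w) by rewrite mulN1r cRe1B_gt0.
have := cdiffZ (-1) (cdiff_comp h1 (clog_cdiff w2)).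
rewrite (_ : (fun w => _ * _) = mercator); last by apply/funext => v; rewrite /mercator !mulN1r.
by congr cdiff; rewrite mulN1r; ring.
Qed.

Lemma mercator_ofR x : x < 1 -> mercator (ofR x) = ofR (- ln (1 - x)).
Proof. by move=> x1; rewrite /mercator -ofR1 -ofRB clog_ofR ?subr_gt0// ofRN. Qed.

(** The function has some Taylor series, and $(1-w) L' = 1$ forces $(k+1) c_{k+1} = 1$. At [k = 0]
    the convention that the inverse of 0 is 0 supplies the correct constant term. *)
Lemma mercator_series w : cabs w < 1 ->
  mercator w = pval (fun k => ofR (k%:R^-1)) w.
Proof.
move=> w1; have [r /andP[r0 r1] wr] := mid_radius w1.
have [c [cr cE]] := cauchy_taylor r0 r1 (fun v v1 => ex_intro _ _ (mercator_cdiff v1)).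
have dE v : cabs v < r -> pval (dcoef c) v = (1 - v)^-1.
  move=> vr; apply: cdiff_unique (pval_cdiff cr vr) _.
  apply: cdiff_near (mercator_cdiff (lt_trans vr r1)).
  exists (r - cabs v); first by rewrite subr_gt0.
  move=> v' h; apply: cE; rewrite (_ : v' = v + (v' - v)); last by ring.
  by apply: le_lt_trans (cabsD _ _) _; lra.
have [mr mE] := pval_mul1BX (converges_in_dcoef cr).
have key k : mul1BX (dcoef c) k = indic0 k.
  apply: (pval_inj_real r0 mr (converges_in_indic0 (r := r))) => s /andP[s0 sr].
  have sr' : cabs (ofR s) < r by rewrite cabs_ofR gtr0_norm.
  rewrite mE// dE// pval_indic0 divff// -cabs_gt0.
  by apply: lt_le_trans (normr_cRe _); rewrite normr_gt0 gt_eqF// cRe1B_gt0//; apply: lt_trans sr' _.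
have dc k : dcoef c k = 1.
  elim: k => [|k IH]; first by have := key 0%N; rewrite /mul1BX subr0.
  by have := key k.+1; rewrite /mul1BX IH => /eqP; rewrite subr_eq add0r => /eqP.
rewrite cE//; congr pval; apply/funext => -[|k].
  have := cE 0; rewrite pval0 cabs0 => <-//.
  by rewrite (mercator_ofR (x := 0))// subr0 ln1 oppr0 invr0.
have := dc k; rewrite /dcoef => h; rewrite ofRV ofR_nat.
have kn0 : (k.+1%:R : Cplx R) != 0 by rewrite pnatr_eq0.
by apply: (mulfI kn0); rewrite h divff.
Qed.

Lemma cRe_series_ofR (d : nat -> R) x n :
  cRe (series (fun k => ofR (d k) * ofR x ^+ k) n) = \sum_(0 <= k < n) d k * x ^+ k.
Proof. by rewrite /series /= cRe_sum; apply: eq_bigr => k _; rewrite -ofRX -ofRM. Qed.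

Lemma pval_nneg_ge (d : nat -> R) x r n : converges_in (fun k => ofR (d k)) r -> 0 <= x < r ->
  (forall k, 0 <= d k) ->
  \sum_(0 <= k < n) d k * x ^+ k <= cRe (pval (fun k => ofR (d k)) (ofR x)).
Proof.
move=> dr /andP[x0 xr] d0; have xr' : cabs (ofR x) < r by rewrite cabs_ofR ger0_norm.
apply/ler_addgt0Pr => e e0.
have /cvg_cabsP /(_ _ e0) [N _ hN] := pval_cvg dr xr'.
have := hN (maxn n N) (leq_maxr _ _) => /(le_lt_trans (normr_cRe _)).
rewrite cReB cRe_series_ofR ltr_norml => /andP[_].
suff : \sum_(0 <= k < n) d k * x ^+ k <= \sum_(0 <= k < maxn n N) d k * x ^+ k by lra.
rewrite (big_cat_nat (leq0n n) (leq_maxl n N))//= lerDl.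
by apply: sumr_ge0 => k _; rewrite mulr_ge0// exprn_ge0.
Qed.

Lemma pval_majorant c (d : nat -> R) z r : converges_in c r -> converges_in (fun k => ofR (d k)) r ->
  cabs z < r -> (forall k, cabs (c k) <= d k) ->
  cabs (pval c z) <= cRe (pval (fun k => ofR (d k)) (ofR (cabs z))).
Proof.
move=> cr dr zr cd; apply: (cabs_cvg_le _ (pval_cvg cr zr)); apply: nearW => n.
have d0 k : 0 <= d k by apply: le_trans (cd k); exact: cabs_ge0.
apply: le_trans (pval_nneg_ge n dr _ d0); last by rewrite cabs_ge0.
apply: le_trans (cabs_sum _ _ _) _; apply: ler_sum => k _.
by rewrite cabsM cabsX ler_wpM2r// exprn_ge0// cabs_ge0.
Qed.

Lemma converges_in_harmonic : converges_in (fun k => ofR (k%:R^-1)) (1 : R).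
Proof.
move=> s /andP[s0 s1]; exists 1 => k; rewrite cabs_ofR ger0_norm ?invr_ge0//.
apply: (@le_trans _ _ (1 * 1)); last by rewrite mulr1.
apply: ler_pM; rewrite ?invr_ge0 ?exprn_ge0 ?(ltW s0)//; last by rewrite exprn_ile1// ltW.
by case: k => [|k]; [rewrite invr0|rewrite invf_le1// ler1n].
Qed.

(** The coefficients $1/k$ are nonnegative, so on each circle the modulus is largest at the positive
    real point. *)
Lemma mercator_le w : cabs w < 1 -> cabs (mercator w) <= - ln (1 - cabs w).
Proof.
move=> w1; have aw1 : cabs (ofR (cabs w)) < 1 by rewrite cabs_ofR ger0_norm ?cabs_ge0.
rewrite mercator_series//.
apply: le_trans (pval_majorant converges_in_harmonic converges_in_harmonic w1 _) _.
  by move=> k; rewrite cabs_ofR ger0_norm ?invr_ge0.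
by rewrite -mercator_series// mercator_ofR.
Qed.

(** Since $|1-w| < 2$, the real part exceeds $-\ln 2 \ge -1$; the argument is below $\pi/2 < 2$. The
    rounded bounds 1 and 2 add up to the 3 of [mercator_strip]. *)
Lemma mercator_region w : cabs w < 1 -> -1 < cRe (mercator w) /\ `|cIm (mercator w)| < 2.
Proof.
move=> w1; rewrite /mercator cReN cImN normrN cIm_clog_lt; split => //.
rewrite cRe_clog ltrN2; have p0 : 0 < cabs (1 - w).
  by apply: lt_le_trans (normr_cRe _); rewrite normr_gt0 gt_eqF// cRe1B_gt0.
have h : cabs (1 - w) < 2 by apply: le_lt_trans (cabsB _ _) _; rewrite cabs1; lra.
apply: (@lt_le_trans _ _ (ln 2)); first by rewrite ltr_ln ?posrE.
by rewrite (_ : 2 = 1 + 1)// le_ln1Dx//; lra.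
Qed.

End mercator.

(** * Rising products of the shift and their generating function *)

Section rising.

(* [rising e a k j] is entry [j] of [prod_(r < k) (e S + r)] applied to [a], [S] being the shift of sequences *)
Fixpoint rising {K : fieldType} (e : K) (a : nat -> K) (k : nat) : nat -> K :=
  if k is r.+1 then fun j => e * rising e a r j.+1 + r%:R * rising e a r j else a.

Variable R : realType.
Implicit Types (a : nat -> Cplx R) (eta rho s : R) (w : Cplx R).

Definition qseq eta a k : Cplx R := (k`!%:R)^-1 * rising (ofR eta^-1) a k 0.

Definition taylor a k : Cplx R := (k`!%:R)^-1 * a k.

Definition shift_seq a j : Cplx R := a j.+1.

(** The factors $e S + r$ commute with the shift $S$. *)
Lemma rising_shift (e : Cplx R) a k j : rising e (shift_seq a) k j = rising e a k j.+1.
Proof. by elim: k j => [//|k IH] j /=; rewrite !IH. Qed.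

(** The coefficient form of $(1-w) H_a' = \eta^{-1} H_{Sa}$, where $H_a$ is the Taylor series of [a]
    composed with the scaled [mercator]. *)
Lemma qseqS eta a k : k.+1%:R * qseq eta a k.+1 = ofR eta^-1 * qseq eta (shift_seq a) k + k%:R * qseq eta a k.
Proof.
have kn0 : (k.+1%:R : Cplx R) != 0 by rewrite pnatr_eq0.
rewrite /qseq /= rising_shift factS natrM invfM -mulrA mulVKf//; ring.
Qed.

Lemma dcoef_taylor a : dcoef (taylor a) = taylor (shift_seq a).
Proof.
have kn0 k : (k.+1%:R : Cplx R) != 0 by rewrite pnatr_eq0.
by apply/funext => k; rewrite /dcoef /taylor /shift_seq factS natrM invfM -mulrA mulVKf.
Qed.

Lemma converges_in_shift a rho : converges_in (taylor a) rho -> converges_in (taylor (shift_seq a)) rho.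
Proof. by rewrite -dcoef_taylor; exact: converges_in_dcoef. Qed.

Lemma one_sub_exp_lt1 eta s : 1 - expR (- eta * s) < 1.
Proof. by rewrite gtrBl expR_gt0. Qed.

Lemma mercator_scaled_lt eta rho w : 0 < eta -> cabs w < 1 - expR (- eta * rho) ->
  cabs (ofR eta^-1 * mercator w) < rho.
Proof.
move=> e0 hw; have w1 := lt_trans hw (one_sub_exp_lt1 eta rho).
rewrite cabsM cabs_ofR ger0_norm ?invr_ge0 ?(ltW e0)// mulrC ltr_pdivrMr//.
apply: le_lt_trans (mercator_le w1) _.
rewrite ltrNl -ltr_expR lnK ?posrE ?subr_gt0// mulrC -mulNr; lra.
Qed.

Lemma taylor_mercator_cdiff eta rho a w : 0 < eta -> converges_in (taylor a) rho ->
  cabs w < 1 - expR (- eta * rho) ->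
  cdiff (fun w => pval (taylor a) (ofR eta^-1 * mercator w)) w
    (pval (taylor (shift_seq a)) (ofR eta^-1 * mercator w) * (ofR eta^-1 * (1 - w)^-1)).
Proof.
move=> e0 ar hw; have w1 := lt_trans hw (one_sub_exp_lt1 eta rho).
apply: (cdiff_comp (f := fun w => ofR eta^-1 * mercator w)).
  by apply: cdiffZ; exact: mercator_cdiff.
by rewrite -dcoef_taylor; apply: pval_cdiff ar _; exact: mercator_scaled_lt.
Qed.

(* with w = 1 - exp (- eta s) this reads exp (s A) = (1 - w)^(- A / eta), expanded by the binomial series *)
Lemma taylor_mercator eta rho a : 0 < eta -> 0 < rho -> converges_in (taylor a) rho ->
  converges_in (qseq eta a) (1 - expR (- eta * rho)) /\
  forall w, cabs w < 1 - expR (- eta * rho) ->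
    pval (taylor a) (ofR eta^-1 * mercator w) = pval (qseq eta a) w.
Proof.
move=> e0 rho0 ar; set W := 1 - expR _.
have W0 : 0 < W by rewrite subr_gt0 expR_lt1 mulNr oppr_lt0 mulr_gt0.
pose H a w := pval (taylor a) (ofR eta^-1 * mercator w).
(* The induction runs over all sequences at once: coefficient [k.+1] for [a] calls on coefficient
   [k] for the shifted sequence, whose composite has a Taylor series [c'] of its own. *)
have key r : 0 < r < W -> forall k a c, converges_in (taylor a) rho -> converges_in c r ->
    (forall w, cabs w < r -> H a w = pval c w) -> c k = qseq eta a k.
  move=> /andP[r0 rW]; elim => [|k IH] {}a c {}ar cr cE.
    have := cE 0; rewrite pval0 cabs0 => /(_ r0) <-.
    rewrite /H (mercator_ofR (x := 0))// subr0 ln1 oppr0 mulr0 pval0.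
    by rewrite /taylor /qseq.
  have ar' := converges_in_shift ar.
  have [c' [cr' cE']] := cauchy_taylor r0 rW (fun v vW => ex_intro _ _ (taylor_mercator_cdiff e0 ar' vW)).
  have dE v : cabs v < r -> pval (dcoef c) v = H (shift_seq a) v * (ofR eta^-1 * (1 - v)^-1).
    move=> vr; apply: cdiff_unique (pval_cdiff cr vr) _.
    apply: cdiff_near (taylor_mercator_cdiff e0 ar (lt_trans vr rW)).
    exists (r - cabs v); first by rewrite subr_gt0.
    move=> v' h; apply: cE; rewrite (_ : v' = v + (v' - v)); last by ring.
    by apply: le_lt_trans (cabsD _ _) _; lra.
  have [mr mE] := pval_mul1BX (converges_in_dcoef cr).
  have [sr sE] := pval_scale (ofR eta^-1) cr'.
  have eq j : mul1BX (dcoef c) j = ofR eta^-1 * c' j.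
    apply: (pval_inj_real r0 mr sr) => s /andP[s0 s_r].
    have sr' : cabs (ofR s) < r by rewrite cabs_ofR gtr0_norm.
    have s1 : cabs (ofR s) < 1 by apply: lt_trans sr' _; apply: lt_trans rW _; exact: one_sub_exp_lt1.
    have n0 : 1 - ofR s != 0.
      by rewrite -cabs_gt0; apply: lt_le_trans (normr_cRe _); rewrite normr_gt0 gt_eqF// cRe1B_gt0.
    rewrite mE// sE// dE// -cE'// /H; set P := pval _ _; set E := ofR _^-1.
    by rewrite mulrC -!mulrA mulVf// mulr1 mulrC.
  have kn0 : (k.+1%:R : Cplx R) != 0 by rewrite pnatr_eq0.
  apply: (mulfI kn0); rewrite qseqS -(IH _ _ ar' cr' cE') -(IH _ _ ar cr cE) -eq.
  rewrite /mul1BX /dcoef; case: k {IH eq kn0} => [|k]; first by rewrite mul0r addr0 subr0.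
  by rewrite subrK.
split.
  move=> s /andP[s0 sW]; have [r /andP[r0 rW] sr] := @mid_radius R (ofR s) W ltac:(by rewrite cabs_ofR gtr0_norm).
  have [c [cr cE]] := cauchy_taylor r0 rW (fun v vW => ex_intro _ _ (taylor_mercator_cdiff e0 ar vW)).
  rewrite (_ : qseq eta a = c); last first.
    by apply/funext => k; rewrite (key r _ k a c ar cr cE)// r0.
  by apply: cr; rewrite s0; rewrite cabs_ofR gtr0_norm in sr.
move=> w wW; have [r /andP[r0 rW] wr] := mid_radius wW.
have [c [cr cE]] := cauchy_taylor r0 rW (fun v vW => ex_intro _ _ (taylor_mercator_cdiff e0 ar vW)).
rewrite cE//; congr pval.
by apply/funext => k; rewrite (key r _ k a c ar cr cE)// r0.
Qed.

Lemma one_sub_exp_ge0 eta s : 0 < eta -> 0 <= s -> 0 <= 1 - expR (- eta * s).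
Proof. by move=> e0 s0; rewrite subr_ge0 expR_le1 mulNr oppr_le0 mulr_ge0// ltW. Qed.

Lemma one_sub_exp_lt eta s s' : 0 < eta -> s < s' -> 1 - expR (- eta * s) < 1 - expR (- eta * s').
Proof. by move=> e0 ss; rewrite ltrD2l ltrN2 ltr_expR !mulNr ltrN2 ltr_pM2l. Qed.

Lemma mercator_one_sub_exp eta s : 0 < eta ->
  ofR eta^-1 * mercator (ofR (1 - expR (- eta * s))) = ofR s.
Proof.
move=> e0; rewrite mercator_ofR ?one_sub_exp_lt1// -ofRM; congr ofR.
by rewrite (_ : 1 - _ = expR (- eta * s)) ?expRK; [field; rewrite gt_eqF|ring].
Qed.

Lemma taylor_expansion eta rho a s : 0 < eta -> converges_in (taylor a) rho -> 0 <= s < rho ->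
  pval (taylor a) (ofR s) = pval (qseq eta a) (ofR (1 - expR (- eta * s))).
Proof.
move=> e0 ar /andP[s0 sr]; have [_ h] := taylor_mercator e0 (le_lt_trans s0 sr) ar.
rewrite -h ?mercator_one_sub_exp// cabs_ofR ger0_norm ?one_sub_exp_ge0//.
exact: one_sub_exp_lt.
Qed.

Lemma rising_ofR (e : R) (d : nat -> R) k j :
  rising (ofR e) (fun i => ofR (d i)) k j = ofR (rising e d k j).
Proof. by elim: k j => [//|k IH] j /=; rewrite !IH ofRD !ofRM ofR_nat. Qed.

Lemma rising_ge0 (e : R) (d : nat -> R) k j : 0 <= e -> (forall i, 0 <= d i) -> 0 <= rising e d k j.
Proof. by move=> e0 d0; elim: k j => [//|k IH] j /=; rewrite addr_ge0 ?mulr_ge0. Qed.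

Lemma cabs_rising (e : R) a k j : 0 <= e ->
  cabs (rising (ofR e) a k j) <= rising e (fun i => cabs (a i)) k j.
Proof.
move=> e0; elim: k j => [//|k IH] j /=; apply: le_trans (cabsD _ _) _.
by rewrite !cabsM cabs_ofR cabs_nat ger0_norm// lerD// ler_wpM2l.
Qed.

Definition majorant a j : Cplx R := ofR (cabs (a j)).

(** Replacing [a] by its moduli makes every entry of [rising] nonnegative and at least as large. One
    nonnegative term is at most the whole sum, and that sum is $\sum_j |a_j| s^j/j!$ by
    [taylor_expansion]. *)
Lemma qseq_le eta rho a s k : 0 < eta -> converges_in (taylor a) rho -> 0 <= s < rho ->
  cabs (qseq eta a k) * (1 - expR (- eta * s)) ^+ k <= cRe (pval (taylor (majorant a)) (ofR s)).
Proof.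
move=> e0 ar /[dup] s_rho /andP[s0 sr].
have mr : converges_in (taylor (majorant a)) rho.
  move=> t /ar[M hM]; exists M => j; have := hM j.
  by rewrite /taylor /majorant !cabsM cabs_ofR ger0_norm ?cabs_ge0.
have e1 : 0 <= eta^-1 by rewrite invr_ge0 ltW.
pose d j : R := (j`!%:R)^-1 * rising eta^-1 (fun i => cabs (a i)) j 0.
have qd : qseq eta (majorant a) = fun j => ofR (d j).
  by apply/funext => j; rewrite /qseq /majorant rising_ofR /d ofRM ofRV ofR_nat.
have d0 j : 0 <= d j.
  by rewrite mulr_ge0 ?invr_ge0// rising_ge0// => i; exact: cabs_ge0.
have rho0 := le_lt_trans s0 sr.
have [qr _] := taylor_mercator e0 rho0 mr.
rewrite (taylor_expansion e0 mr s_rho) qd; rewrite qd in qr.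
have w0 := one_sub_exp_ge0 e0 s0; have w1 := one_sub_exp_lt e0 sr.
apply: le_trans (pval_nneg_ge k.+1 qr _ d0); last by rewrite w0.
rewrite big_nat_recr//=; apply: (@le_trans _ _ (d k * (1 - expR (- eta * s)) ^+ k)).
  rewrite ler_wpM2r ?exprn_ge0// /qseq cabsM cabsV cabs_nat ler_wpM2l ?invr_ge0//.
  exact: cabs_rising.
by rewrite lerDr sumr_ge0// => j _; rewrite mulr_ge0// exprn_ge0.
Qed.

End rising.

(** * Root test, strip and continuation along the half-line *)

Section root_test.
Variable R : realType.
Implicit Types (c : nat -> Cplx R) (x : nat -> R).

Lemma limn_esup_le1P x : (forall k, 0 <= x k) ->
  ((limn_esup (fun k => (x k)%:E) <= 1)%E <->
   forall M : R, 1 < M -> exists N, forall n, (N <= n)%N -> x n <= M).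
Proof.
move=> x0; rewrite limn_esup_lim (cvg_lim _ (@cvg_esups_inf _ _))//; split=> [h M M1|h].
  have : (ereal_inf (range (esups (fun k => (x k)%:E))) < M%:E)%E by apply: le_lt_trans h _; rewrite lte_fin.
  move=> /ereal_inf_lt[_ [N _ <-]] hN; exists N => n Nn.
  rewrite -lee_fin; apply: le_trans (ltW hN); apply: ereal_sup_ubound.
  by exists n.
apply/lee_addgt0Pr => e e0; have [|N hN] := h (1 + e); first by rewrite ltrDl.
apply: (@le_trans _ _ (esups (fun k => (x k)%:E) N)).
  by apply: ereal_inf_lbound; exists N.
by apply: ge_ereal_sup => _ [n /= Nn <-]; rewrite -EFinD lee_fin hN.
Qed.

Lemma eventually_bounded x (M : R) N : (forall n, (N <= n)%N -> x n <= M) ->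
  exists M', forall n, x n <= M'.
Proof.
move=> h; exists (`|M| + \sum_(k < N) `|x k|) => n.
have s0 : 0 <= \sum_(k < N) `|x k| by apply: sumr_ge0.
have [nN|Nn] := ltnP n N.
  rewrite (bigD1 (Ordinal nN))//= addrCA; apply: le_trans (ler_norm _) _.
  by rewrite lerDl addr_ge0// sumr_ge0.
by apply: le_trans (h _ Nn) _; apply: le_trans (ler_norm _) _; rewrite lerDl.
Qed.

Lemma root_pow (y : R) n : 0 <= y -> (0 < n)%N -> (y `^ n%:R^-1) ^+ n = y.
Proof.
move=> y0 n0; rewrite -powR_mulrn ?powR_ge0// -powRrM mulVf ?powRr1//.
by rewrite pnatr_eq0 -lt0n.
Qed.

(** Forwards, the roots are eventually below $1/s$, so the terms at radius [s] are at most 1.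
    Backwards, boundedness at an [s] with $M s > 1$ is used, since $(M s)^n$ outgrows any
    constant. *)
Lemma root_test c : (limn_esup (fun k => (cabs (c k) `^ k%:R^-1)%:E) <= 1)%E <->
  converges_in c 1.
Proof.
rewrite limn_esup_le1P; last by move=> k; exact: powR_ge0.
split=> [h s /andP[s0 s1]|h M M1].
  have [|N hN] := h s^-1; first by rewrite invf_gt1.
  (* Starting at [N.+1] keeps [n] positive; at 0 the exponent is the inverse of 0 and [root_pow]
     fails. *)
  apply: (@eventually_bounded _ 1 N.+1) => n Nn.
  rewrite -(root_pow (cabs_ge0 (c n)) (leq_ltn_trans (leq0n N) Nn)) -exprMn exprn_ile1//.
    by rewrite mulr_ge0 ?powR_ge0 ?ltW.
  by rewrite -ler_pdivlMr// mul1r hN// ltnW.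
(* The midpoint of $1/M$ and 1, so that [s < 1] and [M * s > 1]. *)
pose s := (1 + M^-1) / 2.
have Mi : 0 < M^-1 < 1 by rewrite invr_gt0 invf_lt1//; lra.
have s01 : 0 < s < 1 by rewrite /s; lra.
have MV : M * M^-1 = 1 by rewrite divff//; lra.
have Ms : 1 < M * s by rewrite /s; nra.
have [C hC] := h s s01.
have /cvgrPdist_lt /(_ _ ltr01) [N _ hN] : (fun n => C * (M * s)^-1 ^+ n) @ \oo --> C * 0.
  apply: cvgMl_tmp; apply: cvg_expr.
  by rewrite ger0_norm ?invr_ge0 ?invf_lt1//; lra.
exists N.+1 => n Nn; have {hN} := hN n (ltnW Nn).
rewrite mulr0 sub0r normrN => /(le_lt_trans (ler_norm _)).
have Msn : 0 < (M * s) ^+ n by rewrite exprn_gt0//; lra.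
rewrite exprVn ltr_pdivrMr// mul1r => hn.
have n0 : (0 < n)%N by exact: leq_ltn_trans Nn.
rewrite -(@ler_pXn2r _ n)// ?nnegrE ?powR_ge0//; last by lra.
rewrite root_pow ?cabs_ge0//.
have sn : 0 < s ^+ n by rewrite exprn_gt0//; lra.
rewrite -(ler_pM2r sn) -exprMn; apply: le_trans (hC n) _; exact: ltW.
Qed.

End root_test.

(** * The strip, the half-line and the unit disc for one scalar function *)

Section one_variable.
Variable R : realType.
Implicit Types (a c : nat -> Cplx R) (eta rho s r : R) (w z : Cplx R) (P : R -> Cplx R).

(** To the right of the imaginary axis the bound $2/\eta$ on the imaginary part suffices; to the
    left the modulus is below $(1+2)/\eta$, and the point falls into the disc. *)
Lemma mercator_strip eta r w : 0 < eta -> 3 <= eta * r -> cabs w < 1 ->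
  disc_strip r (ofR eta^-1 * mercator w).
Proof.
move=> e0 er w1; have [h1 h2] := mercator_region w1.
have ei : 0 < eta^-1 by rewrite invr_gt0.
have r3 : 3 * eta^-1 <= r by rewrite ler_pdivrMr// mulrC.
have [h0|h0] := ltP 0 (cRe (mercator w)).
  right; split; rewrite ?cRe_ofRM ?cIm_ofRM; first exact: mulr_gt0.
  rewrite normrM gtr0_norm//; nra.
left; rewrite /= cabsM cabs_ofR gtr0_norm//; apply: lt_le_trans r3.
rewrite mulrC ltr_pM2r//; apply: le_lt_trans (cabs_ReIm _) _.
rewrite (ler0_norm h0); lra.
Qed.

(** Pulled back to the unit disc, [F] has Taylor coefficients at every radius below 1. On the real
    points $1-e^{-\eta s}$ with $s < \rho$ its values are those of the [qseq] series, so the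
    coefficients agree and [qseq] inherits the full radius 1. *)
Lemma strip_expansion eta rho r a P (F : Cplx R -> Cplx R) :
  0 < eta -> 0 < rho -> 0 < r -> 3 <= eta * r -> converges_in (taylor a) rho ->
  (forall s, 0 <= s < rho -> P s = pval (taylor a) (ofR s)) ->
  holomorphic_on (disc_strip r) F -> (forall s, 0 <= s -> F (ofR s) = P s) ->
  forall s, 0 <= s -> series (fun k => qseq eta a k * ofR (1 - expR (- eta * s)) ^+ k) @ \oo --> P s.
Proof.
move=> e0 rho0 r0 er ar Pa [_ Fh] FP.
pose H w := F (ofR eta^-1 * mercator w).
have dH w : cabs w < 1 -> exists l, cdiff H w l.
  move=> w1; have [l Fl] := (derivable_cdiff _ _).1 (Fh _ (mercator_strip e0 er w1)).
  exists (l * (ofR eta^-1 * (1 - w)^-1)); apply: (cdiff_comp (f := fun w => ofR eta^-1 * mercator w) (g := F)) => //.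
  by apply: cdiffZ; exact: mercator_cdiff.
have [qr qE] := taylor_mercator e0 rho0 ar.
set W := 1 - expR (- eta * rho) in qr qE.
have W0 : 0 < W by rewrite subr_gt0 expR_lt1 mulNr oppr_lt0 mulr_gt0.
have HF s : 0 <= s -> H (ofR (1 - expR (- eta * s))) = P s.
  by move=> s0; rewrite /H mercator_one_sub_exp// FP.
have key r1 : 0 < r1 < 1 -> converges_in (qseq eta a) r1 /\ forall w, cabs w < r1 -> H w = pval (qseq eta a) w.
  move=> /andP[r10 r11]; have [c [cr cE]] := cauchy_taylor r10 r11 dH.
  suff -> : qseq eta a = c by [].
  have m0 : 0 < Num.min r1 W by rewrite lt_min r10.
  have mr : Num.min r1 W <= r1 by rewrite ge_min lexx.
  have mW : Num.min r1 W <= W by rewrite ge_min lexx orbT.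
  apply/funext; apply: (pval_inj_real m0 (converges_inS mW qr) (converges_inS mr cr)) => x /andP[x0 xm].
  have x1 : x < 1 by lra.
  have [s [s0 xs]] : exists s, 0 <= s /\ x = 1 - expR (- eta * s).
    exists (eta^-1 * - ln (1 - x)); split.
      by rewrite mulr_ge0 ?invr_ge0 ?(ltW e0)// oppr_ge0 ln_le0//; lra.
    by rewrite mulNr mulrA mulfV ?gt_eqF// mul1r opprK lnK ?posrE ?subKr//; lra.
  have srho : s < rho.
    rewrite ltNge; apply/negP => rs.
    suff : W <= x by lra.
    by rewrite xs /W lerD2l lerN2 ler_expR !mulNr lerN2 ler_pM2l.
  have xr : cabs (ofR x) < r1 by rewrite cabs_ofR gtr0_norm//; lra.
  have s_rho : 0 <= s < rho by rewrite s0.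
  rewrite -(cE _ xr) xs (HF _ s0) (Pa _ s_rho); exact: esym (taylor_expansion e0 ar s_rho).
move=> s s0; set w := 1 - expR (- eta * s).
have w0 : 0 <= w by exact: one_sub_exp_ge0.
have w1 : w < 1 by exact: one_sub_exp_lt1.
have [|q1 q2] := key ((1 + w) / 2); first by lra.
have hw : cabs (ofR w) < (1 + w) / 2 by rewrite cabs_ofR ger0_norm//; lra.
by rewrite -HF// -/w q2//; exact: pval_cvg q1 hw.
Qed.

(** As [s] runs over the half-line, $1-e^{-\eta s}$ runs over all of $[0,1)$; convergence there
    already yields radius 1. *)
Lemma expansion_converges eta c P : 0 < eta ->
  (forall s, 0 <= s -> series (fun k => c k * ofR (1 - expR (- eta * s)) ^+ k) @ \oo --> P s) ->
  converges_in c 1.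
Proof.
move=> e0 h; apply: converges_in_cvg => x /andP[x0 x1].
have s0 : 0 <= eta^-1 * - ln (1 - x).
  by rewrite mulr_ge0 ?invr_ge0 ?(ltW e0)// oppr_ge0 ln_le0//; lra.
have E : 1 - expR (- eta * (eta^-1 * - ln (1 - x))) = x.
  by rewrite mulNr mulrA mulfV ?gt_eqF// mul1r opprK lnK ?posrE ?subKr//; lra.
have := h _ s0; rewrite E => h'; apply/cvg_ex; eexists; exact: h'.
Qed.

Lemma disc_strip_open r : open (disc_strip r : set (Cplx R)).
Proof.
rewrite openE => z hz; apply/near_dnbhs_cabsP; case: hz => [h|[h1 h2]].
  exists (r - cabs z); first by rewrite subr_gt0.
  move=> w hw; left => /=; have := cabs_ger w z; lra.
exists (Num.min (cRe z) (r - `|cIm z|)); first by rewrite lt_min h1 subr_gt0.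
move=> w; rewrite lt_min => /andP[k1 k2]; right => /=.
have := normr_cRe (w - z); have := normr_cIm (w - z); rewrite cReB cImB => j1 j2.
have j3 : `|cRe w - cRe z| < cRe z by lra.
split; first by move: j3; rewrite ltr_norml; lra.
rewrite (_ : cIm w = (cIm w - cIm z) + cIm z); last by ring.
by apply: le_lt_trans (ler_normD _ _) _; lra.
Qed.

(** With $E = e^{-\Re z}$ and $y = \Im z$ one has $|1-e^{-z}|^2 = 1 - 2E\cos y + E^2$. For $\Re z >
    0$ and $\cos y > 1/2$ this is below 1, as $2E\cos y > E > E^2$. Near 0 continuity of the
    exponential is enough. *)
Lemma one_sub_cexp_lt1 : exists2 d : R, 0 < d & forall z, disc_strip d z -> cabs (1 - cexp (- z)) < 1.
Proof.
have [d1 d10 h1] := cdiff_cont (@cexp_cdiff R 0) ltr01.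
have [d2 /= d20 h2] : exists2 d : R, 0 < d & forall y, `|y| < d -> 1 / 2 < cos y.
  have /cvgrPdist_lt /(_ (1 / 2)) := @continuous_cos R 0.
  move=> /(_ ltac:(lra)) /nbhs_ballP[d /= d0 hd]; exists d => // y hy.
  have := hd y; rewrite /ball /= sub0r normrN => /(_ hy).
  by rewrite cos0 ltr_norml; lra.
exists (Num.min d1 d2); first by rewrite lt_min d10.
move=> z [|[z0]] /=; rewrite lt_min => /andP[z1 z2].
  by have := h1 (- z); rewrite cabsN add0r cexp0 cabsC; apply.
have := h2 _ z2; set y := cIm z => cy.
have E0 : 0 < expR (- cRe z) by exact: expR_gt0.
have E1 : expR (- cRe z) < 1 by rewrite expR_lt1 oppr_lt0.
rewrite -(@ltr_pXn2r _ 2)// ?nnegrE ?cabs_ge0// expr1n.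
have -> : cabs (1 - cexp (- z)) ^+ 2 = 1 - 2 * expR (- cRe z) * cos y + expR (- cRe z) ^+ 2.
  rewrite /cabs; set u := 1 - _; have : cRe u ^+ 2 + cIm u ^+ 2 = 1 - 2 * expR (- cRe z) * cos y + expR (- cRe z) ^+ 2.
    rewrite /u cReB cImB /cexp /= -/(cRe z) -/(cIm z) cReN cImN cosN sinN -/y.
    have := cos2Dsin2 y; set C := cos y; set S := sin y; set E := expR _ => CS.
    rewrite (_ : (1 - _) ^+ 2 + _ = 1 - 2 * E * C + E ^+ 2 * (C ^+ 2 + S ^+ 2)); last by ring.
    by rewrite CS mulr1.
  by move=> <-; case: u => u1 u2 /=; rewrite sqr_sqrtr// addr_ge0// sqr_ge0.
by nra.
Qed.

Lemma scaled_one_sub_cexp : exists2 d : R, 0 < d & forall eta z, 0 < eta -> disc_strip (d / eta) z ->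
  cabs (1 - cexp (- (ofR eta * z))) < 1.
Proof.
have [d d0 hd] := one_sub_cexp_lt1; exists d => // eta z e0 hz; apply: hd.
case: hz => [/= h|[/= h1 h2]]; [left|right] => /=.
  by rewrite cabsM cabs_ofR gtr0_norm// mulrC -ltr_pdivlMr.
by rewrite cRe_ofRM cIm_ofRM normrM gtr0_norm// [eta * `|_|]mulrC -ltr_pdivlMr//; split => //; exact: mulr_gt0.
Qed.

Lemma qseries_cdiff eta c z : converges_in c 1 -> cabs (1 - cexp (- (ofR eta * z))) < 1 ->
  exists l, cdiff (fun z => pval c (1 - cexp (- (ofR eta * z)))) z l.
Proof.
move=> c1 hz.
have h0 : cdiff (fun z => (- ofR eta) * z) z (- ofR eta * 1) by apply: cdiffZ; exact: cdiff_id.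
have := cdiffD (@cdiff_cst R 1 z) (cdiffZ (-1) (cdiff_comp h0 (cexp_cdiff _))).
have -> : (fun w => 1 + -1 * cexp (- ofR eta * w)) = (fun z => 1 - cexp (- (ofR eta * z))).
  by apply/funext => w; rewrite mulN1r mulNr.
by move=> h1; eexists; exact: (cdiff_comp h1 (pval_cdiff c1 hz)).
Qed.

Lemma one_sub_cexp_ofR eta s : 1 - cexp (- (ofR eta * ofR s)) = ofR (1 - expR (- eta * s)).
Proof. by rewrite -ofRM -ofRN cexp_ofR ofRB mulNr. Qed.

(** The restriction [0 <= s0 + t] makes the notion one-sided at the end point 0, where [P] is
    compared with its series on the right only. *)
Definition locally_analytic P s0 := exists r c, [/\ 0 < r, converges_in c r &
  forall t, `|t| < r -> 0 <= s0 + t -> P (s0 + t) = pval c (ofR t)].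

Lemma holomorphic_locally_analytic P (D : set (Cplx R)) (F : Cplx R -> Cplx R) s0 :
  D (ofR s0) -> holomorphic_on D F -> (forall s, 0 <= s -> D (ofR s) -> F (ofR s) = P s) ->
  locally_analytic P s0.
Proof.
move=> Ds0 [oD Fh] FP.
have [rho rho0 hD] := (near_dnbhs_cabsP _ _).1 (open_nbhs_nbhs (conj oD Ds0)).
have dF w : cabs w < rho -> exists l, cdiff (fun w => F (ofR s0 + w)) w l.
  move=> wr; have [|l Fl] := (derivable_cdiff F (ofR s0 + w)).1 _.
    by apply: Fh; apply: hD; rewrite addrC addKr.
  have h0 : cdiff (fun w => ofR s0 + w) w (0 + 1) by exact: cdiffD (cdiff_cst _ _) (cdiff_id _).
  by eexists; exact: (cdiff_comp h0 Fl).
have r2 : rho / 2 < rho by lra.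
have r20 : 0 < rho / 2 by lra.
have [c [cr cE]] := cauchy_taylor r20 r2 dF.
exists (rho / 2), c; split => // t tr st.
by rewrite -cE ?cabs_ofR// -ofRD FP// ofRD; apply: hD; rewrite addrC addKr cabs_ofR; lra.
Qed.

(** At the supremum of the times up to which the functions agree, the two local series agree to the
    left, hence coincide, and agreement continues past the supremum. *)
Lemma analytic_continuation P1 P2 d : 0 < d ->
  (forall s, 0 <= s -> locally_analytic P1 s) -> (forall s, 0 <= s -> locally_analytic P2 s) ->
  (forall s, 0 <= s < d -> P1 s = P2 s) -> forall s, 0 <= s -> P1 s = P2 s.
Proof.
move=> d0 an1 an2 eqd s1 s10; apply: contrapT => ne.
pose S := [set s : R | 0 <= s /\ forall t, 0 <= t <= s -> P1 t = P2 t].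
have Sub : has_ubound S.
  exists s1 => s [s0 hs]; rewrite leNgt; apply/negP => ss; apply: ne.
  by apply: hs; rewrite s10 ltW.
have Sd : S (d / 2) by split; [lra|move=> t /andP[t0 td]; apply: eqd; lra].
have hsup : has_sup S by split => //; exists (d / 2).
set s0 := sup S.
have s0d : d / 2 <= s0 by exact: ub_le_sup.
have below t : 0 <= t < s0 -> P1 t = P2 t.
  move=> /andP[t0 ts]; have st : 0 < s0 - t by rewrite subr_gt0.
  have [u [u0 hu] tu] := sup_adherent st hsup.
  by apply: hu; rewrite t0 /= ltW//; move: tu; rewrite -/s0; lra.
have s00 : 0 < s0 by lra.
have [r1 [c1 [r10 cr1 E1]]] := an1 s0 (ltW s00).
have [r2 [c2 [r20 cr2 E2]]] := an2 s0 (ltW s00).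
pose r := Num.min r1 r2.
have r0 : 0 < r by rewrite lt_min r10.
have rr1 : r <= r1 by rewrite ge_min lexx.
have rr2 : r <= r2 by rewrite ge_min lexx orbT.
clearbody r; have c12 : c1 = c2.
  apply/funext; apply: (pval_inj r0 (converges_inS rr1 cr1) (converges_inS rr2 cr2)) => e e0.
  (* The comparison point is [s0 - t], to the left of the supremum; the cap by [s0] keeps it
     nonnegative. *)
  pose t := Num.min e (Num.min r s0) / 2.
  have m0 : 0 < Num.min e (Num.min r s0) by rewrite !lt_min e0 r0.
  have m1 : Num.min e (Num.min r s0) <= e by rewrite ge_min lexx.
  have m2 : Num.min e (Num.min r s0) <= r by rewrite !ge_min lexx orbT.
  have m3 : Num.min e (Num.min r s0) <= s0 by rewrite !ge_min lexx !orbT.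
  have t0 : 0 < t by rewrite /t; lra.
  have te : t < e by rewrite /t; lra.
  have tr : t < r by rewrite /t; lra.
  have ts : t < s0 by rewrite /t; lra.
  have nt : `|- t| = t by rewrite normrN gtr0_norm.
  exists (ofR (- t)); first by rewrite cabs_ofR nt t0.
  rewrite -E1 ?nt ?(lt_le_trans tr rr1)//; last by lra.
  rewrite -E2 ?nt ?(lt_le_trans tr rr2)//; last by lra.
  by apply: below; lra.
have : S (s0 + r / 2).
  split=> [|t /andP[t0 ts]]; first by lra.
  have [tlt|tge] := ltP t s0; first by apply: below; rewrite t0.
  have nt : `|t - s0| <= r / 2 by rewrite ger0_norm; lra.
  have tE : t = s0 + (t - s0) by rewrite subrKC.
  rewrite tE E1 ?E2 ?c12 ?subrKC//; lra.
by move=> /(ub_le_sup Sub); rewrite -/s0; lra.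
Qed.

End one_variable.

(** * The operator *)

Section topology.
Variable R : realType.
Local Notation C := (Cplx R).

Lemma entourage_cabsP (E : set (C * C)) : entourage E <->
  exists2 e : R, 0 < e & forall z w, cabs (z - w) < e -> E (z, w).
Proof.
rewrite -entourage_ballE; split=> [[e /= e0 hE]|[e e0 hE]].
  have [eE e1] := gt0_ofR e0; exists (cRe e) => // z w zw; apply: hE.
  by rewrite /= /ball /= normE eE /ofR ltcR.
exists (ofR e); first by rewrite /= /ofR ltcR.
by move=> [z w] /=; rewrite /ball /= normE /ofR ltcR; exact: hE.
Qed.

Lemma uniform_nbhs_cabsP (U : choiceType) (A : set U) (f : {uniform` A -> C}) P :
  nbhs f P <-> exists2 e : R, 0 < e &
    forall h : U -> C, (forall y, A y -> cabs (h y - f y) < e) -> P h.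
Proof.
rewrite uniform_nbhs; split=> [[E [/entourage_cabsP[e e0 hE] sP]]|[e e0 hP]].
  by exists e => // h hh; apply: sP => y /hh hy; apply: hE; rewrite cabsC.
exists [set zw | cabs (zw.1 - zw.2) < e]; split.
  by apply/entourage_cabsP; exists e.
by move=> h hh; apply: hP => y /hh /=; rewrite cabsC.
Qed.

Lemma uniform_seriesP (T : choiceType) (D : set T) (u : nat -> T -> C) :
  uniform_series D u <-> exists l : T -> C, forall e : R, 0 < e ->
    exists N, forall n, (N <= n)%N -> forall y, D y ->
      cabs (\sum_(0 <= k < n) u k y - l y) < e.
Proof.
split=> -[l hl]; exists l.
  move=> e e0; have : nbhs (l : {uniform` D -> C}) [set h | forall y, D y -> cabs (h y - l y) < e].
    by apply/uniform_nbhs_cabsP; exists e.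
  by move=> /hl [N _ hN]; exists N => n Nn y Dy; exact: (hN n Nn).
move=> P /uniform_nbhs_cabsP[e e0 hP]; have [N hN] := hl _ e0.
by exists N => // n Nn; apply: hP => y Dy; exact: hN.
Qed.

Variable n : nat.
Variable X : set 'rV[R]_n.+1.
Local Notation Rn := 'rV[R]_n.+1.

Definition approx (f : Rn -> C) (P : set (Rn -> C)) : Prop := exists K (e : R),
  [/\ compact K, K `<=` X, 0 < e & forall h : Rn -> C, (forall x, K x -> cabs (h x - f x) < e) -> P h].

Lemma approx_filter f : Filter (approx f).
Proof.
split.
- exists set0, 1; split => //; exact: compact0.
- move=> P Q [K [e [cK sK e0 hP]]] [K' [e' [cK' sK' e0' hQ]]].
  exists (K `|` K'), (Num.min e e'); split.
  + exact: compactU.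
  + by move=> x [/sK|/sK'].
  + by rewrite lt_min e0.
  + move=> h hh; split; [apply: hP|apply: hQ] => x Kx.
      by apply: lt_le_trans (hh x (or_introl Kx)) _; rewrite ge_min lexx.
    by apply: lt_le_trans (hh x (or_intror Kx)) _; rewrite ge_min lexx orbT.
- by move=> P Q PQ [K [e [cK sK e0 hP]]]; exists K, e; split => // h /hP /PQ.
Qed.

(** The filter [approx f] itself converges to [f] uniformly on each compact subset of [X], so it
    contains every neighbourhood of [f]. *)
Lemma CX_nbhsP (f : CX X) (P : set (CX X)) : nbhs f P <-> approx f P.
Proof.
split; last first.
  move=> [K [e [cK sK e0 hP]]].
  apply: (filterS (P := [set g : CX X | forall y, K y -> cabs (f y - g y) < e])).
    by move=> g hg; apply: hP => x /hg; rewrite cabsC.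
  apply: (@fam_nbhs _ _ (compactly_in X) K [set zw | cabs (zw.1 - zw.2) < e]) => //.
  by apply/entourage_cabsP; exists e.
have FF := approx_filter f.
suff : {family compactly_in X, approx f --> (f : Rn -> C)} by move=> h; exact: h.
apply/fam_cvgP => K [sK cK] Q /uniform_nbhs_cabsP[e e0 hQ].
by exists K, e; split.
Qed.

(** One compact set and one tolerance serve both components of the graph, through a union and a
    minimum. *)
Lemma closureP (A : operator X) (f g : CX X) : closure A (f, g) <->
  forall (K : set Rn) (e : R), compact K -> K `<=` X -> 0 < e ->
    exists f' g' : CX X, A (f', g') /\
      forall x, K x -> cabs (f' x - f x) < e /\ cabs (g' x - g x) < e.
Proof.
split=> [cA K e cK sK e0|h B [[P Q] /= [/CX_nbhsP hP /CX_nbhsP hQ] PQB]].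
  have nb (h : CX X) : nbhs h [set h' : CX X | forall x, K x -> cabs (h' x - h x) < e].
    by apply/CX_nbhsP; exists K, e.
  have [[f' g'] /= [Afg [h1 h2]]] := cA _ (ex_intro2 _ _ (_, _) (conj (nb f) (nb g)) (fun _ h => h)).
  by exists f', g'; split => // x Kx; split; [exact: h1|exact: h2].
have [K1 [e1 [cK1 sK1 e10 h1]]] := hP; have [K2 [e2 [cK2 sK2 e20 h2]]] := hQ.
have [||f' [g' [Afg hfg]]] := h (K1 `|` K2) (Num.min e1 e2) (compactU cK1 cK2).
- by move=> x [/sK1|/sK2].
- by rewrite lt_min e10.
exists (f', g'); split => //; apply: PQB; split => /=.
  apply: h1 => x Kx; have [k _] := hfg x (or_introl Kx).
  by apply: lt_le_trans k _; rewrite ge_min lexx.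
apply: h2 => x Kx; have [_ k] := hfg x (or_intror Kx).
by apply: lt_le_trans k _; rewrite ge_min lexx orbT.
Qed.

Lemma compact_nbhs (x : Rn) : open X -> X x -> exists K : set Rn, [/\ compact K, K `<=` X & nbhs x K].
Proof.
move=> oX Xx; have /nbhs_ballP[e /= e0 he] := open_nbhs_nbhs (conj oX Xx).
exists (closed_ball x (e / 2)); split.
- apply: bounded_closed_compact; last exact: closed_ball_closed.
  exists (`|x| + e); split; first exact: num_real.
  move=> M hM y; rewrite closed_ballE ?divr_gt0// /closed_ball_ /= => xy.
  rewrite (_ : y = x - (x - y)); last by rewrite subKr.
  by apply: le_trans (ler_normB _ _) _; lra.
- move=> y; rewrite closed_ballE ?divr_gt0// /closed_ball_ /= => xy; apply: he.
  by rewrite -ball_normE /ball_ /=; apply: le_lt_trans xy _; lra.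
- apply/nbhs_ballP; exists (e / 2); first by rewrite /= divr_gt0.
  by apply: subset_closed_ball.
Qed.

Lemma locally_uniform_continuous (f : Rn -> C) : open X ->
  (forall (K : set Rn) (e : R), compact K -> K `<=` X -> 0 < e ->
    exists h : Rn -> C, continuous_on X h /\ forall x, K x -> cabs (h x - f x) < e) ->
  continuous_on X f.
Proof.
move=> oX hf x Xx; have [K [cK sK nK]] := compact_nbhs oX Xx.
apply/(@cvg_cabsP R _ (nbhs x) f (f x) (nbhs_filter x)) => e e0.
have [h [ch hK]] := hf K (e / 3) cK sK ltac:(by rewrite divr_gt0).
have hx := (@cvg_cabsP R _ (nbhs x) h (h x) (nbhs_filter x)).1 (ch x Xx) (e / 3).
have hx' := hx ltac:(by rewrite divr_gt0).
have Kx : K x := nbhs_singleton nK.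
near=> y.
have Ky : K y by near: y.
have h1 := hK y Ky; have h2 := hK x Kx.
have h3 : cabs (h y - h x) < e / 3 by near: y.
rewrite (_ : f y - f x = (h y - h x) - (h y - f y) + (h x - f x)); last by ring.
apply: le_lt_trans (cabsD _ _) _; apply: le_lt_trans (lerD (cabsB _ _) (lexx _)) _; lra.
Unshelve. all: by end_near. Qed.

Lemma continuous_compact_bounded (f : Rn -> C) (K : set Rn) : compact K -> K `<=` X ->
  continuous_on X f -> exists M : R, forall x, K x -> cabs (f x) <= M.
Proof.
move=> cK sK cf.
have cc : {within K, continuous (fun x => cabs (f x))}.
  apply: continuous_in_subspaceT => x; rewrite inE => /sK Xx.
  exact: (@cvg_cabs R _ (nbhs x) f (f x) (nbhs_filter x) (cf x Xx)).
have [M [_ hM]] := compact_bounded (continuous_compact cc cK).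
exists (M + 1) => x Kx; have := hM (M + 1) ltac:(by rewrite ltrDl) (cabs (f x)).
by rewrite /= ger0_norm ?cabs_ge0//; apply; exists x.
Qed.

End topology.

(** * Linearity of partial derivatives on an open set *)

Section partial_linear.
Variables (R : realType) (n : nat) (X : set 'rV[R]_n.+1).
Hypothesis oX : open X.
Local Notation Rn := 'rV[R]_n.+1.
Implicit Types (g : Rn -> R) (al be : R).

Lemma near_open (x : Rn) : X x -> \near x, X x.
Proof. by move=> Xx; exact: (open_nbhs_nbhs (conj oX Xx)). Qed.

Lemma is_derive_lincomb g1 g2 al be (x v : Rn) : derivable g1 x v -> derivable g2 x v ->
  is_derive x v (fun y => al * g1 y + be * g2 y) (al * 'D_v g1 x + be * 'D_v g2 x).
Proof.
move=> d1 d2; have i1 := derivableP d1; have i2 := derivableP d2.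
exact: (is_deriveD (is_deriveZ al i1) (is_deriveZ be i2)).
Qed.

(** A derivative at [x] sees a neighbourhood of [x]. As [X] is open, the induction hypothesis holds
    on such a neighbourhood and not merely at [x]. *)
Lemma partial_lincomb k g1 g2 al be : class_C k X g1 -> class_C k X g2 ->
  forall (s : seq 'I_n.+1) x, (size s <= k)%N -> X x ->
    partial s (fun y => al * g1 y + be * g2 y) x = al * partial s g1 x + be * partial s g2 x.
Proof.
move=> c1 c2; elim=> [//|i s IH] x sk Xx /=.
have sk' : (size s <= k)%N := ltnW sk.
have [_ /(_ sk i x Xx) d1] := c1 s sk'; have [_ /(_ sk i x Xx) d2] := c2 s sk'.
rewrite (@near_eq_derive _ _ _ _ (fun y => al * partial s g1 y + be * partial s g2 y)); last first.
  by near=> y; apply: IH => //; near: y; exact: near_open.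
by have [_ ->] := is_derive_lincomb al be d1 d2.
Unshelve. all: by end_near. Qed.

Lemma class_C_lincomb k g1 g2 al be : class_C k X g1 -> class_C k X g2 ->
  class_C k X (fun y => al * g1 y + be * g2 y).
Proof.
move=> c1 c2 s sk; have [k1 d1] := c1 s sk; have [k2 d2] := c2 s sk.
have eqn x : X x -> \forall y \near x, al * partial s g1 y + be * partial s g2 y =
    partial s (fun y => al * g1 y + be * g2 y) y.
  by move=> Xx; near=> y; apply/esym/(partial_lincomb al be c1 c2) => //; near: y; exact: near_open.
split=> [x Xx|sk' i x Xx].
  rewrite /prop_for /continuous_at (partial_lincomb al be c1 c2 sk Xx).
  apply: cvg_trans (near_eq_cvg (eqn x Xx)) _.
  have h1 := @cvgMl_tmp _ _ _ (nbhs_filter x) _ al _ (k1 x Xx).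
  have h2 := @cvgMl_tmp _ _ _ (nbhs_filter x) _ be _ (k2 x Xx).
  exact: (cvgD h1 h2).
apply: (near_eq_derivable (eqn x Xx)).
by have [] := is_derive_lincomb al be (d1 sk' i x Xx) (d2 sk' i x Xx).
Unshelve. all: by end_near. Qed.

(** The scalars are real, as are all coefficients met later, namely [s ^+ k] over [k!], [eta^-1] and
    [k]; real and imaginary parts thus stay separate. *)
Definition lincomb al be (f g : Rn -> Cplx R) : Rn -> Cplx R := fun x => ofR al * f x + ofR be * g x.

Lemma cRe_lincomb al be (f g : Rn -> Cplx R) : cRe \o lincomb al be f g = fun x => al * cRe (f x) + be * cRe (g x).
Proof. by apply/funext => x; rewrite /= cReD !cRe_ofRM. Qed.

Lemma cIm_lincomb al be (f g : Rn -> Cplx R) : cIm \o lincomb al be f g = fun x => al * cIm (f x) + be * cIm (g x).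
Proof. by apply/funext => x; rewrite /= cImD !cIm_ofRM. Qed.

Lemma cpartial_lincomb k (f g : Rn -> Cplx R) al be s x : cclass_C k X f -> cclass_C k X g ->
  (size s <= k)%N -> X x ->
  cpartial s (lincomb al be f g) x = ofR al * cpartial s f x + ofR be * cpartial s g x.
Proof.
move=> [f1 f2] [g1 g2] sk Xx.
apply: complex_eq; rewrite ?cReD ?cImD ?cRe_ofRM ?cIm_ofRM /=.
  by rewrite cRe_lincomb (partial_lincomb al be f1 g1).
by rewrite cIm_lincomb (partial_lincomb al be f2 g2).
Qed.

Lemma cclass_C_lincomb k (f g : Rn -> Cplx R) al be : cclass_C k X f -> cclass_C k X g ->
  cclass_C k X (lincomb al be f g).
Proof.
move=> [f1 f2] [g1 g2]; split.
  by rewrite cRe_lincomb; exact: class_C_lincomb.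
by rewrite cIm_lincomb; exact: class_C_lincomb.
Qed.

Lemma continuous_on_lincomb (f g : Rn -> Cplx R) al be : continuous_on X f -> continuous_on X g ->
  continuous_on X (lincomb al be f g).
Proof.
move=> cf cg x Xx.
have h1 := @cvgMl_tmp _ _ _ (nbhs_filter x) _ (ofR al : Cplx R) _ (cf x Xx).
have h2 := @cvgMl_tmp _ _ _ (nbhs_filter x) _ (ofR be : Cplx R) _ (cg x Xx).
exact: (cvgD h1 h2).
Qed.

End partial_linear.

Section integral_linear.
Variables (R : realType) (d : measure_display) (T : measurableType d) (mu : {measure set T -> \bar R}).

Lemma integrable_lincomb (f g : T -> R) (al be : R) :
  mu.-integrable setT (EFin \o f) -> mu.-integrable setT (EFin \o g) ->
  mu.-integrable setT (EFin \o (fun x => al * f x + be * g x)).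
Proof.
move=> fi gi; have := integrableD measurableT (integrableZl measurableT al fi) (integrableZl measurableT be gi).
by apply: eq_integrable => // x _.
Qed.

Lemma fine_integral_lincomb (f g : T -> R) (al be : R) :
  mu.-integrable setT (EFin \o f) -> mu.-integrable setT (EFin \o g) ->
  fine (\int[mu]_x (al * f x + be * g x)%:E) =
  al * fine (\int[mu]_x (f x)%:E) + be * fine (\int[mu]_x (g x)%:E).
Proof.
move=> fi gi.
have fi' : mu.-integrable setT (EFin \o (fun x => al * f x)).
  by have := integrableZl measurableT al fi; apply: eq_integrable.
have gi' : mu.-integrable setT (EFin \o (fun x => be * g x)).
  by have := integrableZl measurableT be gi; apply: eq_integrable.
change (\int[mu]_(x in setT) (al * f x + be * g x) =
  al * \int[mu]_(x in setT) f x + be * \int[mu]_(x in setT) g x).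
by rewrite RintegralD// !RintegralZl.
Qed.

End integral_linear.

(** * The generator: linear, closed and single-valued on [X] *)

Section generator_linear.
Local Open Scope complex_scope.
Variables (R : realType) (n m : nat) (X : set 'rV[R]_n.+1).
Local Notation Rn := 'rV[R]_n.+1.
Local Notation C := (Cplx R).
Variables (b : Rn -> Rn) (sigma : Rn -> 'M[R]_(n.+1, m)).
Variable (v : Rn -> {measure set (borelRn R n) -> \bar R}).
Hypothesis oX : open X.

Lemma complex_lincomb (al be p q p' q' : R) :
  ((al * p + be * q) +i* (al * p' + be * q') : C) = ofR al * (p +i* p') + ofR be * (q +i* q').
Proof. by apply: complex_eq; rewrite ?cReD ?cImD ?cRe_ofRM ?cIm_ofRM. Qed.

Lemma jump_lincomb al be (f g : Rn -> C) x z : cclass_C 2 X f -> cclass_C 2 X g -> X x ->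
  jump (lincomb al be f g) x z = ofR al * jump f x z + ofR be * jump g x z.
Proof.
move=> cf cg Xx; rewrite /jump.
rewrite (eq_bigr (fun i => ofR al * (cpartial [:: i] f x * ofR ((z : Rn) 0 i)) +
   ofR be * (cpartial [:: i] g x * ofR ((z : Rn) 0 i)))); last first.
  by move=> i _; rewrite (cpartial_lincomb oX al be cf cg)//; ring.
by rewrite big_split /= -!mulr_sumr /lincomb; ring.
Qed.

Lemma lincomb_sum3 (al be p1 p2 p3 q1 q2 q3 : C) :
  al * (p1 + p2 + p3) + be * (q1 + q2 + q3) =
  (al * p1 + be * q1) + (al * p2 + be * q2) + (al * p3 + be * q3).
Proof. by ring. Qed.

Lemma second_order_lincomb (a : 'M[R]_n.+1) al be (f g : Rn -> C) x :
  cclass_C 2 X f -> cclass_C 2 X g -> X x ->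
  ofR 2^-1 * (\sum_i \sum_j ofR (a i j) * cpartial [:: i; j] (lincomb al be f g) x) =
  ofR al * (ofR 2^-1 * (\sum_i \sum_j ofR (a i j) * cpartial [:: i; j] f x)) +
  ofR be * (ofR 2^-1 * (\sum_i \sum_j ofR (a i j) * cpartial [:: i; j] g x)).
Proof.
move=> cf cg Xx; rewrite ![ofR _ * (ofR 2^-1 * _)]mulrCA -mulrDr; congr (_ * _).
rewrite !mulr_sumr -big_split; apply: eq_bigr => i _ /=.
rewrite !mulr_sumr -big_split; apply: eq_bigr => j _ /=.
by rewrite (cpartial_lincomb oX al be cf cg)//; ring.
Qed.

Lemma first_order_lincomb (c : Rn) al be (f g : Rn -> C) x :
  cclass_C 2 X f -> cclass_C 2 X g -> X x ->
  \sum_i ofR (c 0 i) * cpartial [:: i] (lincomb al be f g) x =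
  ofR al * (\sum_i ofR (c 0 i) * cpartial [:: i] f x) +
  ofR be * (\sum_i ofR (c 0 i) * cpartial [:: i] g x).
Proof.
move=> cf cg Xx; rewrite !mulr_sumr -big_split; apply: eq_bigr => i _ /=.
by rewrite (cpartial_lincomb oX al be cf cg)//; ring.
Qed.

Lemma Asharp_lincomb al be (f1 f2 g1 g2 : Rn -> C) :
  Asharp X b sigma v (f1, g1) -> Asharp X b sigma v (f2, g2) ->
  Asharp X b sigma v (lincomb al be f1 f2, lincomb al be g1 g2).
Proof.
move=> [/= c1 j1 e1 k1] [/= c2 j2 e2 k2].
have jRe x : X x -> cRe \o jump (lincomb al be f1 f2) x =
    fun z => al * cRe (jump f1 x z) + be * cRe (jump f2 x z).
  by move=> Xx; apply/funext => z; rewrite /= jump_lincomb// cReD !cRe_ofRM.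
have jIm x : X x -> cIm \o jump (lincomb al be f1 f2) x =
    fun z => al * cIm (jump f1 x z) + be * cIm (jump f2 x z).
  by move=> Xx; apply/funext => z; rewrite /= jump_lincomb// cImD !cIm_ofRM.
split => /=.
- exact: cclass_C_lincomb.
- move=> x Xx; rewrite /jump_integrable jRe// jIm//.
  have [a1 a2] := j1 x Xx; have [a3 a4] := j2 x Xx.
  by split; apply: integrable_lincomb.
- move=> x Xx; have [a1 a2] := j1 x Xx; have [a3 a4] := j2 x Xx.
  rewrite /lincomb (e1 x Xx) (e2 x Xx) -/(lincomb al be f1 f2).
  rewrite /Asharp_expr lincomb_sum3; congr (_ + _ + _).
  + exact/esym/second_order_lincomb.
  + exact/esym/first_order_lincomb.
  + rewrite -complex_lincomb -(fine_integral_lincomb al be a1 a3) -(fine_integral_lincomb al be a2 a4).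
    by congr (fine _ +i* fine _); apply: eq_integral => z _; rewrite jump_lincomb// ?cReD ?cImD ?cRe_ofRM ?cIm_ofRM.
- exact: continuous_on_lincomb.
Qed.

Local Notation A := (generator X b sigma v).

Lemma generator_lincomb al be (f1 f2 g1 g2 : CX X) : A (f1, g1) -> A (f2, g2) ->
  A (lincomb al be f1 f2, lincomb al be g1 g2).
Proof.
move=> [/= cf1 cg1 /closureP h1] [/= cf2 cg2 /closureP h2].
split; [exact: continuous_on_lincomb|exact: continuous_on_lincomb|].
apply/closureP => K e cK sK e0.
have D0 : 0 < `|al| + `|be| + 1 by rewrite ltr_wpDl// addr_ge0.
have e0' : 0 < e / (`|al| + `|be| + 1) by rewrite divr_gt0.
have [f1' [g1' [A1 K1]]] := h1 K _ cK sK e0'.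
have [f2' [g2' [A2 K2]]] := h2 K _ cK sK e0'.
exists (lincomb al be f1' f2'), (lincomb al be g1' g2'); split.
  exact: (Asharp_lincomb al be A1 A2).
have aux (p p' q q' : C) : cabs (p' - p) < e / (`|al| + `|be| + 1) -> cabs (q' - q) < e / (`|al| + `|be| + 1) ->
    cabs (ofR al * p' + ofR be * q' - (ofR al * p + ofR be * q)) < e.
  move=> hp hq.
  rewrite (_ : _ - _ = ofR al * (p' - p) + ofR be * (q' - q)); last by ring.
  apply: le_lt_trans (cabsD _ _) _; rewrite !cabsM !cabs_ofR.
  have := ler_wpM2l (normr_ge0 al) (ltW hp); have := ler_wpM2l (normr_ge0 be) (ltW hq).
  set t := e / _ in e0' *.
  have -> : e = t * (`|al| + `|be| + 1) by rewrite /t mulfVK// gt_eqF.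
  lra.
by move=> x Kx; have [? ?] := K1 x Kx; have [? ?] := K2 x Kx; split; exact: aux.
Qed.

Lemma continuous_on_ext (f f' : Rn -> C) : (forall x, X x -> f x = f' x) ->
  continuous_on X f -> continuous_on X f'.
Proof.
move=> ff' cf x Xx; rewrite /prop_for /continuous_at -(ff' x Xx).
have eqn : \forall y \near x, f y = f' y.
  by near=> y; apply: ff'; near: y; exact: near_open.
exact: (cvg_trans (near_eq_cvg eqn) (cf x Xx)).
Unshelve. all: by end_near. Qed.

(** Elements of $C(\mathfrak X)$ are represented by functions on the whole space; this is
    independence of the representatives. *)
Lemma generator_ext (f f' g g' : CX X) : (forall x, X x -> f x = f' x) ->
  (forall x, X x -> g x = g' x) -> A (f, g) -> A (f', g').
Proof.
move=> ff' gg' [/= cf cg /closureP h]; split => /=.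
- exact: continuous_on_ext ff' cf.
- exact: continuous_on_ext gg' cg.
apply/closureP => K e cK sK e0; have [p [q [Apq hK]]] := h K e cK sK e0.
by exists p, q; split => // x Kx; rewrite -ff' -?gg'; [exact: hK|exact: sK|exact: sK].
Qed.

(** The closure is idempotent: an approximant in the graph is itself approximated by [Asharp], each
    within half of the tolerance. Continuity on [X] passes to locally uniform limits. *)
Lemma generator_closed (f g : CX X) :
  (forall (K : set Rn) (e : R), compact K -> K `<=` X -> 0 < e -> exists f' g' : CX X, A (f', g') /\
     forall x, K x -> cabs (f' x - f x) < e /\ cabs (g' x - g x) < e) -> A (f, g).
Proof.
move=> h; split => /=.
- apply: locally_uniform_continuous => // K e cK sK e0.
  have [f' [g' [[/= cf _ _] hK]]] := h K e cK sK e0.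
  by exists f'; split => // x /hK[].
- apply: locally_uniform_continuous => // K e cK sK e0.
  have [f' [g' [[/= _ cg _] hK]]] := h K e cK sK e0.
  by exists g'; split => // x /hK[].
apply/closureP => K e cK sK e0; have e2 : 0 < e / 2 by rewrite divr_gt0.
have [f' [g' [[/= _ _ /closureP cl] hK]]] := h K _ cK sK e2.
have [f2 [g2 [A2 hK2]]] := cl K _ cK sK e2.
exists f2, g2; split => // x Kx; have [a1 a2] := hK x Kx; have [a3 a4] := hK2 x Kx.
by split; [apply: le_lt_trans (cabs_tri (f' x) _ _) _|apply: le_lt_trans (cabs_tri (g' x) _ _) _]; lra.
Qed.

Hypothesis A_closable : closable (Asharp X b sigma v).

Lemma generator_app (f : CX X) : dom A f -> A (f, app A f).
Proof. by move=> [g Ag]; exact: (xgetPex (fun=> 0) (ex_intro (fun g => A (f, g)) g Ag)). Qed.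

(** [app] picks some image by choice, and closability makes all images of the same function agree on
    [X]. *)
Lemma app_generator (f g : CX X) : A (f, g) -> forall x, X x -> app A f x = g x.
Proof.
move=> Ag x Xx; have := generator_app (ex_intro _ g Ag) => Af.
exact: (A_closable Af Ag).
Qed.

End generator_linear.

(** * The solution and the equivalences *)

Section solution.
Variables (R : realType) (n m : nat) (X : set 'rV[R]_n.+1).
Local Notation Rn := 'rV[R]_n.+1.
Local Notation C := (Cplx R).
Variables (b : Rn -> Rn) (sigma : Rn -> 'M[R]_(n.+1, m)).
Variable (v : Rn -> {measure set (borelRn R n) -> \bar R}).
Hypothesis oX : open X.
Hypothesis A_closable : closable (Asharp X b sigma v).
Local Notation A := (generator X b sigma v).
Variables (f0 : CX X) (rho : R).
Hypothesis rho0 : 0 < rho.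
Hypothesis iter_dom : forall k, dom A (iter k (app A) f0).
Hypothesis iter_sum : forall s : R, 0 <= s < rho ->
  forall K : set Rn, compact K -> K `<=` X ->
    uniform_series K (fun k x => s ^+ k / k`!%:R * cabs (iter k (app A) f0 x)).

Definition orbit (x : Rn) (k : nat) : C := iter k (app A) f0 x.

Lemma orbit_generator k : A ((fun x => orbit x k) : CX X, (fun x => orbit x k.+1) : CX X).
Proof. exact: generator_app (iter_dom k). Qed.

Lemma orbit_continuous k : continuous_on X (fun x => orbit x k).
Proof. have [/= cf _ _] := orbit_generator k; exact: cf. Qed.

(** Both partial sums lie within 1 of the limit, which itself comes without any bound; comparing
    them with each other avoids it. *)
Lemma uniform_series_bounded (T : choiceType) (D : set T) (w : nat -> T -> R) :
  uniform_series D w -> exists N, forall k y, D y -> (N <= k)%N ->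
    \sum_(0 <= i < k) w i y <= \sum_(0 <= i < N) w i y + 2.
Proof.
move=> [l hl].
have : nbhs (l : {uniform` D -> R}) [set h | forall y, D y -> `|l y - h y| < 1].
  apply/uniform_nbhs; exists [set z | `|z.1 - z.2| < 1]; split => //.
  by rewrite -entourage_ballE; exists 1 => //= -[].
move=> /hl [N _ hN]; exists N => k y Dy Nk.
have := hN k Nk y Dy; have := hN N (leqnn N) y Dy; rewrite /= !ltr_norml; lra.
Qed.

(** On [K] only finitely many continuous iterates have to be bounded one by one; all further terms
    together add at most 2. *)
Lemma orbit_sum_bounded (K : set Rn) (s : R) : compact K -> K `<=` X -> 0 <= s < rho ->
  exists M : R, forall x, K x -> forall k,
    \sum_(0 <= i < k) s ^+ i / i`!%:R * cabs (orbit x i) <= M.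
Proof.
move=> cK sK hs; have [N hN] := uniform_series_bounded (iter_sum hs cK sK).
have t0 i x : 0 <= s ^+ i / i`!%:R * cabs (orbit x i).
  by have /andP[s0 _] := hs; rewrite mulr_ge0 ?cabs_ge0// divr_ge0 ?exprn_ge0.
have [M hM] : exists M : R, forall x, K x -> \sum_(0 <= i < N) s ^+ i / i`!%:R * cabs (orbit x i) <= M.
  elim: N {hN} => [|N [M hM]]; first by exists 0 => x _; rewrite big_nil.
  have [M' hM'] := continuous_compact_bounded cK sK (orbit_continuous (k := N)).
  exists (M + s ^+ N / N`!%:R * M') => x Kx; rewrite big_nat_recr//= lerD ?hM//.
  by have /andP[s0 _] := hs; rewrite ler_wpM2l ?hM'// divr_ge0 ?exprn_ge0.
exists (M + 2) => x Kx k; have h := hM x Kx.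
have [Nk|/ltnW kN] := leqP N k; first by have := hN k x Kx Nk; rewrite /orbit in h *; lra.
apply: (@le_trans _ _ (\sum_(0 <= i < N) s ^+ i / i`!%:R * cabs (orbit x i))); last by lra.
by rewrite (big_cat_nat (leq0n k) kN)//= lerDl sumr_ge0.
Qed.

Lemma cabs_taylor (a : nat -> C) k : cabs (taylor a k) = (k`!%:R)^-1 * cabs (a k).
Proof. by rewrite /taylor cabsM cabsV cabs_nat. Qed.

Lemma orbit_taylor_bounded (K : set Rn) (s : R) : compact K -> K `<=` X -> 0 <= s < rho ->
  exists M : R, forall x, K x -> forall k, cabs (taylor (orbit x) k) * s ^+ k <= M.
Proof.
move=> cK sK hs; have [M hM] := orbit_sum_bounded cK sK hs; exists M => x Kx k.
apply: le_trans (hM x Kx k.+1); rewrite big_nat_recr//= cabs_taylor.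
rewrite (_ : _ * _ * _ = s ^+ k / k`!%:R * cabs (orbit x k)); last by ring.
rewrite lerDr sumr_ge0// => i _; have /andP[s0 _] := hs.
by rewrite mulr_ge0 ?cabs_ge0// divr_ge0 ?exprn_ge0.
Qed.

Lemma compact_point (x : Rn) : X x -> compact [set x] /\ [set x] `<=` X.
Proof. by move=> Xx; split; [exact: compact_set1|move=> _ ->]. Qed.

Lemma orbit_converges x : X x -> converges_in (taylor (orbit x)) rho.
Proof.
move=> Xx s /andP[s0 sr]; have [cx sx] := compact_point Xx.
have [|M hM] := @orbit_taylor_bounded _ s cx sx; first by rewrite ltW.
by exists M => k; exact: hM.
Qed.

Lemma orbit_majorant_bounded (K : set Rn) (s : R) : compact K -> K `<=` X -> 0 <= s < rho ->
  exists M : R, forall x, K x -> cRe (pval (taylor (majorant (orbit x))) (ofR s)) <= M.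
Proof.
move=> cK sK /[dup] hs /andP[s0 sr]; have [M hM] := orbit_sum_bounded cK sK hs; exists M => x Kx.
have mr : converges_in (taylor (majorant (orbit x))) rho.
  move=> t /(orbit_converges (sK x Kx))[M' hM']; exists M' => j; have := hM' j.
  by rewrite !cabs_taylor /majorant cabs_ofR ger0_norm ?cabs_ge0.
apply: le_trans (ler_norm _) _; apply: le_trans (normr_cRe _) _.
apply: (cabs_cvg_le _ (pval_cvg mr (z := ofR s) _)); first by rewrite cabs_ofR ger0_norm.
apply: nearW => k; apply: le_trans (cabs_sum _ _ _) _; apply: le_trans (hM x Kx k).
apply: ler_sum => i _; rewrite cabsM cabs_taylor cabsX !cabs_ofR !ger0_norm ?cabs_ge0//.
by rewrite le_eqVlt; apply/orP; left; apply/eqP; ring.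
Qed.

Definition power_solution (s : R) : CX X := fun x => pval (taylor (orbit x)) (ofR s).

Definition power_derivative (s : R) : CX X := fun x => pval (taylor (shift_seq (orbit x))) (ofR s).

Lemma partial_sum_generator (s : R) N :
  A ((fun x => series (fun k => taylor (orbit x) k * ofR s ^+ k) N) : CX X,
     (fun x => series (fun k => taylor (shift_seq (orbit x)) k * ofR s ^+ k) N) : CX X).
Proof.
elim: N => [|N IH].
  apply: generator_ext (generator_lincomb oX 0 0 (orbit_generator 0) (orbit_generator 0)) => // x _.
    by rewrite /lincomb /series /= big_nil !mul0r addr0.
  by rewrite /lincomb /series /= big_nil !mul0r addr0.
apply: (generator_ext oX _ _ (generator_lincomb oX 1 (N`!%:R^-1 * s ^+ N) IH (orbit_generator N))) => x _.
  rewrite /lincomb /series /= big_nat_recr//= mul1r; congr (_ + _).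
  by rewrite /taylor ofRM ofRV ofR_nat ofRX mulrAC.
rewrite /lincomb /series /= big_nat_recr//= mul1r; congr (_ + _).
by rewrite /taylor /shift_seq ofRM ofRV ofR_nat ofRX mulrAC.
Qed.

Lemma geometric_small (q M e : R) : 0 <= q < 1 -> 0 < e ->
  exists N, forall k, (N <= k)%N -> `|M| * q ^+ k / (1 - q) < e.
Proof.
move=> /andP[q0 q1] e0.
have : (fun k => `|M| / (1 - q) * q ^+ k) @ \oo --> `|M| / (1 - q) * 0.
  by apply: cvgMl_tmp; apply: cvg_expr; rewrite ger0_norm.
rewrite mulr0 => /cvgrPdist_lt /(_ _ e0) [N _ hN]; exists N => k Nk.
have := hN k Nk; rewrite sub0r normrN => /(le_lt_trans (ler_norm _)).
by rewrite mulrAC.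
Qed.

Lemma pval_uniform_tail (T : Type) (D : set T) (c : T -> nat -> C) (r M w1 e : R) :
  0 <= w1 < r -> 0 < e -> (forall y, D y -> forall k, cabs (c y k) * r ^+ k <= M) ->
  exists N, forall k, (N <= k)%N -> forall y, D y -> forall z, cabs z <= w1 ->
    cabs (series (fun j => c y j * z ^+ j) k - pval (c y) z) < e.
Proof.
move=> /andP[w0 wr] e0 hM; have r0 : 0 < r := le_lt_trans w0 wr.
have q01 : 0 <= w1 / r < 1 by rewrite divr_ge0 ?(ltW r0)//= ltr_pdivrMr// mul1r.
have [N hN] := geometric_small M q01 e0; exists N => k Nk y Dy z zw.
have zr := le_lt_trans zw wr.
rewrite cabsC; apply: le_lt_trans (pval_tail zr (hM y Dy) k) _.
apply: le_lt_trans (hN k Nk).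
have M0 : 0 <= M by apply: le_trans (hM y Dy 0%N); rewrite expr0 mulr1 cabs_ge0.
have zq : cabs z / r <= w1 / r by rewrite ler_pM2r ?invr_gt0.
have z0 : 0 <= cabs z / r by rewrite divr_ge0 ?cabs_ge0 ?(ltW r0).
have /andP[q0 q1] := q01.
rewrite ger0_norm//; apply: ler_pM.
- by rewrite mulr_ge0// exprn_ge0.
- by rewrite invr_ge0; lra.
- by rewrite ler_wpM2l// lerXn2r// nnegrE.
- by rewrite lef_pV2 ?posrE; lra.
Qed.

(** The partial sums and their images under the operator both converge uniformly on compacta, so
    closedness applies to the limits. *)
Lemma power_solution_generator s : 0 <= s < rho -> A (power_solution s, power_derivative s).
Proof.
move=> /andP[s0 sr]; apply: generator_closed => // K e cK sK e0.
(* From [s < s1 < s2 < rho]: the coefficients are bounded at [s2], and the differentiated ones at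
   [s1] by [dcoef_bound]. *)
pose s2 := (s + 2 * rho) / 3; pose s1 := (2 * s + rho) / 3.
have hs2 : 0 <= s2 < rho by rewrite /s2; lra.
have [M hM] := orbit_taylor_bounded cK sK hs2.
have s01 : 0 <= s < s2 by rewrite /s2; lra.
have [N1 h1] := pval_uniform_tail s01 e0 hM.
have s12 : 0 <= s1 < s2 by rewrite /s2 /s1; lra.
have s02 : 0 <= s < s1 by rewrite /s1; lra.
have hM' x : K x -> forall k, cabs (taylor (shift_seq (orbit x)) k) * s1 ^+ k <= M / (s2 - s1).
  by move=> Kx; rewrite -dcoef_taylor; apply: dcoef_bound => // k; exact: hM.
have [N2 h2] := pval_uniform_tail s02 e0 hM'.
pose N := maxn N1 N2.
have zs : cabs (ofR s) <= s by rewrite cabs_ofR ger0_norm.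
exists (fun x => series (fun k => taylor (orbit x) k * ofR s ^+ k) N),
  (fun x => series (fun k => taylor (shift_seq (orbit x)) k * ofR s ^+ k) N).
split; first exact: partial_sum_generator.
move=> x Kx; split.
  by apply: h1 => //; exact: leq_maxl.
by apply: h2 => //; exact: leq_maxr.
Qed.

Lemma rcdiff_quotient (U : R -> C) (J : set R) (s : R) (l : C) : rcdiff U s l ->
  (ofR (t - s)^-1 * (U t - U s)) @[t --> within J s^'] --> l.
Proof.
move=> Ul; apply/cvg_cabsP => e e0.
have [d d0 hd] := Ul (e / 2) ltac:(by rewrite divr_gt0).
rewrite near_withinE /dnbhs near_withinE; apply/nbhs_ballP; exists d => // t.
rewrite /ball /= distrC => ts nts _.
have ts0 : t - s != 0 by rewrite subr_eq0.
have := hd _ ts; rewrite subrKC => h.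
have n0 : 0 < `|t - s| by rewrite normr_gt0.
have ofR0' : ofR (t - s) != 0 :> C by rewrite -cabs_gt0 cabs_ofR.
rewrite (_ : _ - l = (ofR (t - s))^-1 * (U t - U s - l * ofR (t - s))); last first.
  by move: ofR0'; rewrite ofRV; move: (ofR (t - s)) => D D0; field.
rewrite cabsM cabsV cabs_ofR mulrC ltr_pdivrMr//; apply: le_lt_trans h _.
by rewrite ltr_pM2r//; lra.
Qed.

(** Differentiating the power series in [s] shifts its sequence, and so does applying the
    operator. *)
Lemma power_solution_cauchy : cauchy_solution A `[0, rho[ f0 power_solution.
Proof.
split=> [x Xx|s]; first by rewrite /power_solution pval0 /taylor fact0 invr1 mul1r.
rewrite /= in_itv /= => hs; have As := power_solution_generator hs.
split; first by exists (power_derivative s).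
move=> x Xx; rewrite (app_generator A_closable As Xx).
apply: (rcdiff_quotient (U := fun t => power_solution t x)).
have /andP[s0 sr] := hs.
have h := pval_cdiff (orbit_converges Xx) (z := ofR s) ltac:(by rewrite cabs_ofR ger0_norm).
have := cdiff_rcdiff (rcdiff_ofR s) h.
by rewrite mulr1 dcoef_taylor.
Qed.

Lemma cauchy_solution_restrict (J J' : set R) p : J' `<=` J ->
  cauchy_solution A J f0 p -> cauchy_solution A J' f0 p.
Proof.
move=> JJ [p0 ps]; split => // s /JJ /ps[ds hs]; split => // x /hs h.
apply: cvg_trans h; apply: cvg_app => P hP.
by apply: (@filterS _ s^' _ [set t | J t -> P t] [set t | J' t -> P t]) hP => t ht /JJ; exact: ht.
Qed.

Lemma solution_power_series (p : R -> CX X) : cauchy_solution A `[0, +oo[ f0 p ->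
  cauchy_unique A `[0, rho[ f0 ->
  forall s x, 0 <= s < rho -> X x -> p s x = pval (taylor (orbit x)) (ofR s).
Proof.
move=> hp uniq s x hs Xx.
apply: (uniq p power_solution) => //.
- by apply: cauchy_solution_restrict hp => t /=; rewrite !in_itv /= andbT => /andP[].
- exact: power_solution_cauchy.
Qed.

Section coefficients.
Variable eta : R.

Lemma rising_generator k j :
  A ((fun x => rising (ofR eta^-1) (orbit x) k j) : CX X,
     (fun x => rising (ofR eta^-1) (orbit x) k j.+1) : CX X).
Proof.
elim: k j => [|k IH] j; first exact: orbit_generator.
apply: (generator_ext oX _ _ (generator_lincomb oX eta^-1 k%:R (IH j.+1) (IH j))) => x _ /=.
  by rewrite /lincomb ofR_nat.
by rewrite /lincomb ofR_nat.
Qed.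

(** Since [app] is determined on [X] only, [shifted_prod] is first placed in the graph by
    [generator_ext], and its image is then read off on [X]. *)
Lemma shifted_prod_rising k x : X x -> shifted_prod A eta f0 k x = rising (ofR eta^-1) (orbit x) k 0.
Proof.
elim: k x => [//|k IH] x Xx /=; rewrite IH//; congr (_ * _ + _).
have Ak : A (shifted_prod A eta f0 k, (fun x => rising (ofR eta^-1) (orbit x) k 1) : CX X).
  by apply: (generator_ext oX _ _ (rising_generator k 0)) => // y Xy; rewrite IH.
exact: (app_generator A_closable Ak Xx).
Qed.

Lemma qcoefE k x : X x -> qcoef A eta f0 k x = qseq eta (orbit x) k.
Proof. by move=> Xx; rewrite /qcoef /qseq shifted_prod_rising. Qed.

Hypothesis eta0 : 0 < eta.

Lemma qseq_uniform (K : set Rn) (w1 e : R) : compact K -> K `<=` X ->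
  0 <= w1 < 1 - expR (- eta * rho) -> 0 < e ->
  exists N, forall k, (N <= k)%N -> forall x, K x -> forall z, cabs z <= w1 ->
    cabs (series (fun j => qseq eta (orbit x) j * z ^+ j) k - pval (qseq eta (orbit x)) z) < e.
Proof.
move=> cK sK /andP[w0 wW] e0.
have w11 : w1 < 1 by apply: lt_trans wW _; exact: one_sub_exp_lt1.
(* The radius [w1] corresponds to a time [t < rho]. At any time [s] strictly between them the radius
   $1-e^{-\eta s}$ exceeds [w1], and [qseq_le] bounds the terms there uniformly on [K]. *)
pose t := eta^-1 * - ln (1 - w1).
have tw : 1 - expR (- eta * t) = w1.
  by rewrite /t mulNr mulrA mulfV ?gt_eqF// mul1r opprK lnK ?posrE ?subKr//; lra.
have t0 : 0 <= t by rewrite /t mulr_ge0 ?invr_ge0 ?(ltW eta0)// oppr_ge0 ln_le0//; lra.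
have tr : t < rho.
  rewrite ltNge; apply/negP => rt; suff : 1 - expR (- eta * rho) <= w1 by lra.
  by rewrite -tw lerD2l lerN2 ler_expR !mulNr lerN2 ler_pM2l.
pose s := (t + rho) / 2.
have hs : 0 <= s < rho by rewrite /s; lra.
have [M hM] := orbit_majorant_bounded cK sK hs.
apply: (@pval_uniform_tail _ K (fun x => qseq eta (orbit x)) (1 - expR (- eta * s)) M) => //.
  by rewrite w0 /= -tw one_sub_exp_lt// /s; lra.
move=> x Kx k; apply: le_trans (hM x Kx).
exact: (qseq_le k eta0 (orbit_converges (sK x Kx)) hs).
Qed.

End coefficients.

(** * The implications between the three assertions *)

Section equivalences.
Variable p : R -> CX X.
Hypothesis p_sol : cauchy_solution A `[0, +oo[ f0 p.
Hypothesis p_unique : cauchy_unique A `[0, rho[ f0.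

Lemma qcoef_series eta x (w : C) : X x ->
  series (fun k => qcoef A eta f0 k x * w ^+ k) = series (fun k => qseq eta (orbit x) k * w ^+ k).
Proof. by move=> Xx; congr series; apply/funext => k; rewrite qcoefE. Qed.

Lemma qcoef_sum eta x (w : C) N : X x ->
  \sum_(0 <= k < N) qcoef A eta f0 k x * w ^+ k = series (fun k => qseq eta (orbit x) k * w ^+ k) N.
Proof. by move=> Xx; rewrite /series /=; apply: eq_bigr => k _; rewrite qcoefE. Qed.

Lemma expansion_uniform eta (K : set (Rn * R)) : 0 < eta -> compact K ->
  K `<=` [set y | X y.1 /\ 0 <= y.2 < rho] ->
  uniform_series K (fun k y => qcoef A eta f0 k y.1 * ofR (1 - expR (- eta * y.2)) ^+ k).
Proof.
move=> e0 cK sK; apply/uniform_seriesP.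
exists (fun y => pval (qseq eta (orbit y.1)) (ofR (1 - expR (- eta * y.2)))) => e e_gt0.
have cK1 : compact (fst @` K).
  by apply: continuous_compact => //; apply: continuous_subspaceT => y; exact: cvg_fst.
have sK1 : fst @` K `<=` X by move=> _ [y /sK[Xy _] <-].
have [[y0 Ky0]|K0] := pselect (K !=set0); last first.
  by exists 0%N => k _ y Ky; exfalso; apply: K0; exists y.
(* The largest time in [K] is attained, hence strictly below [rho], and confines all arguments to
   one smaller disc. *)
have [|c cinK hc] := @compact_EVT_max _ R (fun y : Rn * R => y.2) K (ex_intro _ y0 Ky0) cK.
  by apply: continuous_subspaceT => y; exact: cvg_snd.
move: cinK; rewrite inE => /sK[_ /andP[c0 cr]].
have hw : 0 <= 1 - expR (- eta * c.2) < 1 - expR (- eta * rho).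
  by rewrite one_sub_exp_ge0// one_sub_exp_lt.
have [N hN] := qseq_uniform e0 cK1 sK1 hw e_gt0.
exists N => k Nk y Ky; have [Xy /andP[y20 y2r]] := sK y Ky.
rewrite qcoef_sum//; apply: hN => //; first by exists y.
rewrite cabs_ofR ger0_norm ?one_sub_exp_ge0// lerD2l lerN2 ler_expR !mulNr lerN2 ler_pM2l//.
by apply: hc; rewrite inE.
Qed.

Lemma strip_to_expansion : strip_extension X p -> exponential_expansion A f0 rho p.
Proof.
(* This choice meets the condition [3 <= eta * r] of [mercator_strip] with equality. *)
move=> [r [r0 hr]]; pose eta := 3 / r.
have eta0 : 0 < eta by rewrite divr_gt0.
exists eta; split => //; split; last by move=> K cK sK; exact: expansion_uniform.
move=> x Xx s s0; have [F [Fh FP]] := hr x Xx; rewrite qcoef_series//.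
apply: (strip_expansion eta0 rho0 r0 _ (orbit_converges Xx) _ Fh FP) => //.
  by rewrite /eta mulfVK ?gt_eqF.
by move=> t ht; exact: solution_power_series p_sol p_unique _ _ ht Xx.
Qed.

Lemma extension_holomorphic (eta d : R) x : 0 < eta ->
  (forall eta z, 0 < eta -> disc_strip (d / eta) z -> cabs (1 - cexp (- (ofR eta * z))) < 1) ->
  converges_in (qseq eta (orbit x)) 1 ->
  holomorphic_on (disc_strip (d / eta))
    (fun z => pval (qseq eta (orbit x)) (1 - cexp (- (ofR eta * z)))).
Proof.
move=> e0 hd qr; split; first exact: disc_strip_open.
by move=> z hz; apply/derivable_cdiff; exact: qseries_cdiff qr (hd _ _ e0 hz).
Qed.

Lemma expansion_to_strip : exponential_expansion A f0 rho p -> strip_extension X p.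
Proof.
move=> [eta [e0 [hexp _]]]; have [d d0 hd] := @scaled_one_sub_cexp R.
exists (d / eta); split; first by rewrite divr_gt0.
move=> x Xx; have hx s : 0 <= s ->
    series (fun k => qseq eta (orbit x) k * ofR (1 - expR (- eta * s)) ^+ k) @ \oo --> (p s x : C).
  by move=> s0; have := hexp x Xx s s0; rewrite qcoef_series.
have qr := expansion_converges e0 hx.
exists (fun z => pval (qseq eta (orbit x)) (1 - cexp (- (ofR eta * z)))); split.
  exact: extension_holomorphic.
by move=> s s0; rewrite one_sub_cexp_ofR; apply: pval_unique; exact: hx.
Qed.

Lemma disc_strip_real (r s : R) : 0 < r -> 0 <= s -> disc_strip r (ofR s).
Proof.
move=> r0; rewrite le_eqVlt => /predU1P[<-|s0]; first by left; rewrite /= cabs0.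
by right; split; rewrite //= normr0.
Qed.

Lemma expansion_to_disc : exponential_expansion A f0 rho p -> unit_disc_expansion A f0 p.
Proof.
move=> hexp; have [r [r0 hr]] := expansion_to_strip hexp.
split.
  move=> x Xx s0 s00; have [F [Fh FP]] := hr x Xx.
  exists (disc_strip r), F; split => //; first exact: disc_strip_real.
  by move=> s hs _; exact: FP.
have [eta [e0 [hx _]]] := hexp; exists eta; split => //; split.
  move=> x Xx; under eq_fun do rewrite qcoefE//.
  apply/root_test; apply: (expansion_converges e0 (P := fun s => p s x)) => s s0.
  by have := hx x Xx s s0; rewrite qcoef_series.
(* The disc of radius [1 - eps] corresponds to times up to [rho / 2], well inside the range where
   [qseq_uniform] applies. *)
exists (expR (- eta * (rho / 2))).
have er : expR (- eta * (rho / 2)) < 1 by rewrite expR_lt1 mulNr oppr_lt0 mulr_gt0// divr_gt0.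
split; first by rewrite expR_gt0.
move=> K cK sK; apply/uniform_seriesP.
exists (fun y => pval (qseq eta (orbit y.1)) y.2) => e e_gt0.
have cK1 : compact (fst @` K).
  by apply: continuous_compact => //; apply: continuous_subspaceT => y; exact: cvg_fst.
have sK1 : fst @` K `<=` X by move=> _ [y /sK[Xy _] <-].
have hw : 0 <= 1 - expR (- eta * (rho / 2)) < 1 - expR (- eta * rho).
  by rewrite one_sub_exp_ge0 ?divr_ge0 ?(ltW rho0)//= one_sub_exp_lt// ltr_pdivrMr// ltr_pMr// ltr1n.
have [N hN] := qseq_uniform e0 cK1 sK1 hw e_gt0.
exists N => k Nk y Ky; have [Xy yw] := sK y Ky.
by rewrite qcoef_sum//; apply: hN => //; [exists y|exact: ltW].
Qed.

(** The neighbourhoods given by (iii) may shrink from point to point, so the solution and the series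
    [P2] share no evident complex domain; they are compared along the half-line, starting from their
    agreement on $[0,\rho)$. *)
Lemma disc_to_expansion : unit_disc_expansion A f0 p -> exponential_expansion A f0 rho p.
Proof.
move=> [hol [eta [e0 [hroot _]]]]; exists eta; split => //; split; last first.
  by move=> K cK sK; exact: expansion_uniform.
move=> x Xx.
have qr : converges_in (qseq eta (orbit x)) 1.
  by apply/root_test; have := hroot x Xx; under eq_fun do rewrite qcoefE//.
have [d d0 hd] := @scaled_one_sub_cexp R.
have de0 : 0 < d / eta by rewrite divr_gt0.
pose P2 s := pval (qseq eta (orbit x)) (ofR (1 - expR (- eta * s))).
have an1 s : 0 <= s -> locally_analytic (fun s => p s x) s.
  move=> s0; have [D [F [Ds Fh FP]]] := hol x Xx s s0.
  exact: holomorphic_locally_analytic Ds Fh FP.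
have an2 s : 0 <= s -> locally_analytic P2 s.
  move=> s0; apply: (holomorphic_locally_analytic (disc_strip_real de0 s0) (extension_holomorphic e0 hd qr)).
  by move=> t t0 _; rewrite one_sub_cexp_ofR.
have eqP s : 0 <= s < rho -> p s x = P2 s.
  move=> hs; rewrite (solution_power_series p_sol p_unique hs Xx).
  exact: taylor_expansion e0 (orbit_converges Xx) hs.
move=> s s0; rewrite (analytic_continuation rho0 an1 an2 eqP s0) qcoef_series//.
by apply: pval_cvg qr _; rewrite cabs_ofR ger0_norm ?one_sub_exp_ge0// one_sub_exp_lt1.
Qed.

End equivalences.

End solution.

Theorem theorem3p3 (R : realType) (n m : nat) (X : set 'rV[R]_n.+1)
    (b : 'rV[R]_n.+1 -> 'rV[R]_n.+1)
    (sigma : 'rV[R]_n.+1 -> 'M[R]_(n.+1, m))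
    (v : 'rV[R]_n.+1 -> {measure set (borelRn R n) -> \bar R})
    (I : Type) (f : I -> 'rV[R]_n.+1 -> Cplx R) (rad : I -> R)
    (X_open : open X)
    (coef_ok : coefficients_ok b sigma v)
    (A_closable : closable (Asharp X b sigma v))
    (f_smooth : forall u, bounded_smooth (f u))
    (f_dense : dense_family X f)
    (well_posed : forall u, cauchy_well_posed (generator X b sigma v) (f u))
    (f_analytic : analytic_vectors (generator X b sigma v) f rad)
    (u : I) (p : R -> 'rV[R]_n.+1 -> Cplx R)
    (p_sol : cauchy_solution (generator X b sigma v) `[0, +oo[ (f u) p) :
  (strip_extension X p <->
   exponential_expansion (generator X b sigma v) (f u) (rad u) p) /\
  (exponential_expansion (generator X b sigma v) (f u) (rad u) p <->
   unit_disc_expansion (generator X b sigma v) (f u) p).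
Proof.
have [f_dom /(_ u)[rad0 f_sum]] := f_analytic.
have sum_u (s : R) (hs : 0 <= s < rad u) := (f_sum s hs).2.
have [_ _ /(_ (rad u) rad0) p_unique] := well_posed u.
split; split.
- exact: strip_to_expansion p_sol p_unique.
- exact: expansion_to_strip.
- exact: expansion_to_disc.
- exact: disc_to_expansion p_sol p_unique.
Qed.
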